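(* Let $\gamma\in(0,1]$ be given. The intermittent phase $\mathcal{I}(\gamma)$ contains the zero function $\mathbf{0}$ and it is therefore nonempty. In the case where $\alpha<1$ and $\gamma>\alpha$, we have $\mathcal{I}(\gamma)=C^\gamma(\mathbb{R})$ and $\mathcal{S}(\gamma)=\emptyset$. In the remaining case where $\gamma\le\alpha$, the stationary phase $\mathcal{S}(\gamma)$ is nonempty and the following properties hold. 1. The intermittent phase $\mathcal{I}(\gamma)$ is star-convex at $\mathbf{0}$. In particular, $\mathcal{I}(\gamma)$ is connected. 2. The stationary phase $\mathcal{S}(\gamma)$ is unbounded, convex, and coincides with the interior of $$\{\varphi\in C^\gamma(\mathbb{R}):\delta_0\text{ is a Gibbs state of }f\text{ for the potential }\varphi\}.$$ In particular, $\mathcal{S}(\gamma)$ is connected. 3. Each of the phases $\mathcal{I}(\gamma)$ and $\mathcal{S}(\gamma)$ is a regular open set. Furthermore, these sets are disjoint and their union is dense in $C^\gamma(\mathbb{R})$. In particular, we have $$\partial\mathcal{I}(\gamma)=\partial\mathcal{S}(\gamma)=C^\gamma(\mathbb{R})\setminus(\mathcal{I}(\gamma)\cup\mathcal{S}(\gamma)).$$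
   Context: Fix $\alpha\in(0,+\infty)$ and let $f\colon[0,1]\to[0,1]$ be the intermittent map given by $f(x)=x(1+x^{\alpha})$ if $x(1+x^{\alpha})\le 1$, and $f(x)=x(1+x^{\alpha})-1$ otherwise. Let $\mathscr{M}$ be the set of Borel probability measures on $[0,1]$ invariant by $f$; for $\nu\in\mathscr{M}$ let $h_\nu$ be its measure-theoretic entropy. For $\gamma\in(0,1]$, $C^{\gamma}(\mathbb{R})$ is the Banach space of real-valued $\gamma$-Hölder continuous functions on $[0,1]$ with norm $\|\varphi\|_\gamma=\|\varphi\|+|\varphi|_\gamma$, where $\|\varphi\|=\sup_{[0,1]}|\varphi|$ and $|\varphi|_\gamma=\sup_{x\ne y}|\varphi(x)-\varphi(y)|/|x-y|^\gamma$; topological notions (interior, boundary, density) for subsets refer to this norm. For a continuous $\varphi\colon[0,1]\to\mathbb{R}$ (a potential), the pressure is $P(\varphi)=\sup\{h_\nu+\int\varphi\,d\nu:\nu\in\mathscr{M}\}$, and a Gibbs state of $f$ for $\varphi$ is a measure in $\mathscr{M}$ attaining this supremum. $\delta_0$ is the Dirac mass at $0$. A measure $\nu\in\mathscr{M}$ is exponentially mixing if there are $C\in(0,+\infty)$ and $\rho\in(0,1)$ such that for every bounded measurable $\psi\colon[0,1]\to\mathbb{R}$, every Lipschitz $\tilde\psi\colon[0,1]\to\mathbb{R}$ and every $n\in\mathbb{N}$, $|\int\psi\circ f^n\cdot\tilde\psi\,d\nu-\int\psi\,d\nu\int\tilde\psi\,d\nu|\le C\|\psi\|\,|\tilde\psi|_1\,\rho^n$.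 The intermittent phase $\mathcal{I}(\gamma)$ is the set of $\varphi\in C^\gamma(\mathbb{R})$ for which there is an exponentially mixing Gibbs state of strictly positive entropy. The stationary phase $\mathcal{S}(\gamma)$ is the interior of the set of $\varphi\in C^\gamma(\mathbb{R})$ for which $\delta_0$ is the unique Gibbs state. A subset of a topological space is a regular open set if it equals the interior of its closure. *)

(* Defs.v *)
From HB Require Import structures.
From mathcomp Require Import all_boot all_order all_algebra.
From mathcomp Require Import ring lra.
From mathcomp Require Import all_classical all_reals all_analysis.

Set Implicit Arguments.
Unset Strict Implicit.
Unset Printing Implicit Defensive.

Import Order.TTheory GRing.Theory Num.Theory.
Import numFieldNormedType.Exports.

Local Open Scope classical_set_scope.
Local Open Scope ring_scope.

Definition boundary (T : topologicalType) (A : set T) : set T :=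
  closure A `\` A°.

Definition star_convex (R : numDomainType) (M : lmodType R) (x0 : M)
    (A : set M) : Prop :=
  forall (x : M) (t : R), A x -> 0 <= t <= 1 -> A ((1 - t) *: x0 + t *: x).

Section entropy.
Context d (T : measurableType d) (R : realType).
Implicit Types (nu : probability T R) (f : T -> T).

Definition invariant_measure f nu : Prop :=
  forall A, measurable A -> pushforward nu f A = nu A.

Definition measurable_partition k (P : 'I_k -> set T) : Prop :=
  [/\ forall i, measurable (P i),
      trivIset setT P
    & \bigcup_i P i = setT].

(* The atoms of the join of P, f^-1 P, ..., f^-(n-1) P, indexed by words of
   length n. *)
Definition join_atom f k (P : 'I_k -> set T) n (w : {ffun 'I_n -> 'I_k}) :
    set T :=
  [set x | forall i : 'I_n, P (w i) (iter i f x)].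

(* The convention 0 log 0 = 0 holds whatever the value of ln 0. *)
Definition join_entropy nu f k (P : 'I_k -> set T) n : R :=
  \sum_(w : {ffun 'I_n -> 'I_k})
    - (fine (nu (join_atom f P w)) * ln (fine (nu (join_atom f P w)))).

Definition partition_entropy nu f k (P : 'I_k -> set T) : R :=
  limn (fun n => join_entropy nu f P n / n%:R).

Definition entropy f nu : \bar R :=
  ereal_sup [set h | exists k (P : 'I_k -> set T),
    measurable_partition P /\ h = (partition_entropy nu f P)%:E].

End entropy.

Section unit_interval.
Variable R : realType.

Definition unit_itv : Type := set_type `[0 : R, 1 : R]%classic.

Lemma unit_itv_mem (x : R) : 0 <= x <= 1 -> x \in `[0 : R, 1 : R]%classic.
Proof. by move=> x01; rewrite inE /= in_itv. Qed.

Definition unit_itv0 : unit_itv :=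
  exist _ 0 (unit_itv_mem (introT andP (conj (lexx 0) ler01))).

Definition unit_itv1 : unit_itv :=
  exist _ 1 (unit_itv_mem (introT andP (conj ler01 (lexx 1)))).

Lemma unit_itv10 : unit_itv1 != unit_itv0.
Proof. by apply/negP => /eqP /(congr1 val) /= /eqP; rewrite oner_eq0. Qed.

HB.instance Definition _ := PseudoMetric.copy unit_itv
  (set_type `[0 : R, 1 : R]%classic).
HB.instance Definition _ := isPointed.Build unit_itv unit_itv0.

(* The Borel sigma-algebra of [0,1]. *)
HB.instance Definition _ := Measurable.copy unit_itv
  (g_sigma_algebraType (@open unit_itv)).

Lemma unit_itvP (x : unit_itv) : 0 <= val x <= 1.
Proof. by case: x => x /=; rewrite inE /= in_itv. Qed.

End unit_interval.

Section intermittent_map.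
Context {R : realType} (alpha : {posnum R}).

Definition intermittent_fun (x : R) : R :=
  let y := x * (1 + x `^ alpha%:num) in if y <= 1 then y else y - 1.

Lemma intermittent_fun01 (x : R) : 0 <= x <= 1 -> 0 <= intermittent_fun x <= 1.
Proof.
move=> /andP[x0 x1]; rewrite /intermittent_fun /=.
have p0 : 0 <= x `^ alpha%:num by exact: powR_ge0.
have p1 : x `^ alpha%:num <= 1.
  by rewrite -[leRHS](congr1 (@^~ alpha%:num) (@powR1 R)) ge0_ler_powR ?nnegrE.
by case: ifP => /= [h|/negbT]; rewrite -?ltNge; nra.
Qed.

Definition intermittent_map (x : unit_itv R) : unit_itv R :=
  exist _ (intermittent_fun (val x))
    (unit_itv_mem (intermittent_fun01 (unit_itvP x))).

End intermittent_map.

Section holder_condition.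
Context {R : realType}.
Implicit Types (g C : R) (phi : unit_itv R -> R).

Definition holder_with g phi C : Prop :=
  forall x y, `|phi x - phi y| <= C * `|val x - val y| `^ g.

Definition is_holder g phi : Prop := exists C, holder_with g phi C.

Definition sup_norm phi : R := sup (range (fun x => `|phi x|)).

Definition holder_seminorm g phi : R :=
  sup [set `|phi p.1 - phi p.2| / `|val p.1 - val p.2| `^ g
      | p in [set p : unit_itv R * unit_itv R | p.1 != p.2]].

Lemma unit_itv_dist_gt0 (x y : unit_itv R) : x != y -> 0 < `|val x - val y|.
Proof.
move=> xy; rewrite normr_gt0 subr_eq0; apply: contra xy => /eqP xy.
by apply/eqP/val_inj.
Qed.

Lemma sup_norm_le phi M : (forall x, `|phi x| <= M) -> sup_norm phi <= M.
Proof.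
by move=> h; apply: ge_sup; [exists `|phi point|, point|move=> _ [x _ <-]].
Qed.

Lemma holder_seminorm_le g phi C :
  holder_with g phi C -> holder_seminorm g phi <= C.
Proof.
move=> h; apply: ge_sup.
  by eexists; exists (unit_itv1 R, unit_itv0 R); first exact: unit_itv10.
move=> _ [[x y] /= xy <-].
by rewrite ler_pdivrMr ?powR_gt0 ?unit_itv_dist_gt0.
Qed.

Lemma le_holder_seminorm g phi : g != 0 -> is_holder g phi ->
  holder_with g phi (holder_seminorm g phi).
Proof.
move=> g0 [C hC] x y; have [->|xy] := eqVneq x y.
  by rewrite !subrr normr0 powR0// mulr0.
rewrite -ler_pdivrMr ?powR_gt0 ?unit_itv_dist_gt0//.
apply: ub_le_sup; last by exists (x, y).
exists C => _ [[u v] /= uv <-].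
by rewrite ler_pdivrMr ?powR_gt0 ?unit_itv_dist_gt0.
Qed.

Lemma holder_seminorm_ge0 g phi : g != 0 -> is_holder g phi ->
  0 <= holder_seminorm g phi.
Proof.
move=> g0 /(le_holder_seminorm g0)/(_ (unit_itv1 R) (unit_itv0 R)).
apply: contraTT; rewrite -!ltNge => s_lt0.
rewrite (lt_le_trans _ (normr_ge0 _))// pmulr_llt0// powR_gt0//.
exact/unit_itv_dist_gt0/unit_itv10.
Qed.

Lemma is_holder_bounded g phi : 0 < g -> is_holder g phi ->
  exists M, forall x, `|phi x| <= M.
Proof.
move=> g0 [C hC]; exists (`|phi point| + `|C|) => x.
rewrite -lerBlDl; apply: le_trans (lerB_dist _ _) _; apply: le_trans (hC _ _) _.
apply: le_trans (ler_wpM2r (powR_ge0 _ _) (ler_norm C)) _.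
rewrite -[leRHS]mulr1 ler_wpM2l//.
rewrite -[leRHS](congr1 (@^~ g) (@powR1 R)) ge0_ler_powR ?nnegrE//.
  exact: ltW.
have /= := unit_itvP x; have /= := unit_itvP (@point (unit_itv R)).
by move=> /andP[? ?] /andP[? ?]; rewrite ler_norml; apply/andP; split; lra.
Qed.

Lemma le_sup_norm g phi : 0 < g -> is_holder g phi ->
  forall x, `|phi x| <= sup_norm phi.
Proof.
move=> g0 /(is_holder_bounded g0)[M hM] x; apply: ub_le_sup; last by exists x.
by exists M => _ [y _ <-].
Qed.

End holder_condition.

Section holder_space.
Context {R : realType} (gamma : {posnum R}).

Definition holder_pred : {pred unit_itv R -> R^o} :=
  mem [set phi : unit_itv R -> R^o | is_holder gamma%:num phi].

Record holder : Type := Holder {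
  holder_fun :> unit_itv R -> R^o ;
  _ : holder_fun \in holder_pred }.

HB.instance Definition _ := [isSub for holder_fun].
HB.instance Definition _ := gen_eqMixin holder.
HB.instance Definition _ := gen_choiceMixin holder.

Lemma holder_submod_closed : submod_closed holder_pred.
Proof.
split=> [|a u v]; rewrite !inE.
  by exists 0 => x y; rewrite /= subrr normr0 mul0r.
move=> [C hC] [E hE]; exists (`|a| * C + E) => x y.
have -> : (a *: u + v) x - (a *: u + v) y = a * (u x - u y) + (v x - v y).
  by rewrite !fctE /GRing.scale /=; ring.
apply: le_trans (ler_normD _ _) _; rewrite normrM mulrDl -mulrA.
by rewrite lerD// ler_wpM2l.
Qed.

HB.instance Definition _ :=
  GRing.isSubmodClosed.Build R (unit_itv R -> R^o) holder_pred
    holder_submod_closed.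
HB.instance Definition _ := [SubChoice_isSubLmodule of holder by <:].

Lemma holderP (phi : holder) : is_holder gamma%:num phi.
Proof. by case: phi => phi; rewrite /= inE. Qed.

Definition holder_norm (phi : holder) : R :=
  sup_norm phi + holder_seminorm gamma%:num phi.

Let g_gt0 : 0 < gamma%:num. Proof. by []. Qed.
Let g_neq0 : gamma%:num != 0. Proof. by []. Qed.

Lemma holder_normD phi psi :
  holder_norm (phi + psi) <= holder_norm phi + holder_norm psi.
Proof.
rewrite /holder_norm addrACA lerD//.
  apply: sup_norm_le => x; apply: le_trans (ler_normD _ _) _.
  by rewrite lerD// (le_sup_norm g_gt0)//; exact: holderP.
apply: holder_seminorm_le => x y.
have -> : (phi + psi : holder) x - (phi + psi : holder) y =
    (phi x - phi y) + (psi x - psi y) by rewrite /= !fctE; ring.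
apply: le_trans (ler_normD _ _) _; rewrite mulrDl.
by rewrite lerD//; apply: (le_holder_seminorm g_neq0); exact: holderP.
Qed.

Lemma holder_normZ_le (a : R) phi :
  holder_norm (a *: phi) <= `|a| * holder_norm phi.
Proof.
rewrite /holder_norm mulrDr lerD//.
  apply: sup_norm_le => x; rewrite /= !fctE normrM.
  by rewrite ler_wpM2l// (le_sup_norm g_gt0)//; exact: holderP.
apply: holder_seminorm_le => x y.
have -> : (a *: phi : holder) x - (a *: phi : holder) y = a * (phi x - phi y).
  by rewrite /= !fctE /GRing.scale /=; ring.
rewrite normrM -mulrA ler_wpM2l//.
by apply: (le_holder_seminorm g_neq0); exact: holderP.
Qed.

Lemma holder_norm_ge (phi : holder) x : `|phi x| <= holder_norm phi.
Proof.
apply: (le_trans (le_sup_norm g_gt0 (holderP phi) x)).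
by rewrite /holder_norm lerDl holder_seminorm_ge0//; exact: holderP.
Qed.

Lemma holder_normZ (a : R) phi :
  holder_norm (a *: phi) = `|a| * holder_norm phi.
Proof.
apply/eqP; rewrite eq_le holder_normZ_le /=.
have [->|a0] := eqVneq a 0.
  by rewrite normr0 mul0r; apply: le_trans (holder_norm_ge _ point).
rewrite -ler_pdivlMl ?normr_gt0// -normfV.
by apply: le_trans (holder_normZ_le _ _); rewrite scalerA mulVf// scale1r.
Qed.

Lemma holder_norm0_eq0 phi : holder_norm phi = 0 -> phi = 0.
Proof.
move=> h; apply/val_inj/funext => x; apply/eqP; rewrite -normr_le0.
by rewrite -[leRHS]h holder_norm_ge.
Qed.

HB.instance Definition _ :=
  @Lmodule_isNormed.Build R holder holder_norm holder_normD holder_normZ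
    holder_norm0_eq0.

End holder_space.

Section phases.
Context {R : realType} (alpha : {posnum R}).
Local Notation f := (intermittent_map alpha).
Implicit Types (nu : probability (unit_itv R) R) (phi : unit_itv R -> R).

Definition free_energy phi nu : \bar R :=
  (entropy f nu + \int[nu]_x (phi x)%:E)%E.

Definition pressure phi : \bar R :=
  ereal_sup [set free_energy phi nu | nu in invariant_measure f].

Definition gibbs_state phi nu : Prop :=
  invariant_measure f nu /\ free_energy phi nu = pressure phi.

Definition delta0 : probability (unit_itv R) R := \d_(unit_itv0 R).

(* Two library measures may differ as functions outside the measurable sets,
   so uniqueness is up to agreement on the latter. *)
Definition unique_gibbs_state phi nu : Prop :=
  gibbs_state phi nu /\
  forall mu : probability (unit_itv R) R, gibbs_state phi mu ->
    forall A, measurable A -> mu A = nu A.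

Definition exponentially_mixing nu : Prop :=
  exists C rho : R, [/\ 0 < C, 0 < rho < 1 &
    forall (psi chi : unit_itv R -> R) (n : nat),
      bounded_fun psi -> measurable_fun setT psi -> is_holder 1 chi ->
      `| \int[nu]_x (psi (iter n f x) * chi x)
         - (\int[nu]_x psi x) * (\int[nu]_x chi x) |
      <= C * sup_norm psi * holder_seminorm 1 chi * rho ^+ n].

Variable gamma : {posnum R}.

Definition intermittent_phase : set (holder gamma) :=
  [set phi | exists nu, [/\ gibbs_state phi nu, exponentially_mixing nu
                          & (0 < entropy f nu)%E]].

Definition stationary_phase : set (holder gamma) :=
  [set phi : holder gamma | unique_gibbs_state phi delta0]°.

End phases.

Arguments delta0 R : clear implicits.
Arguments intermittent_phase {R} alpha gamma.
Arguments stationary_phase {R} alpha gamma.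

(* Submission.v *)
(* For a Hoelder potential u let p(u) be the exponential growth rate of the
   iterates of its transfer operator L_u.  The Gibbs inequality gives
   h_mu + int u dmu <= p(u) for every invariant measure mu.  If p(u) > u(0), the
   words with few returns to the expanding branch carry exponentially small
   weight, so L_u satisfies a Lasota-Yorke inequality, has a positive Hoelder
   eigenfunction and a spectral gap, and the resulting invariant measure is an
   exponentially mixing Gibbs state of positive entropy.  Hence phi lies in the
   intermittent phase as soon as delta_0 is not a Gibbs state for phi.

   Conversely, let delta_0 be a Gibbs state for phi, with phi(0) = 0, and suppose
   that some Gibbs state nu of positive entropy mixes exponentially.  Mixing makes
   nu([0,t_l]) exponentially small in l, where t_l is the l-th left preimage of 1.
   Lowering phi to -1 on [0,t_(l+1)] gives u <= phi with p(u) >= - C nu([0,t_l])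
   > u(0), hence an equilibrium state nu' of u.  By concavity of the left branch
   the distortion of u between visits to [t_1,1] is o(l), so
   nu'([0,t_(l+1)]) >= exp(- o(l)); restoring phi then yields a free energy
   >= - C nu([0,t_l]) + nu'([0,t_(l+1)])/2 > 0, a contradiction.

   So the intermittent phase is the complement of the closed convex set D of
   potentials with delta_0 as a Gibbs state, and the stationary phase is the
   interior of D; subtracting a multiple of x^gamma moves a point of D to the
   interior of D, which gives the topological statements. Testing transfer
   operators on exp(- C x^(gamma - alpha)) and on x^(- gamma) shows that D is
   empty if gamma > alpha and nonempty if gamma <= alpha. *)
Require Import Defs.
From HB Require Import structures.
From mathcomp Require Import all_boot all_order all_algebra.
From mathcomp Require Import ring lra zify.
From mathcomp Require Import all_classical all_reals all_analysis.
From mathcomp Require Import measurable_realfun.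

Set Implicit Arguments.
Unset Strict Implicit.
Unset Printing Implicit Defensive.

Import Order.TTheory GRing.Theory Num.Theory.
Import numFieldNormedType.Exports.

Local Open Scope classical_set_scope.
Local Open Scope ring_scope.

(** * Inverse branches and coding *)

(** The fixed point 0 is neutral: the left branch contracts distances by no uniform factor, so a
    Lasota-Yorke inequality cannot come from the map alone. It comes from the potential, through the
    strict inequality p(u) > u(0). Neither spectral theory nor a representation theorem for
    functionals enters. The eigenfunction is an ultralimit of resolvent sums at e^q, q decreasing to
    p, divided by their suprema. The cylinder masses are limits of normalized transfer operators,
    and the measure carrying them is an image of Lebesgue measure on [0,1]. Entropy is a supremum
    over all finite measurable partitions, so its upper bound must treat arbitrary atoms: these are
    approximated by cylinders, and a random relabelling inside the Gibbs inequality absorbs the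
    errors. In the converse direction the obstacle is that the Hoelder bound of the lowered
    potential grows with l. Only its distortion between visits to [t_1,1], estimated by concavity,
    stays o(l); this is what makes exp(- o(l)) win against the exponentially small mass provided by
    mixing. *)

Lemma powR_le1 (R : realType) (a x : R) : 0 <= a -> 0 <= x <= 1 -> x `^ a <= 1.
Proof.
move=> a0 /andP[x0 x1].
by rewrite -[leRHS](congr1 (@^~ a) (@powR1 R)) ge0_ler_powR ?nnegrE.
Qed.

Definition pt (R : realType) (x : unit_itv R) : R := val x.
Arguments pt {R} x : simpl never.

Section branches.
Context {R : realType} (alpha : {posnum R}).
Local Notation X := (unit_itv R).
Local Notation f := (intermittent_map alpha).
Local Notation a := (alpha%:num).
Implicit Types (x y z : X) (b : bool) (w v : seq bool) (n : nat).

Let a_gt0 : 0 < a. Proof. by []. Qed.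

Lemma pt_inj : injective (@pt R). Proof. by move=> x y /val_inj. Qed.

Lemma pt_ge0 x : 0 <= pt x. Proof. by case/andP: (unit_itvP x). Qed.
Lemma pt_le1 x : pt x <= 1. Proof. by case/andP: (unit_itvP x). Qed.

Definition mkX (r : R) (h : 0 <= r <= 1) : X := exist _ r (unit_itv_mem h).

Lemma dist_le1 x y : `|pt x - pt y| <= 1.
Proof.
have := pt_ge0 x; have := pt_ge0 y; have := pt_le1 x; have := pt_le1 y.
by move=> *; rewrite ler_norml; apply/andP; split; lra.
Qed.

Definition expand (r : R) : R := r * (1 + r `^ a).

Lemma expand_slope (r s : R) : 0 <= r -> r <= s ->
  (1 + r `^ a) * (s - r) <= expand s - expand r.
Proof.
move=> r0 rs; rewrite /expand.
have h : r `^ a <= s `^ a by rewrite ge0_ler_powR ?nnegrE// (le_trans r0).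
have := mulr_ge0 (le_trans r0 rs) (_ : 0 <= s `^ a - r `^ a).
by rewrite subr_ge0 => /(_ h); nra.
Qed.

Lemma expandB (r s : R) : 0 <= r -> r <= s -> s - r <= expand s - expand r.
Proof.
move=> r0 rs; apply: le_trans (expand_slope r0 rs).
by rewrite ler_peMl ?subr_ge0// lerDl powR_ge0.
Qed.

Lemma expand_lt (r s : R) : 0 <= r -> r < s -> expand r < expand s.
Proof.
move=> r0 rs; rewrite -subr_gt0; apply: lt_le_trans (expandB r0 (ltW rs)).
by rewrite subr_gt0.
Qed.

Lemma expand_leP (r s : R) : 0 <= r -> 0 <= s ->
  (expand r <= expand s) = (r <= s).
Proof.
move=> r0 s0; apply/idP/idP => [|rs].
  by apply: contraTT; rewrite -!ltNge => /(expand_lt s0).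
by rewrite -subr_ge0; apply: le_trans (expandB r0 rs); rewrite subr_ge0.
Qed.

Lemma expand_ltP (r s : R) : 0 <= r -> 0 <= s ->
  (expand r < expand s) = (r < s).
Proof. by move=> r0 s0; rewrite !ltNge expand_leP. Qed.

Lemma expand_inj (r s : R) : 0 <= r -> 0 <= s -> expand r = expand s -> r = s.
Proof.
by move=> r0 s0 /eqP; rewrite eq_le !expand_leP// -eq_le => /eqP.
Qed.

Lemma expand0 : expand 0 = 0. Proof. by rewrite /expand mul0r. Qed.
Lemma expand1 : expand 1 = 2.
Proof. by rewrite /expand powR1 mul1r. Qed.

Lemma expand_ge (r : R) : 0 <= r -> r <= expand r.
Proof. by move=> r0; rewrite /expand ler_peMr// lerDl powR_ge0. Qed.

Lemma expand_le2 (r : R) : 0 <= r <= 1 -> expand r <= 2 * r.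
Proof.
move=> r01; have := powR_le1 (ltW a_gt0) r01.
case/andP: r01 => r0 r1; rewrite /expand => h.
by rewrite mulrC ler_wpM2r//; lra.
Qed.

Lemma expand_surj (v : R) : 0 <= v <= 2 -> exists x : X, expand (pt x) = v.
Proof.
move=> /andP[v0 v2].
have [->|vn0] := eqVneq v 0; first by exists (unit_itv0 R); rewrite expand0.
have {v0 vn0} v0 : 0 < v by rewrite lt_def vn0.
have e1 : v / 2 <= 1 by rewrite ler_pdivrMr// mul1r.
have e0 : 0 < v / 2 by rewrite divr_gt0.
(* At the left end v / 2 the value of [expand] is at most v by [expand_le2], and on the interval the
   base of the power stays positive, as derivability requires. *)
have [c] : exists2 c, c \in `[v / 2, 1] & expand c = v.
  apply: IVT => //.
    apply: derivable_within_continuous => x; rewrite in_itv/= => /andP[x0 x1].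
    have x_gt0 := lt_le_trans e0 x0.
    apply: derivableM; first exact: derivable_id.
    apply: derivableD; first exact: derivable_cst.
    by apply: derivable_powR; rewrite in_itv/= x_gt0.
  have h : expand (v / 2) <= v.
    by apply: le_trans (expand_le2 _) _; [apply/andP; split=> //; exact: ltW|lra].
  by rewrite ge_min le_max h expand1 v2 orbT.
rewrite in_itv/= => /andP[c0 c1] ec.
have c01 : 0 <= c <= 1 by rewrite c1 (le_trans (ltW e0) c0).
by exists (mkX c01).
Qed.

Fact branch_ex b y : exists x : X, expand (pt x) = pt y + b%:R.
Proof.
apply: expand_surj; have := pt_ge0 y; have := pt_le1 y.
by case: b => /= *; lra.
Qed.

(** Both inverse branches are total on the closed interval. They meet at [tpt 1], which [digit]
    assigns to the left one. *)
Definition branch b y : X := projT1 (cid (branch_ex b y)).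

Lemma branchE b y : expand (pt (branch b y)) = pt y + b%:R.
Proof. by rewrite /branch; case: cid. Qed.

Definition digit x : bool := 1 < expand (pt x).

Lemma pt_map x : pt (f x) = expand (pt x) - (digit x)%:R.
Proof.
have -> : pt (f x) = intermittent_fun alpha (pt x) by [].
rewrite /digit /intermittent_fun /= -/(expand _) ltNge.
by case: ifP => //= _; rewrite subr0.
Qed.

Lemma branch_map x : branch (digit x) (f x) = x.
Proof.
apply/pt_inj/expand_inj; [exact: pt_ge0|exact: pt_ge0|].
by rewrite branchE pt_map subrK.
Qed.

Lemma map_gt0 x : 0 < pt x -> 0 < pt (f x).
Proof.
move=> x0; rewrite pt_map /digit; case: (boolP (1 < _)) => h.
  by rewrite subr_gt0.
by rewrite subr0 (lt_le_trans x0)// expand_ge// ltW.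
Qed.

Lemma branch_gt0 b y : 0 < pt y -> 0 < pt (branch b y).
Proof.
move=> y0; rewrite -(expand_ltP (lexx 0) (pt_ge0 _)) branchE expand0.
by rewrite ltr_wpDr.
Qed.

Lemma branch_le b x y : (pt (branch b x) <= pt (branch b y)) = (pt x <= pt y).
Proof. by rewrite -expand_leP ?pt_ge0// !branchE lerD2r. Qed.

Lemma branch_lt b x y : (pt (branch b x) < pt (branch b y)) = (pt x < pt y).
Proof. by rewrite !ltNge branch_le. Qed.

Lemma branch_dist b x y :
  `|pt (branch b x) - pt (branch b y)| <= `|pt x - pt y|.
Proof.
wlog h : x y / pt y <= pt x.
  by move=> H; have [/H//|/ltW/H] := leP (pt y) (pt x); rewrite distrC (distrC (pt x)).
rewrite !ger0_norm ?subr_ge0 ?branch_le//.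
have := expandB (pt_ge0 (branch b y)) (_ : _ <= pt (branch b x)).
by rewrite branch_le h => /(_ isT); rewrite !branchE; lra.
Qed.

Definition X0 : X := unit_itv0 R.
Definition X1 : X := unit_itv1 R.

Lemma branch_true0 : branch true X0 = branch false X1.
Proof.
by apply/pt_inj/expand_inj; rewrite ?pt_ge0// !branchE/= addr0 add0r.
Qed.

Definition tpt n : X := iter n (branch false) X1.

Lemma tptS n : tpt n.+1 = branch false (tpt n). Proof. by []. Qed.

Lemma tpt_gt0 n : 0 < pt (tpt n).
Proof. by elim: n => [|n IH]; [exact: ltr01|exact: branch_gt0]. Qed.

Lemma tptB n : pt (tpt n) - pt (tpt n.+1) = pt (tpt n.+1) * pt (tpt n.+1) `^ a.
Proof.
have := branchE false (tpt n); rewrite -tptS addr0 => <-.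
by rewrite /expand; lra.
Qed.

Lemma tpt_lt n : pt (tpt n.+1) < pt (tpt n).
Proof.
by rewrite -subr_gt0 tptB mulr_gt0 ?powR_gt0 ?tpt_gt0.
Qed.

Lemma tpt_le m n : (m <= n)%N -> pt (tpt n) <= pt (tpt m).
Proof.
move=> /subnK <-; elim: (n - m)%N => // k IH.
by rewrite addSn; apply: le_trans IH; exact/ltW/tpt_lt.
Qed.

(** As long as t_n exceeds e, each step lowers it by at least e * e^alpha, which can happen only
    finitely often in [0,1]. *)
Lemma tpt_small (e : R) : 0 < e -> exists n, forall m, (n <= m)%N -> pt (tpt m) <= e.
Proof.
move=> e0.
suff [n hn] : exists n, pt (tpt n) <= e.
  by exists n => m /tpt_le h; exact: le_trans h hn.
apply: contrapT => H.
have {}H n : e < pt (tpt n) by rewrite ltNge; apply/negP => ?; apply: H; exists n.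
have ea : 0 < e * e `^ a by rewrite mulr_gt0// powR_gt0.
have step n : n%:R * (e * e `^ a) <= 1 - pt (tpt n).
  elim: n => [|n IH]; first by rewrite mul0r subrr.
  rewrite -natr1 mulrDl mul1r.
  have : e * e `^ a <= pt (tpt n) - pt (tpt n.+1).
    rewrite tptB; apply: ler_pM; rewrite ?powR_ge0 ?(ltW e0) ?(ltW (H _))//.
    by rewrite ge0_ler_powR ?nnegrE ?(ltW (H _))// ?pt_ge0// ltW.
  by move: IH; lra.
have [n hn] : exists n, 1 < n%:R * (e * e `^ a).
  exists (Num.truncn (e * e `^ a)^-1).+1.
  by rewrite -ltr_pdivrMr// mul1r truncnS_gt.
by have := step n; have := tpt_gt0 n; lra.
Qed.

(* A Lipschitz constant of the right branch. *)
Definition rate : R := (1 + pt (tpt 1) `^ a)^-1.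

Lemma rate_gt0 : 0 < rate.
Proof. by rewrite invr_gt0 ltr_wpDr ?powR_ge0. Qed.

Lemma rate_lt1 : rate < 1.
Proof. by rewrite invf_lt1 ?ltrDl ?powR_gt0 ?tpt_gt0// ltr_wpDr ?powR_ge0. Qed.

Lemma branch_true_ge y : pt (tpt 1) <= pt (branch true y).
Proof. by rewrite /= -branch_true0 branch_le pt_ge0. Qed.

Lemma branch_true_dist x y :
  `|pt (branch true x) - pt (branch true y)| <= rate * `|pt x - pt y|.
Proof.
wlog h : x y / pt y <= pt x.
  by move=> H; have [/H//|/ltW/H] := leP (pt y) (pt x); rewrite distrC (distrC (pt x)).
rewrite !ger0_norm ?subr_ge0 ?branch_le// /rate ler_pdivlMl ?ltr_wpDr ?powR_ge0//.
have := expand_slope (pt_ge0 (branch true y)) (_ : _ <= pt (branch true x)).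
rewrite branch_le h => /(_ isT); rewrite !branchE => hs.
have : (1 + pt (tpt 1) `^ a) * (pt (branch true x) - pt (branch true y)) <= (1 + pt (branch true y) `^ a) * (pt (branch true x) - pt (branch true y)).
  apply: ler_wpM2r; first by rewrite subr_ge0 branch_le.
  by rewrite lerD2l ge0_ler_powR ?nnegrE ?pt_ge0// branch_true_ge.
by move: hs; lra.
Qed.

Definition br w x : X := foldr branch x w.

Lemma br_cat v w x : br (v ++ w) x = br v (br w x).
Proof. by rewrite /br foldr_cat. Qed.

Lemma br_cons b w x : br (b :: w) x = branch b (br w x). Proof. by []. Qed.

Lemma br_nseq n : br (nseq n false) X1 = tpt n.
Proof. by elim: n => //= n ->. Qed.

Lemma br_le w x y : (pt (br w x) <= pt (br w y)) = (pt x <= pt y).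
Proof. by elim: w => //= b w <-; rewrite branch_le. Qed.

Lemma br_lt w x y : (pt (br w x) < pt (br w y)) = (pt x < pt y).
Proof. by rewrite !ltNge br_le. Qed.

Lemma br_dist w x y : `|pt (br w x) - pt (br w y)| <= `|pt x - pt y|.
Proof. by elim: w => //= b w; exact/le_trans/branch_dist. Qed.

Definition ones w := count id w.

Lemma br_dist_ones w x y :
  `|pt (br w x) - pt (br w y)| <= rate ^+ ones w * `|pt x - pt y|.
Proof.
elim: w => [|[] w IH] /=; first by rewrite expr0 mul1r.
  rewrite add1n exprS -mulrA; apply: le_trans (branch_true_dist _ _) _.
  by rewrite ler_wpM2l// ltW// rate_gt0.
by rewrite add0n; exact: le_trans (branch_dist _ _ _) IH.
Qed.

Lemma br_nseq_le k w x : pt (br (nseq k false ++ w) x) <= pt (tpt k).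
Proof. by rewrite br_cat -br_nseq br_le pt_le1. Qed.

(** The neutral fixed point rules out a uniform rate, so words are cut into blocks of [K.+1]
    letters. Either the word starts with K letters 0 and the cylinder lies in [0,t_K], or a letter 1
    occurs early and contributes a factor [rate]. *)
Lemma cylinder_shrink (e : R) : 0 < e -> exists m, forall w x y,
  (m <= size w)%N -> `|pt (br w x) - pt (br w y)| <= e.
Proof.
move=> e0; have [K hK] := tpt_small e0.
suff H j : forall w x y, (j * K.+1 <= size w)%N ->
    `|pt (br w x) - pt (br w y)| <= Num.max e (rate ^+ j).
  have := @cvg_expr R rate _.
  rewrite ger0_norm ?(ltW rate_gt0)// rate_lt1 => /(_ isT)/cvgrPdist_le/(_ _ e0).
  move=> [j _ /(_ j (leqnn j))]; rewrite sub0r normrN ger0_norm ?exprn_ge0 ?(ltW rate_gt0)//.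
  move=> hj; exists (j * K.+1)%N => w x y hw.
  by apply: le_trans (H j w x y hw) _; rewrite ge_max lexx hj.
elim: j => [|j IH] w x y hw; first by rewrite expr0 le_max dist_le1 orbT.
have [m [v [Ew hm]]] : exists m v, w = nseq m false ++ v /\ (v = [::] \/ exists v', v = true :: v').
  elim: w {hw} => [|[] w [m [v [-> hv]]]].
  - by exists 0%N, [::]; split => //; left.
  - by exists 0%N, (true :: nseq m false ++ v); split => //; right; exists (nseq m false ++ v).
  - by exists m.+1, v.
rewrite {}Ew in hw *.
have [Km|mK] := leqP K m.
  rewrite le_max; apply/orP; left.
  have := br_nseq_le m v x; have := br_nseq_le m v y.
  have := pt_ge0 (br (nseq m false ++ v) x); have := pt_ge0 (br (nseq m false ++ v) y).
  by have := hK _ Km; move=> *; rewrite ler_norml; apply/andP; split; lra.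
have [v' Ev hv'] : exists2 v', v = true :: v' & (j * K.+1 <= size v')%N.
  case: hm hw => [->|[v' ->]]; rewrite size_cat size_nseq mulSn /=; first lia.
  by exists v' => //; lia.
rewrite Ev.
rewrite !br_cat; apply: le_trans (br_dist _ _ _) _; rewrite !br_cons.
apply: le_trans (branch_true_dist _ _) _.
apply: le_trans (ler_wpM2l (ltW rate_gt0) (IH _ _ _ hv')) _.
rewrite maxr_pMr ?(ltW rate_gt0)// ge_max !le_max -exprS lexx orbT andbT.
by apply/orP; left; rewrite ger_pMl// ltW// rate_lt1.
Qed.

Fixpoint code n x : seq bool :=
  if n is n'.+1 then digit x :: code n' (f x) else [::].

Lemma size_code n x : size (code n x) = n.
Proof. by elim: n x => //= n IH x; rewrite IH. Qed.

Lemma br_code n x : br (code n x) (iter n f x) = x.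
Proof.
by elim: n x => //= n IH x; rewrite -iterS iterSr IH branch_map.
Qed.

Lemma code_add m n x : code (m + n) x = code m x ++ code n (iter m f x).
Proof.
by elim: m x => //= m IH x; rewrite IH -iterS iterSr.
Qed.

(** Cylinders are half-open on the left because the preimage of 1 under the left branch keeps digit
    0. The point 0, coded by 0s only, is in no such interval and is treated apart later. *)
Lemma code_between w x : pt (br w X0) < pt x -> pt x <= pt (br w X1) ->
  code (size w) x = w.
Proof.
move=> h0 h1; have x0 : 0 < pt x by apply: le_lt_trans h0; exact: pt_ge0.
elim: w x x0 h0 h1 => //= b w IH x x0 h0 h1.
have db : digit x = b.
  rewrite /digit; apply/idP/idP => [h|].
    case: b h0 h1 => // _ h1; move: h; rewrite ltNge => /negP[].
    have := h1; rewrite -expand_leP ?pt_ge0// branchE addr0 => /le_trans; apply.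
    exact: pt_le1.
  case: b h0 h1 => // h0 _ _; rewrite -expand_ltP ?pt_ge0// branchE in h0.
  by apply: le_lt_trans h0; rewrite lerDr pt_ge0.
rewrite db; congr cons; apply: IH; first exact: map_gt0.
  by rewrite -(branch_lt b) -[in X in _ < X]db branch_map.
by rewrite -(branch_le b) -[in X in X <= _]db branch_map.
Qed.

Lemma iter_map0 n : iter n f X0 = X0.
Proof.
elim: n => //= n ->; apply/pt_inj; rewrite pt_map /digit /= expand0.
by rewrite ltNge ler01 subr0.
Qed.

Lemma code0 n : code n X0 = nseq n false.
Proof.
elim: n => //= n <-; rewrite {1}/digit /= expand0 ltNge ler01/=.
by rewrite -[f X0]/(iter 1 f X0) iter_map0.
Qed.

(** Plain lists rather than tuples: words are split and concatenated at varying lengths, without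
    casts. *)
Fixpoint words n : seq (seq bool) :=
  if n is n'.+1 then map (cons false) (words n') ++ map (cons true) (words n')
  else [:: [::]].

Lemma mem_words n w : (w \in words n) = (size w == n).
Proof.
elim: n w => [|n IH] [|b w] //=.
  by rewrite mem_cat; apply/negbTE; rewrite negb_or; apply/andP; split; apply/mapP => -[].
have mem_cons c s : (b :: w \in map (cons c) s) = (b == c) && (w \in s).
  by apply/mapP/andP => [[v hv [-> ->]]|[/eqP-> hw]]; [rewrite eqxx|exists w].
by rewrite mem_cat eqSS -IH !mem_cons; case: b {mem_cons}; rewrite /= ?orbF.
Qed.

Lemma uniq_words n : uniq (words n).
Proof.
elim: n => //= n IH; rewrite cat_uniq !map_inj_uniq ?IH/= ?andbT; try by move=> u v [].
by apply/hasPn => _ /mapP[v _ ->]; apply/negP => /mapP[u _ []].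
Qed.

Lemma big_words_cons (V : nmodType) (G : seq bool -> V) n :
  \sum_(w <- words n.+1) G w =
  \sum_(w <- words n) G (false :: w) + \sum_(w <- words n) G (true :: w).
Proof. by rewrite /= big_cat/= !big_map. Qed.

Lemma big_words_add (V : nmodType) (G : seq bool -> V) m n :
  \sum_(w <- words (m + n)) G w =
  \sum_(u <- words m) \sum_(v <- words n) G (u ++ v).
Proof.
elim: m G => [|m IH] G; first by rewrite big_seq1.
by rewrite addSn !big_words_cons !IH.
Qed.

End branches.

(** * Transfer operators *)

Section transfer.
Context {R : realType} (alpha : {posnum R}).
Local Notation X := (unit_itv R).
Local Notation f := (intermittent_map alpha).
Local Notation branch := (branch alpha).
Local Notation br := (br alpha).
Local Notation code := (code alpha).
Implicit Types (x y z : X) (b : bool) (w v : seq bool) (n : nat).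
Implicit Types (u psi : X -> R).

(** The Birkhoff sum along the backward orbit of x coded by w. Following branches instead of
    iterating [f] keeps it continuous in x for continuous u, even at x = 0, where
    [f (branch true X0)] is 1. *)
Fixpoint bs u w x : R := if w is b :: w' then u (br w x) + bs u w' x else 0.

Lemma bs_cat u v w x : bs u (v ++ w) x = bs u v (br w x) + bs u w x.
Proof.
by elim: v => /= [|b v ->]; rewrite ?add0r// br_cat addrA.
Qed.

Lemma bs_code u n x :
  bs u (code n x) (iter n f x) = \sum_(i < n) u (iter i f x).
Proof.
elim: n x => [|n IH] x; first by rewrite big_ord0.
rewrite big_ord_recl iterSr /= IH br_code branch_map; congr (_ + _).
by apply: eq_bigr => i _; rewrite -iterSr.
Qed.

Lemma bs_le u (M : R) w x : (forall z, u z <= M) -> bs u w x <= (size w)%:R * M.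
Proof.
move=> h; elim: w => [|b w IH]; first by rewrite mul0r.
by rewrite /= -natr1 mulrDl mul1r addrC lerD.
Qed.

Lemma bs_ge u (M : R) w x : (forall z, M <= u z) -> (size w)%:R * M <= bs u w x.
Proof.
move=> h; elim: w => [|b w IH]; first by rewrite mul0r.
by rewrite /= -natr1 mulrDl mul1r addrC lerD.
Qed.

Definition Lop u psi x : R :=
  expR (u (branch false x)) * psi (branch false x) +
  expR (u (branch true x)) * psi (branch true x).

Lemma iter_LopE u psi n x :
  iter n (Lop u) psi x = \sum_(w <- words n) expR (bs u w x) * psi (br w x).
Proof.
elim: n psi => [|n IH] psi; first by rewrite big_seq1 expR0 mul1r.
rewrite iterSr IH big_words_cons -big_split; apply: eq_bigr => w _ /=.
by rewrite /Lop mulrDr !mulrA -!expRD; congr (expR _ * _ + expR _ * _); exact: addrC.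
Qed.

Lemma iter_Lop_le u psi1 psi2 n x : (forall z, psi1 z <= psi2 z) ->
  iter n (Lop u) psi1 x <= iter n (Lop u) psi2 x.
Proof.
by move=> h; rewrite !iter_LopE ler_sum// => w _; rewrite ler_wpM2l// expR_ge0.
Qed.

Lemma iter_LopZ u (c : R) psi n x :
  iter n (Lop u) (fun z => c * psi z) x = c * iter n (Lop u) psi x.
Proof.
by rewrite !iter_LopE mulr_sumr; apply: eq_bigr => w _; rewrite mulrCA.
Qed.

Lemma iter_Lop_ge0 u psi n x : (forall z, 0 <= psi z) ->
  0 <= iter n (Lop u) psi x.
Proof.
by move=> h; rewrite iter_LopE sumr_ge0// => w _; rewrite mulr_ge0// expR_ge0.
Qed.

Lemma eq_iter_Lop u psi1 psi2 n x : psi1 =1 psi2 ->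
  iter n (Lop u) psi1 x = iter n (Lop u) psi2 x.
Proof. by move=> /funext ->. Qed.

Definition Zn u n x : R := iter n (Lop u) (fun=> 1) x.

Lemma ZnE u n x : Zn u n x = \sum_(w <- words n) expR (bs u w x).
Proof. by rewrite /Zn iter_LopE; apply: eq_bigr => w _; rewrite mulr1. Qed.

Lemma Zn_ge0 u n x : 0 <= Zn u n x.
Proof. exact: iter_Lop_ge0. Qed.

Lemma Zn_add u m n x : Zn u (m + n) x = iter m (Lop u) (Zn u n) x.
Proof. by rewrite /Zn iterD. Qed.

Lemma size_words n : size (words n) = (2 ^ n)%N.
Proof. by elim: n => //= n IH; rewrite size_cat !size_map IH expnS mul2n addnn. Qed.

Lemma sum_words_cst (c : R) n : \sum_(w <- words n) c = 2 ^+ n * c.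
Proof.
by rewrite big_const_seq count_predT size_words iter_addr_0 -[LHS]mulr_natl natrX.
Qed.

Lemma Zn_le u (M : R) n x : (forall z, u z <= M) ->
  Zn u n x <= expR (n%:R * (M + ln 2)).
Proof.
move=> h; have -> : expR (n%:R * (M + ln 2)) = 2 ^+ n * expR (n%:R * M).
  by rewrite mulrDr expRD mulrC; congr (_ * _); rewrite expRM_natl lnK ?posrE.
rewrite ZnE -sum_words_cst.
rewrite big_seq [leRHS]big_seq ler_sum// => w; rewrite mem_words => /eqP sw.
by rewrite ler_expR -sw bs_le.
Qed.

Lemma Zn_ge u (M : R) n x : (forall z, M <= u z) -> expR (n%:R * M) <= Zn u n x.
Proof.
move=> h; rewrite ZnE (big_rem (nseq n false)) ?mem_words ?size_nseq//=.
apply: ler_wpDr; first by rewrite sumr_ge0// => w _; exact: expR_ge0.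
by rewrite ler_expR -[in leLHS](size_nseq n false) bs_ge.
Qed.

Definition ucont u := forall e : R, 0 < e -> exists2 d : R, 0 < d &
  forall x y, `|pt x - pt y| <= d -> `|u x - u y| <= e.

Lemma cylinder_var u : ucont u -> forall e : R, 0 < e -> exists m, forall w x y,
  (m <= size w)%N -> `|u (br w x) - u (br w y)| <= e.
Proof.
move=> uu e /uu[d d0 hd]; have [m hm] := cylinder_shrink alpha d0.
by exists m => w x y sw; apply: hd; exact: hm.
Qed.

(** Only suffixes of w shorter than m may give points far apart; they cost at most 2 B each, and
    every longer suffix costs at most e. *)
Lemma bs_var u (B : R) : ucont u -> (forall x, `|u x| <= B) ->
  forall e : R, 0 < e -> exists2 C : R, 0 <= C & forall w x y,
  `|bs u w x - bs u w y| <= (size w)%:R * e + C.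
Proof.
move=> uu hB e e0; have [m hm] := cylinder_var uu e0.
have B0 : 0 <= B by apply: le_trans (hB X0).
exists (m%:R * (2 * B)); first by rewrite mulr_ge0// mulr_ge0.
suff H w x y : `|bs u w x - bs u w y| <=
    (size w)%:R * e + (minn m (size w))%:R * (2 * B).
  move=> w x y; apply: le_trans (H w x y) _; rewrite lerD2l ler_wpM2r ?mulr_ge0//.
  by rewrite ler_nat geq_minl.
elim: w => [|b w IH]; first by rewrite subrr normr0 minn0 !mul0r addr0.
have -> : bs u (b :: w) x - bs u (b :: w) y =
  (u (br (b :: w) x) - u (br (b :: w) y)) + (bs u w x - bs u w y).
  by rewrite /=; lra.
apply: le_trans (ler_normD _ _) _; rewrite /= -natr1 mulrDl mul1r.
have [h|h] := boolP (m <= (size w).+1)%N.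
  have [h'|h'] := boolP (m <= size w)%N.
    rewrite (minn_idPl h) (minn_idPl h') in IH *; have := hm (b :: w) x y h; rewrite /=; lra.
  have E : minn m (size w) = size w by apply/minn_idPr; lia.
  have E' : minn m (size w).+1 = (size w).+1 by apply/minn_idPr; lia.
  have := ler_normB (u (br (b :: w) x)) (u (br (b :: w) y)).
  have := hB (br (b :: w) x); have := hB (br (b :: w) y).
  by rewrite E in IH; rewrite E' -natr1 mulrDl mul1r; move: IH; rewrite /=; lra.
have E : minn m (size w) = size w by apply/minn_idPr; lia.
have E' : minn m (size w).+1 = (size w).+1 by apply/minn_idPr; lia.
have := ler_normB (u (br (b :: w) x)) (u (br (b :: w) y)).
have := hB (br (b :: w) x); have := hB (br (b :: w) y).
by rewrite E in IH; rewrite E' -natr1 mulrDl mul1r; move: IH; rewrite /=; lra.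
Qed.

End transfer.

Lemma expR_dist (R : realType) (s t m : R) : s <= m -> t <= m ->
  `|expR s - expR t| <= expR m * `|s - t|.
Proof.
wlog st : s t / t <= s.
  by move=> H sm tm; have [/H|/ltW/H] := leP t s; [exact|rewrite distrC (distrC s); exact].
move=> sm _; rewrite !ger0_norm ?subr_ge0 ?ler_expR//.
apply: (@le_trans _ _ (expR s * (s - t))); last first.
  by rewrite ler_wpM2r ?subr_ge0// ler_expR.
have := expR_ge1Dx (t - s); have := expR_gt0 s.
have -> : expR t = expR s * expR (t - s) by rewrite -expRD; congr expR; lra.
by nra.
Qed.

(** * Hoelder functions and their composition with inverse branches *)

Section holder.
Context {R : realType} (alpha : {posnum R}) (g : R) (g_gt0 : 0 < g).
Local Notation X := (unit_itv R).
Local Notation br := (br alpha).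
Local Notation H := (holder_with g).
Implicit Types (x y z : X) (b : bool) (w v : seq bool) (n : nat).
Implicit Types (u psi : X -> R).

Lemma holder_ge0 u (A : R) : H u A -> 0 <= A.
Proof.
move=> /(_ (unit_itv1 R) (unit_itv0 R)).
have -> : `|val (unit_itv1 R) - val (unit_itv0 R)| = 1 :> R.
  by rewrite /= subr0 normr1.
by rewrite powR1 mulr1; exact: le_trans.
Qed.

Lemma dist_powR_le1 x y : `|pt x - pt y| `^ g <= 1.
Proof. by rewrite powR_le1 ?(ltW g_gt0)// normr_ge0 dist_le1. Qed.

Lemma holder_bounded u (A : R) : H u A -> forall x y, `|u x - u y| <= A.
Proof.
move=> h x y; apply: le_trans (h x y) _.
by rewrite ler_piMr ?(holder_ge0 h)// (dist_powR_le1 x y).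
Qed.

Lemma le_holder u (A B : R) : A <= B -> H u A -> H u B.
Proof.
by move=> AB h x y; apply: le_trans (h x y) _; rewrite ler_wpM2r ?powR_ge0.
Qed.

Lemma holder_modulus (A e : R) : 0 <= A -> 0 < e -> exists2 d : R, 0 < d &
  forall u, H u A -> forall x y, `|pt x - pt y| <= d -> `|u x - u y| <= e.
Proof.
move=> A0 e0; exists ((e / (A + 1)) `^ g^-1) => [|u h x y xy].
  by apply: powR_gt0; rewrite divr_gt0// ltr_wpDl.
apply: le_trans (h x y) _.
have : `|pt x - pt y| `^ g <= e / (A + 1).
  have := @ge0_ler_powR R g (ltW g_gt0) _ _ _ _ xy.
  rewrite -powRrM mulVf ?gt_eqF// powRr1 ?divr_ge0 ?(ltW e0) ?addr_ge0//; apply.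
    by rewrite nnegrE.
  by rewrite nnegrE powR_ge0.
rewrite ler_pdivlMr ?ltr_wpDl// => h1; apply: le_trans h1; rewrite mulrC.
by rewrite ler_wpM2l ?powR_ge0// lerDl.
Qed.

Lemma holder_ucont u (A : R) : H u A -> ucont u.
Proof.
move=> h e e0; have [d d0 hd] := holder_modulus (holder_ge0 h) e0.
by exists d => //; exact: hd.
Qed.

(** The depth m depends on A and e alone, so it serves a whole sequence of functions with a common
    Hoelder constant. *)
Lemma holder_cylinder (A e : R) : 0 <= A -> 0 < e -> exists m, forall u,
  H u A -> forall w x y, (m <= size w)%N -> `|u (br w x) - u (br w y)| <= e.
Proof.
move=> A0 e0; have [d d0 hd] := holder_modulus A0 e0.
have [m hm] := cylinder_shrink alpha d0.
by exists m => u uA w x y sw; apply: hd => //; exact: hm.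
Qed.

Lemma holderD u psi (A B : R) : H u A -> H psi B -> H (fun x => u x + psi x) (A + B).
Proof.
move=> h1 h2 x y.
have -> : u x + psi x - (u y + psi y) = (u x - u y) + (psi x - psi y) by lra.
by apply: le_trans (ler_normD _ _) _; rewrite mulrDl lerD.
Qed.

Lemma holderZ u (c A : R) : H u A -> H (fun x => c * u x) (`|c| * A).
Proof. by move=> h x y; rewrite -mulrBr normrM -mulrA ler_wpM2l. Qed.

Lemma holder_cst (c : R) : H (fun=> c) 0.
Proof. by move=> x y; rewrite subrr normr0 mul0r. Qed.

Lemma holderM u psi (A B M N : R) : H u A -> H psi B ->
  (forall x, `|u x| <= M) -> (forall x, `|psi x| <= N) ->
  H (fun x => u x * psi x) (A * N + M * B).
Proof.
move=> h1 h2 hM hN x y.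
have -> : u x * psi x - u y * psi y = (u x - u y) * psi x + u y * (psi x - psi y) by lra.
apply: le_trans (ler_normD _ _) _; rewrite !normrM mulrDl lerD//.
  by rewrite mulrAC ler_pM.
by rewrite -mulrA ler_pM.
Qed.

Lemma holderV u (A m : R) : H u A -> 0 < m -> (forall x, m <= u x) ->
  H (fun x => (u x)^-1) (A / m ^+ 2).
Proof.
move=> h m0 hm x y; have ux := lt_le_trans m0 (hm x); have uy := lt_le_trans m0 (hm y).
have -> : (u x)^-1 - (u y)^-1 = (u y - u x) / (u x * u y).
  by field; rewrite !gt_eqF.
rewrite normrM normfV (gtr0_norm (mulr_gt0 ux uy)) mulrAC ler_pM//.
- by rewrite invr_ge0 ltW// mulr_gt0.
- by rewrite distrC; exact: h.
- by rewrite lef_pV2 ?posrE ?exprn_gt0 ?mulr_gt0// expr2 ler_pM// ltW.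
Qed.

Definition rateg : R := rate alpha `^ g.

Lemma rateg_gt0 : 0 < rateg. Proof. by rewrite powR_gt0// rate_gt0. Qed.

Lemma rateg_lt1 : rateg < 1.
Proof.
rewrite -[ltRHS](congr1 (@^~ g) (@powR1 R)) gt0_ltr_powR ?nnegrE//.
  exact/ltW/rate_gt0.
exact: rate_lt1.
Qed.

Lemma br_distg w x y :
  `|pt (br w x) - pt (br w y)| `^ g <= rateg ^+ ones w * `|pt x - pt y| `^ g.
Proof.
have r0 := ltW (rate_gt0 alpha).
have -> : rateg ^+ ones w * `|pt x - pt y| `^ g =
    (rate alpha ^+ ones w * `|pt x - pt y|) `^ g.
  rewrite powRM ?exprn_ge0//; congr (_ * _).
  rewrite -[LHS]powR_mulrn ?powR_ge0// -powRrM mulrC powRrM.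
  by rewrite (powR_mulrn (ones w) r0).
rewrite ge0_ler_powR ?nnegrE ?(ltW g_gt0)//.
  by rewrite mulr_ge0// exprn_ge0.
exact: br_dist_ones.
Qed.

Lemma br_distg1 w x y :
  `|pt (br w x) - pt (br w y)| `^ g <= `|pt x - pt y| `^ g.
Proof.
by rewrite ge0_ler_powR ?nnegrE ?(ltW g_gt0)// br_dist.
Qed.

Lemma holder_bs u (A : R) w : H u A -> H (bs alpha u w) ((size w)%:R * A).
Proof.
move=> h; elim: w => [|b w IH] x y /=; first by rewrite subrr normr0 !mul0r.
have -> : forall p q r s : R, p + q - (r + s) = (q - s) + (p - r) by move=> *; lra.
rewrite -natr1 mulrDl mul1r [leRHS]mulrDl.
apply: le_trans (ler_normD _ _) _; rewrite lerD//.
apply: le_trans (h _ _) _; rewrite ler_wpM2l ?(holder_ge0 h)//.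
exact: (br_distg1 (b :: w)).
Qed.

End holder.

(** * The spectral gap *)

Section lasota_yorke.
Context {R : realType} (alpha : {posnum R}) (g : R) (g_gt0 : 0 < g).
Local Notation X := (unit_itv R).
Local Notation br := (br alpha).
Local Notation tpt := (tpt alpha).
Local Notation H := (holder_with g).
Local Notation Lop := (Lop alpha).
Local Notation Zn := (Zn alpha).
Local Notation bs := (bs alpha).
Implicit Types (x y z : X) (b : bool) (w v : seq bool) (n : nat).
Implicit Types (psi : X -> R).

Lemma sum_ones (z : R) n : \sum_(w <- words n) z ^+ ones w = (1 + z) ^+ n.
Proof.
elim: n => [|n IH]; first by rewrite big_seq1.
rewrite big_words_cons /= [in RHS]exprS mulrDl mul1r -IH; congr (_ + _).
by rewrite mulr_sumr; apply: eq_bigr => w _; rewrite exprS.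
Qed.

Lemma br_lead w x : pt (br w x) <= pt (tpt (find id w)).
Proof.
by elim: w => [|[] w IH] /=; rewrite ?pt_le1// branch_le.
Qed.

Definition grows_le (u : X -> R) (q : R) : Prop :=
  exists C : R, forall n x, Zn u n x <= C * expR (n%:R * q).

Variables (u : X -> R) (A B p : R).
Hypotheses (uA : H u A) (uB : forall x, `|u x| <= B).
Hypothesis pP : forall q, p < q -> grows_le u q.
Hypothesis p_min : forall q, grows_le u q -> p <= q.
Hypothesis u0p : u X0 < p.

Let B_ge0 : 0 <= B. Proof. by apply: le_trans (uB X0). Qed.

Let A_ge0 : 0 <= A. Proof. exact: holder_ge0 uA. Qed.

(** In each term the variation of psi is contracted once per letter 1, and that of the weight is
    paid by the bound M on psi. The bound [e] on Birkhoff sums is left free, to be chosen word by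
    word. *)
Lemma LY_basic n psi (D M : R) (e : seq bool -> R) :
  (forall w x, size w = n -> bs u w x <= e w) ->
  H psi D -> (forall x, `|psi x| <= M) ->
  H (iter n (Lop u) psi)
    ((\sum_(w <- words n) expR (e w) * rateg alpha g ^+ ones w) * D +
     (2 ^+ n * (expR (n%:R * B) * (n%:R * A))) * M).
Proof.
move=> he hD hM x y; rewrite !iter_LopE -sumrB.
have D0 := holder_ge0 hD.
apply: le_trans (ler_norm_sum _ _ _) _.
rewrite mulrDl -mulrA -sum_words_cst !mulr_suml -big_split.
rewrite big_seq [leRHS]big_seq ler_sum// => w; rewrite mem_words => /eqP sw /=.
have -> : forall a b c d : R, a * b - c * d = a * (b - d) + (a - c) * d by move=> *; lra.
apply: le_trans (ler_normD _ _) _; rewrite !normrM lerD//.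
  rewrite ger0_norm ?expR_ge0//.
  apply: (@le_trans _ _ (expR (e w) * (D * (rateg alpha g ^+ ones w * `|pt x - pt y| `^ g)))); last first.
    by rewrite /pt; lra.
  apply: ler_pM => //; rewrite ?expR_ge0//.
    by rewrite ler_expR he.
  by apply: le_trans (hD _ _) _; rewrite ler_wpM2l//; exact: br_distg.
have hb z : bs u w z <= n%:R * B.
  by rewrite -sw; apply: bs_le => t; apply: le_trans (ler_norm _) (uB t).
rewrite [leRHS]mulrAC; apply: ler_pM => //.
apply: le_trans (expR_dist (hb x) (hb y)) _.
rewrite -!mulrA ler_wpM2l ?expR_ge0//.
by apply: le_trans (holder_bs alpha g_gt0 w uA x y) _; rewrite sw mulrA.
Qed.

(** A quarter of the gap between p and u(0). In [weights_small] one share pays for the variation of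
    u near 0, one for the threshold on the number of 1s, one for the count of words, and the last
    one for twice [eps]. *)
Let d4 : R := (p - u X0) / 4.
Let d4_gt0 : 0 < d4. Proof. by rewrite divr_gt0 ?subr_gt0. Qed.

(** A term exceeds u(0) + d4 only if the next letter 1, or the end of the word, is fewer than k
    letters away. Each 1 is thus charged with [k.+1] terms of excess at most 2 B, and the end of the
    word with k more. *)
Lemma bs_runs : exists2 C1 : R, 0 <= C1 & forall w x,
  bs u w x <= (size w)%:R * (u X0 + d4) + C1 * (ones w)%:R + C1.
Proof.
have [d d0 hd] := holder_ucont g_gt0 uA d4_gt0.
have [k hk] := tpt_small alpha d0.
exists (k.+1%:R * (2 * B)); first by rewrite !mulr_ge0.
have B2 z : u z <= u X0 + d4 + 2 * B.
  have := uB z; have := uB X0; have := d4_gt0.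
  by rewrite !ler_norml => h0 /andP[h1 h2] /andP[h3 h4]; lra.
(* The last summand counts the surcharged letters of the current leading run; the next letter 1
   absorbs it. *)
suff Hm w x : bs u w x <= (size w)%:R * (u X0 + d4) +
    k.+1%:R * (2 * B) * (ones w)%:R + (minn k (find id w))%:R * (2 * B).
  move=> w x; apply: le_trans (Hm w x) _; rewrite lerD2l ler_wpM2r ?mulr_ge0//.
  by rewrite ler_nat; lia.
elim: w => [|[] w IH] /=; first by rewrite minn0 !mul0r mulr0 !addr0.
  have := B2 (branch alpha true (br w x)).
  have : (minn k (find id w))%:R * (2 * B) <= k%:R * (2 * B) :> R.
    by rewrite ler_wpM2r ?mulr_ge0// ler_nat geq_minl.
  rewrite minn0 mul0r addr0 addnC addn1 -!natr1 in IH *.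
  by move: IH; lra.
rewrite add0n -natr1.
have [h|h] := boolP (k <= find id w)%N.
  have -> : minn k (find id w).+1 = k by apply/minn_idPl; lia.
  have Ek : minn k (find id w) = k by apply/minn_idPl.
  rewrite {}Ek in IH.
  suff : u (branch alpha false (br w x)) <= u X0 + d4 by move: IH; lra.
  suff hh : `|pt (branch alpha false (br w x)) - pt X0| <= d.
    by have := hd _ _ hh; rewrite ler_norml => /andP[_]; lra.
  rewrite subr0 ger0_norm ?pt_ge0//; apply: le_trans (br_lead (false :: w) x) _.
  by apply: hk => /=; lia.
have -> : minn k (find id w).+1 = (find id w).+1 by apply/minn_idPr; lia.
have Ek : minn k (find id w) = find id w by apply/minn_idPr; lia.
rewrite {}Ek in IH; rewrite -natr1.
by have := B2 (branch alpha false (br w x)); move: IH; lra.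
Qed.

(* Words with a definite proportion of 1s contract distances exponentially, the
   others carry at most the weight e^(n (u 0 + small)), and u 0 < p. *)
Lemma weights_small (k : R) : 0 < k -> exists n, (0 < n)%N /\
  exists e : seq bool -> R,
  (forall w x, size w = n -> bs u w x <= e w) /\
  \sum_(w <- words n) expR (e w) * rateg alpha g ^+ ones w <= k * expR (n%:R * p).
Proof.
move=> k0; have [C1 C10 hC1] := bs_runs.
(* T is the parameter of an exponential Chebyshev bound on the number of 1s, large enough for the
   binomial sum of the e^(C1 - T) to grow at rate at most d4. *)
set T := C1 + d4^-1.
have T0 : 0 < T by rewrite ltr_wpDl// invr_gt0.
have hT : 1 + expR (C1 - T) <= expR d4.
  apply: le_trans (expR_ge1Dx _); rewrite lerD2l /T opprD addNKr expRN.
  rewrite -[leRHS]invrK lef_pV2 ?posrE ?expR_gt0 ?invr_gt0//.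
  by apply: le_trans (expR_ge1Dx _); rewrite lerDr.
set sg := - ln (rateg alpha g).
have sg0 : 0 < sg by rewrite oppr_gt0 ln_lt0// rateg_gt0 rateg_lt1.
set a := d4 / T; have a0 : 0 < a by rewrite divr_gt0.
(* A third, because [eps] is lost twice, in the distortion and in the growth bound, and must still
   be gained once. *)
set eps := Num.min (sg * a / 3) (d4 / 2).
have e0 : 0 < eps by rewrite lt_min; apply/andP; split; [apply: divr_gt0 => //; exact: mulr_gt0|exact: divr_gt0].
have e1 : eps <= sg * a / 3 by rewrite ge_min lexx.
have e2 : eps <= d4 / 2 by rewrite ge_min lexx orbT.
have [C C0 hC] := bs_var alpha (holder_ucont g_gt0 uA) uB e0.
have [Cp hCp] : grows_le u (p + eps) by apply: pP; rewrite ltrDl.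
pose E n w := bs u w X1 + (n%:R * eps + C).
have Esum n : \sum_(w <- words n) expR (E n w) * rateg alpha g ^+ ones w <=
    expR C * (Cp + expR C1) * expR (n%:R * - eps) * expR (n%:R * p).
  (* With at least a n letters 1 the first exponential suffices; otherwise T times their number is
     at most d4 n, and the second one is at least 1. *)
  have hk w : size w = n -> rateg alpha g ^+ ones w <=
      expR (- (sg * a * n%:R)) + expR (d4 * n%:R - T * (ones w)%:R).
    move=> sw; have -> : rateg alpha g ^+ ones w = expR (- sg * (ones w)%:R).
      by rewrite mulrC expRM_natl opprK lnK ?posrE ?rateg_gt0.
    have [h|/ltW h] := leP (a * n%:R) (ones w)%:R.
      apply: ler_wpDr; first exact: expR_ge0.
      by rewrite ler_expR -mulrA mulNr lerN2 ler_wpM2l ?(ltW sg0).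
    apply: ler_wpDl; first exact: expR_ge0.
    rewrite ler_expR; apply: (@le_trans _ _ 0).
      by rewrite mulNr oppr_le0 mulr_ge0// ltW.
    have -> : d4 = T * a by rewrite /a; field; rewrite gt_eqF.
    by rewrite -mulrA subr_ge0 ler_wpM2l// ltW.
  apply: (@le_trans _ _ (\sum_(w <- words n) (expR (n%:R * eps + C - sg * a * n%:R) * expR (bs u w X1) + expR (n%:R * eps + C + d4 * n%:R + n%:R * (u X0 + d4) + C1) * expR (C1 - T) ^+ ones w))).
    rewrite big_seq [leRHS]big_seq ler_sum// => w; rewrite mem_words => /eqP sw.
    apply: le_trans (ler_wpM2l (expR_ge0 _) (hk w sw)) _.
    rewrite mulrDr -!expRD -expRM_natl -expRD lerD ?ler_expR /E//; first by lra.
    by have := hC1 w X1; rewrite sw; lra.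
  rewrite big_split -!mulr_sumr sum_ones -ZnE.
  have -> : expR C * (Cp + expR C1) * expR (n%:R * - eps) * expR (n%:R * p) =
      Cp * (expR C * (expR (n%:R * - eps) * expR (n%:R * p))) +
      expR C * (expR C1 * (expR (n%:R * - eps) * expR (n%:R * p))) by ring.
  apply: lerD.
    apply: le_trans (ler_wpM2l (expR_ge0 _) (hCp n X1)) _.
    have Cp0 : 0 <= Cp.
      by have := hCp 0%N X1; rewrite /Zn /= mul0r expR0 mulr1; exact: le_trans.
    rewrite mulrCA.
    rewrite ler_wpM2l// -!expRD ler_expR.
    have := ler_wpM2r (ler0n R n) e1; lra.
  apply: (@le_trans _ _ (expR (n%:R * eps + C + d4 * n%:R + n%:R * (u X0 + d4) + C1) * expR d4 ^+ n)).
    by rewrite ler_wpM2l ?expR_ge0// lerXn2r ?nnegrE ?expR_ge0// addr_ge0 ?expR_ge0.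
  rewrite -expRM_natl -!expRD ler_expR.
  have -> : p = u X0 + d4 * 4 by rewrite /d4; field.
  have := ler_wpM2r (ler0n R n) e2; lra.
have Cp0 : 0 <= Cp.
  by have := hCp 0%N X1; rewrite /Zn /= mul0r expR0 mulr1; exact: le_trans.
set C' := expR C * (Cp + expR C1) in Esum.
have C'0 : 0 < C' by rewrite mulr_gt0 ?expR_gt0// ltr_wpDl ?expR_gt0.
have [n n0 hn] : exists2 n, (0 < n)%N & C' * expR (n%:R * - eps) <= k.
  exists (Num.truncn (C' / k / eps)).+1 => //; set n := _.+1.
  have hn : C' / k / eps < n%:R by exact: truncnS_gt.
  rewrite mulrN expRN ler_pdivrMr ?expR_gt0// -ler_pdivrMl// mulrC.
  apply: le_trans (expR_ge1Dx _); rewrite ltr_pdivrMr// in hn.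
  by apply: le_trans (ltW hn) _; rewrite lerDr.
exists n; split => //; exists (E n); split.
  move=> w x sw; have := hC w x X1; rewrite sw ler_norml /E => /andP[_]; lra.
by apply: le_trans (Esum n) _; rewrite ler_wpM2r ?expR_ge0.
Qed.

Lemma lasota_yorke (k : R) : 0 < k -> exists n, (0 < n)%N /\
  exists2 S : R, 0 <= S & forall psi D M, H psi D -> (forall x, `|psi x| <= M) ->
  H (iter n (Lop u) psi) (k * expR (n%:R * p) * D + S * M).
Proof.
move=> /weights_small[n [n0 [e [he hs]]]]; exists n; split => //.
exists (2 ^+ n * (expR (n%:R * B) * (n%:R * A))).
  by rewrite !mulr_ge0 ?exprn_ge0 ?expR_ge0.
move=> psi D M hD hM; apply: le_holder (LY_basic he hD hM).
by rewrite lerD2r ler_wpM2r// (holder_ge0 hD).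
Qed.

End lasota_yorke.

(** * Ultralimits and the positive eigenfunction *)

Section ultralimit.
Context {R : realType}.

Lemma nat_ultrafilter : exists U : set_system nat,
  [/\ UltraFilter U & \oo `<=` U].
Proof.
have [U [UU hU]] := @ultraFilterLemma nat \oo _.
by exists U.
Qed.

(** A single ultrafilter makes a sequence of functions converge at all points of [0,1]
    simultaneously, in place of a diagonal extraction. *)
Lemma ultra_cvg_bounded (U : set_system nat) (r : nat -> R) (M : R) :
  UltraFilter U -> (forall n, `|r n| <= M) -> exists l : R, r n @[n --> U] --> l.
Proof.
move=> UU hM; have UF : ProperFilter U by exact: ultra_proper.
have [|l [_ hl]] := @segment_compact R (- M) M (r n @[n --> U]) (fmap_proper_filter _ UF).
  by apply: (@filterE _ U) => n; rewrite /= in_itv/= -ler_norml.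
exists l => A lA; have [//|UA] := in_ultra_setVsetC (r @^-1` A) UU.
by have [t []] := hl (~` A) A UA lA.
Qed.

End ultralimit.

Section eigenfunction.
Context {R : realType} (alpha : {posnum R}) (g : R) (g_gt0 : 0 < g).
Local Notation X := (unit_itv R).
Local Notation br := (br alpha).
Local Notation H := (holder_with g).
Local Notation Lop := (Lop alpha).
Local Notation Zn := (Zn alpha).
Local Notation bs := (bs alpha).
Local Notation grows_le := (grows_le alpha).
Implicit Types (x y z : X) (b : bool) (w v : seq bool) (n : nat).
Implicit Types (psi : X -> R).

Variables (u : X -> R) (A B p : R).
Hypotheses (uA : H u A) (uB : forall x, `|u x| <= B).
Hypothesis pP : forall q, p < q -> grows_le u q.
Hypothesis p_min : forall q, grows_le u q -> p <= q.
Hypothesis u0p : u X0 < p.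

(* Partial sums of the resolvent of the transfer operator at e^q. *)
Let S (q : R) M x : R := \sum_(n < M) expR (- (n%:R * q)) * Zn u n x.

Let S_add (q : R) N M x :
  S q (N + M) x = S q N x + expR (- (N%:R * q)) * iter N (Lop u) (S q M) x.
Proof.
rewrite /S big_split_ord /=; congr (_ + _).
rewrite iter_LopE; under [in RHS]eq_bigr do rewrite mulr_sumr.
rewrite exchange_big mulr_sumr; apply: eq_bigr => i _.
rewrite Zn_add iter_LopE natrD mulrDl opprD expRD -mulrA; congr (_ * _).
by rewrite mulr_sumr; apply: eq_bigr => w _; rewrite mulrCA.
Qed.

Let S_ge0 (q : R) M x : 0 <= S q M x.
Proof. by rewrite sumr_ge0// => n _; rewrite mulr_ge0 ?expR_ge0 ?Zn_ge0. Qed.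

Let S_ge1 (q : R) M x : (0 < M)%N -> 1 <= S q M x.
Proof.
case: M => // M _; rewrite -add1n S_add {1}/S big_ord1 mul0r oppr0 expR0 mul1r.
have -> : Zn u ord0 x = 1 by [].
by rewrite lerDl mulr_ge0 ?expR_ge0// iter_Lop_ge0.
Qed.

Let Zn_holder n : exists2 D : R, 0 <= D & H (Zn u n) D.
Proof.
exists ((\sum_(w <- words n) expR (n%:R * B) * rateg alpha g ^+ ones w) * 0 +
  (2 ^+ n * (expR (n%:R * B) * (n%:R * A))) * 1).
  by rewrite mulr0 add0r mulr1 !mulr_ge0 ?exprn_ge0 ?expR_ge0// (holder_ge0 uA).
apply: (LY_basic g_gt0 uA uB).
- by move=> w x <-; apply: bs_le => z; apply: le_trans (ler_norm _) (uB z).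
- exact: holder_cst.
- by move=> x; rewrite normr1.
Qed.

Let S_holder N : exists2 D : R, 0 <= D & forall q : R, p <= q -> H (S q N) D.
Proof.
elim: N => [|N [D D0 hD]].
  by exists 0 => // q _ x y; rewrite /S !big_ord0 subrr normr0 mul0r.
have [E E0 hE] := Zn_holder N; exists (D + expR (- (N%:R * p)) * E).
  by rewrite addr_ge0// mulr_ge0 ?expR_ge0.
move=> q pq x y; rewrite /S !big_ord_recr /=.
have := holderD (hD q pq) (holderZ (expR (- (N%:R * q))) hE) x y.
move=> /le_trans; apply; rewrite ler_wpM2r ?powR_ge0// lerD2l ger0_norm ?expR_ge0//.
by rewrite ler_wpM2r// ler_expR lerN2 ler_wpM2l.
Qed.

(** A block of N steps at least halves the Hoelder constant of the previous partial sum and adds at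
    most (D + T') s, so the bound 2 (D + T') s is preserved. Neither K nor N depends on q, which
    allows q to tend to p. *)
Let S_holder_unif : exists2 K : R, 0 <= K & exists2 N, (0 < N)%N &
  forall (q : R) k (s : R), p <= q -> 1 <= s -> (forall x, S q (k * N) x <= s) ->
  H (S q (k * N)) (K * s).
Proof.
have h2 : 0 < 2^-1 :> R by rewrite invr_gt0.
have [N [N0 [T T0 hT]]] := lasota_yorke g_gt0 uA uB pP u0p h2.
have [D D0 hD] := S_holder N.
set T' := expR (- (N%:R * p)) * T.
have T'0 : 0 <= T' by rewrite mulr_ge0 ?expR_ge0.
exists (2 * (D + T')); first by rewrite mulr_ge0// addr_ge0.
exists N => // q k s pq s1.
elim: k => [|k IH] hs.
  by move=> x y; rewrite /S !big_ord0 subrr normr0 !mulr_ge0 ?powR_ge0 ?addr_ge0// (le_trans ler01).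
have hs' x : S q (k * N) x <= s.
  apply: le_trans (hs x); rewrite mulSn addnC S_add lerDl mulr_ge0 ?expR_ge0//.
  by rewrite iter_Lop_ge0// => z; exact: S_ge0.
have abs x : `|S q (k * N) x| <= s by rewrite ger0_norm ?S_ge0.
have h := hT _ _ _ (IH hs') abs.
have := holderD (hD q pq) (holderZ (expR (- (N%:R * q))) h).
have -> : (fun x => S q N x + expR (- (N%:R * q)) * iter N (Lop u) (S q (k * N)) x) = S q (k.+1 * N).
  by apply/funext => x; rewrite mulSn S_add.
apply: le_holder; rewrite ger0_norm ?expR_ge0//.
have eq : expR (- (N%:R * q)) * expR (N%:R * p) <= 1.
  rewrite -expRD -[leRHS]expR0 ler_expR.
  have := ler_wpM2l (ler0n R N) pq; lra.
have eT : expR (- (N%:R * q)) * T <= T'.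
  by rewrite ler_wpM2r// ler_expR lerN2 ler_wpM2l.
have DT0 : 0 <= (D + T') * s by rewrite mulr_ge0 ?addr_ge0// (le_trans ler01).
apply: (@le_trans _ _ (D * s + ((D + T') * s + T' * s))); last by lra.
apply: lerD; first by rewrite ler_peMr.
rewrite mulrDr; apply: lerD; last first.
  by rewrite mulrA ler_wpM2r// (le_trans ler01).
rewrite [X in X <= _](_ : _ = (expR (- (N%:R * q)) * expR (N%:R * p)) * ((D + T') * s)); last by field.
by rewrite ler_piMl.
Qed.

Let LopS (q : R) M x : expR (- q) * Lop u (S q M) x =
  S q M x - 1 + expR (- (M%:R * q)) * Zn u M x.
Proof.
have E : S q (1 + M) x = S q 1 x + expR (- (1 * q)) * Lop u (S q M) x := S_add q 1 M x.
have E1 : S q (1 + M) x = S q M x + expR (- (M%:R * q)) * Zn u M x.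
  by rewrite add1n /S big_ord_recr.
have E2 : S q 1 x = 1 by rewrite /S big_ord1 mul0r oppr0 expR0 mul1r.
by move: E; rewrite E1 E2 mul1r; lra.
Qed.

Let LopS_small (q : R) N : p < q -> (0 < N)%N -> exists2 k, (0 < k)%N & forall x,
  expR (- ((k * N)%:R * q)) * Zn u (k * N) x <= 2^-1.
Proof.
move=> pq N0; pose r := (p + q) / 2.
have pr : p < r by rewrite /r; lra.
have [C hC] := pP pr.
have C0 : 0 <= C.
  by have := hC 0%N X1; rewrite /Zn /= mul0r expR0 mulr1; exact: le_trans.
have d0 : 0 < q - r by rewrite /r; lra.
exists (Num.truncn (2 * C / (q - r))).+1 => // x; set k := _.+1.
have hk : 2 * C / (q - r) < k%:R by exact: truncnS_gt.
apply: le_trans (ler_wpM2l (expR_ge0 _) (hC _ x)) _.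
rewrite mulrCA -expRD.
have -> : - ((k * N)%:R * q) + (k * N)%:R * r = - ((k * N)%:R * (q - r)) by lra.
rewrite expRN ler_pdivrMr ?expR_gt0// -ler_pdivrMl// invrK.
apply: le_trans (expR_ge1Dx _); apply: ler_wpDl => //.
rewrite ltr_pdivrMr// in hk; apply: le_trans (ltW hk) _.
by rewrite ler_wpM2r ?(ltW d0)// ler_nat leq_pmulr.
Qed.

(* If the resolvent sum is bounded by s, then e^{-q} L contracts it by the
   factor 1 - 1/(2 s), which bounds the growth rate p from above. *)
Let S_large (q : R) M (s : R) : p < q -> (0 < M)%N ->
  (forall x, expR (- (M%:R * q)) * Zn u M x <= 2^-1) ->
  (forall x, S q M x <= s) -> (2 * (q - p))^-1 <= s + 1.
Proof.
move=> pq M0 small hs.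
have s1 : 1 <= s by apply: le_trans (hs X1); exact: S_ge1.
have s0 : 0 < s by apply: lt_le_trans s1.
set t := 1 - (2 * s)^-1.
have t0 : 0 < t.
  by rewrite subr_gt0 invf_lt1 ?mulr_gt0//; lra.
have step x : Lop u (S q M) x <= expR q * t * S q M x.
  rewrite -mulrA -ler_pdivrMl ?expR_gt0// -expRN LopS /t mulrBl mul1r.
  have : (2 * s)^-1 * S q M x <= 2^-1.
    rewrite invfM -mulrA ler_piMr// mulrC ler_pdivrMr ?mul1r//.
  have := small x; lra.
have steps n x : iter n (Lop u) (S q M) x <= (expR q * t) ^+ n * S q M x.
  elim: n x => [|n IH] x; first by rewrite expr0 mul1r.
  rewrite iterSr exprSr -mulrA; apply: (@le_trans _ _ (iter n (Lop u) (fun z => expR q * t * S q M z) x)).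
    exact: iter_Lop_le.
  rewrite iter_LopZ [leRHS]mulrCA ler_wpM2l//.
  by apply: ltW; apply: mulr_gt0 => //; exact: expR_gt0.
have gr : grows_le u (q + ln t).
  exists s => n x.
  have -> : expR (n%:R * (q + ln t)) = (expR q * t) ^+ n.
    by rewrite expRM_natl expRD lnK.
  apply: le_trans (_ : _ <= iter n (Lop u) (S q M) x) _.
    by apply: iter_Lop_le => z; exact: S_ge1.
  apply: le_trans (steps n x) _; rewrite mulrC ler_wpM2r// exprn_ge0//.
  by apply: ltW; apply: mulr_gt0 => //; exact: expR_gt0.
have := p_min gr; have lnt : ln t <= - (2 * s)^-1.
  by have := @le_ln1Dx R (- (2 * s)^-1); rewrite -/t; apply; rewrite ltrN2 invf_lt1 ?mulr_gt0//; lra.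
move=> h; have hqp : (2 * s)^-1 <= q - p by move: h lnt; lra.
have qp : 0 < q - p by rewrite subr_gt0.
rewrite invfM; have : (q - p)^-1 <= 2 * s.
  by rewrite -[leRHS]invrK lef_pV2 ?posrE// ?invr_gt0 ?mulr_gt0.
have : 0 < (q - p)^-1 by rewrite invr_gt0.
lra.
Qed.

(** By [S_large] the supremum s of the resolvent sum blows up as q decreases to p. After division by
    s the boundary terms of [LopS] become small, while the Hoelder constant stays bounded. *)
Let almost_eigen : exists2 K : R, 0 <= K & forall e : R, 0 < e ->
  exists psi, [/\ forall x, 0 <= psi x <= 1, H psi K, exists x, 2^-1 <= psi x &
    forall x, `|expR (- p) * Lop u psi x - psi x| <= e].
Proof.
have [K K0 [N N0 hK]] := S_holder_unif; exists K => // e e0.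
have uBB x : expR (u x) <= expR B.
  by rewrite ler_expR (le_trans (ler_norm _))// uB.
pose E := 2 * expR B.
have E0 : 0 < E by rewrite mulr_gt0 ?expR_gt0.
(* The first condition replaces e^(-q) by e^(-p) at a cost of e / 2; the second one forces s >= 2 /
   e through [S_large]. *)
have [q pq [hq1 hq2]] : exists2 q : R, p < q &
    (expR (- p) - expR (- q)) * E <= e / 2 /\ 4 / e + 4 <= (2 * (q - p))^-1.
  pose d := Num.min (e / 2 / (E * expR (- p))) (2 * (4 / e + 4))^-1.
  have c0 : 0 < 4 / e + 4 by rewrite addr_gt0// divr_gt0.
  have d0 : 0 < d.
    rewrite lt_min; apply/andP; split; last by rewrite invr_gt0 mulr_gt0.
    by apply: divr_gt0; [exact: divr_gt0|rewrite mulr_gt0 ?expR_gt0].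
  exists (p + d); first by rewrite ltrDl.
  split.
    have : expR (- p) * (1 - d) <= expR (- (p + d)).
      by rewrite opprD expRD ler_wpM2l ?expR_ge0//; exact: expR_ge1Dx.
    have : d <= e / 2 / (E * expR (- p)) by rewrite ge_min lexx.
    rewrite ler_pdivlMr ?mulr_gt0 ?expR_gt0// => h1 h2.
    apply: (@le_trans _ _ ((expR (- p) * d) * E)); last by move: h1; lra.
    by rewrite ler_wpM2r ?(ltW E0)//; move: h2; lra.
  have -> : p + d - p = d by lra.
  have : d <= (2 * (4 / e + 4))^-1 by rewrite ge_min lexx orbT.
  move=> h; rewrite -[leLHS]invrK lef_pV2 ?posrE ?invr_gt0 ?mulr_gt0//.
  apply: le_trans (_ : 2 * (2 * (4 / e + 4))^-1 <= _); first by rewrite ler_wpM2l.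
  by rewrite invfM mulrA divff// mul1r.
have [k k0 small] := LopS_small pq N0.
set M := (k * N)%N in small; have M0 : (0 < M)%N by rewrite muln_gt0 k0.
have bdd : has_sup (range (S q M)).
  split; first by exists (S q M X1); exists X1.
  have [D D0 hD] := S_holder M.
  exists (`|S q M X1| + D) => _ [x _ <-].
  have := holder_bounded g_gt0 (hD q (ltW pq)) x X1; have := ler_norm (S q M X1).
  by rewrite ler_norml => h /andP[_]; lra.
set s := sup (range (S q M)).
have hs x : S q M x <= s by apply: sup_upper_bound => //; exists x.
have s1 : 1 <= s by apply: le_trans (hs X1); exact: S_ge1.
have s0 : 0 < s by apply: lt_le_trans s1.
have sl := S_large pq M0 small hs.
have se : 2 / e <= s.
  have : 0 < e^-1 by rewrite invr_gt0.
  by move: hq2 sl; set i := (2 * _)^-1; lra.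
have is1 : s^-1 <= e / 2.
  by rewrite -[leRHS]invrK lef_pV2 ?posrE ?invr_gt0 ?divr_gt0// invf_div.
have is0 : 0 < s^-1 by rewrite invr_gt0.
exists (fun x => s^-1 * S q M x); split.
- move=> x; rewrite mulr_ge0 ?S_ge0 ?(ltW is0)//=.
  by rewrite mulrC ler_pdivrMr// mul1r.
- apply: le_holder (holderZ s^-1 (hK q k s (ltW pq) s1 hs)).
  by rewrite gtr0_norm// mulrCA mulVf ?mulr1// gt_eqF.
- have [_ [x _ <-] hx] := sup_adherent (divr_gt0 s0 (ltr0n R 2)) bdd.
  exists x; rewrite mulrC ler_pdivlMr// mulrC; move: hx; rewrite -/s; lra.
- move=> x.
  pose psi z := s^-1 * S q M z.
  change (`|expR (- p) * Lop u psi x - psi x| <= e).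
  have hL : 0 <= Lop u psi x <= E.
    have p0 z : 0 <= psi z by rewrite mulr_ge0 ?S_ge0 ?(ltW is0).
    have p1 z : psi z <= 1 by rewrite /psi mulrC ler_pdivrMr// mul1r.
    rewrite /Lop addr_ge0 ?(mulr_ge0 (expR_ge0 _) (p0 _))//=.
    have -> : E = expR B + expR B by rewrite /E; ring.
    by apply: lerD; rewrite -[leRHS]mulr1; apply: ler_pM; rewrite ?expR_ge0 ?p0 ?p1 ?uBB.
  have LE : expR (- q) * Lop u psi x = psi x + s^-1 * (expR (- (M%:R * q)) * Zn u M x - 1).
    have -> : Lop u psi x = s^-1 * Lop u (S q M) x by rewrite /Lop /psi; ring.
    by rewrite mulrCA LopS /psi; ring.
  have Zg : 0 <= expR (- (M%:R * q)) * Zn u M x by rewrite mulr_ge0 ?expR_ge0 ?Zn_ge0.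
  have Zs := small x.
  have epq : expR (- q) <= expR (- p) by rewrite ler_expR lerN2 ltW.
  have -> : expR (- p) * Lop u psi x - psi x = (expR (- p) - expR (- q)) * Lop u psi x + s^-1 * (expR (- (M%:R * q)) * Zn u M x - 1).
    by rewrite mulrBl LE; ring.
  have h1 : 0 <= (expR (- p) - expR (- q)) * Lop u psi x <= e / 2.
    case/andP: hL => L0 L1.
    rewrite mulr_ge0 ?subr_ge0//=; apply: le_trans hq1.
    by rewrite ler_wpM2l ?subr_ge0.
  have h2 : - (e / 2) <= s^-1 * (expR (- (M%:R * q)) * Zn u M x - 1) <= 0.
    apply/andP; split.
      apply: le_trans (_ : - s^-1 <= _); first by rewrite lerN2.
      by rewrite -[leLHS]mulr1 mulNr -mulrN ler_wpM2l ?(ltW is0)//; move: Zg; lra.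
    by rewrite mulr_ge0_le0 ?(ltW is0)//; move: Zs; lra.
  case/andP: h1 => ? ?; case/andP: h2 => ? ?.
  by rewrite ler_norml; apply/andP; split; lra.
Qed.

Theorem eigenfunction : exists h : X -> R, exists K c : R,
  [/\ 0 < c, H h K, forall x, c <= h x <= 1 & forall x, Lop u h x = expR p * h x].
Proof.
have [K K0 ae] := almost_eigen.
have /choice[V hV] (n : nat) : exists psi, [/\ forall x, 0 <= psi x <= 1, H psi K,
    exists x, 2^-1 <= psi x &
    forall x, `|expR (- p) * Lop u psi x - psi x| <= n.+1%:R^-1].
  by apply: ae; rewrite invr_gt0.
have [U [UU Uoo]] := nat_ultrafilter.
have UF : ProperFilter U by exact: ultra_proper.
have /choice[h hh] x : exists l : R, V n x @[n --> U] --> l.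
  apply: (ultra_cvg_bounded (M := 1) UU) => n.
  by have [/(_ x)/andP[? ?]] := hV n => *; rewrite ger0_norm.
have h01 x : 0 <= h x <= 1.
  apply/andP; split.
    apply: (cvgr_to_ge (hh x)); apply: nearW => n.
    by have [/(_ x)/andP[]] := hV n.
  apply: (cvgr_to_le (hh x)); apply: nearW => n.
  by have [/(_ x)/andP[]] := hV n.
have hK : H h K.
  move=> x y; have hxy : `|V n x - V n y| @[n --> U] --> `|h x - h y|.
    by apply: cvg_norm; apply: cvgB; exact: hh.
  by apply: (cvgr_to_le hxy); apply: nearW => n; have [_ + _ _] := hV n; exact.
have hL x : Lop u h x = expR p * h x.
  have cL : expR (- p) * Lop u (V n) x - V n x @[n --> U] -->
      expR (- p) * Lop u h x - h x.
    apply: cvgB (hh x); apply: cvgMl_tmp; rewrite /Lop.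
    by apply: cvgD; apply: cvgMl_tmp; exact: hh.
  have c0 : expR (- p) * Lop u (V n) x - V n x @[n --> U] --> (0 : R).
    apply: (@cvg_trans _ ((expR (- p) * Lop u (V n) x - V n x) @[n --> \oo])).
      by move=> Q /=; exact: Uoo.
    apply/cvgrPdist_le => e e0; near=> n; rewrite sub0r normrN.
    have [_ _ _ /(_ x)] := hV n => /le_trans; apply.
    near: n; exists (Num.truncn e^-1) => // n /= ne.
    rewrite -[leRHS]invrK lef_pV2 ?posrE ?invr_gt0//; apply: ltW.
    by apply: lt_le_trans (truncnS_gt _) _; rewrite ler_nat.
  have E := cvg_unique (@Rhausdorff R) cL c0.
  have {E} E : expR (- p) * Lop u h x = h x.
    by apply/eqP; rewrite -subr_eq0; apply/eqP; exact: E.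
  rewrite -[h x]E.
  by rewrite mulrA -expRD subrr expR0 mul1r.
(* The points where [V n] is at least 1/2 move with n. By the common Hoelder bound, the sum over the
   endpoints of all words of length m is at least 1/4 for every n, and this finite sum passes to the
   limit. *)
have [z hz] : exists z, 0 < h z.
  have h4 : 0 < 4^-1 :> R by rewrite invr_gt0.
  have [m hm] := holder_cylinder alpha g_gt0 K0 h4.
  have c1 : \sum_(w <- words m) V n (br w X1) @[n --> U] --> \sum_(w <- words m) h (br w X1).
    elim: (words m) => [|w s IH].
      by under eq_fun do rewrite big_nil; rewrite big_nil; exact: cvg_cst.
    under eq_fun do rewrite big_cons; rewrite big_cons.
    by apply: cvgD IH; exact: hh.
  have : 4^-1 <= \sum_(w <- words m) h (br w X1).
    apply: (cvgr_to_ge c1); apply: nearW => n.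
    have [V01 VK [y hy] _] := hV n.
    rewrite (big_rem (code alpha m y)) ?mem_words ?size_code//=.
    apply: ler_wpDr; first by rewrite sumr_ge0// => w _; case/andP: (V01 (br w X1)).
    have := hm _ VK (code alpha m y) (iter m (intermittent_map alpha) y) X1.
    by rewrite size_code br_code => /(_ (leqnn _)); rewrite ler_norml => /andP[_]; lra.
  move=> hs; apply: contrapT => H0.
  suff : \sum_(w <- words m) h (br w X1) <= 0 by lra.
  by rewrite sumr_le0// => w _; rewrite leNgt; apply/negP => ?; apply: H0; exists (br w X1).
have h4 : 0 < h z / 2 by rewrite divr_gt0.
have [m hm] := holder_cylinder alpha g_gt0 K0 h4.
set w := code alpha m z.
(* In L^m h = e^(m p) h only the word w of z is kept: [br w x] is close enough to z for h to be at
   least h z / 2 there. *)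
pose c := expR (- (m%:R * p)) * (expR (- (m%:R * B)) * (h z / 2)).
have Ln n x : iter n (Lop u) h x = expR (n%:R * p) * h x.
  elim: n => [|n IH]; first by rewrite mul0r expR0 mul1r.
  rewrite iterSr (eq_iter_Lop alpha u n x hL) iter_LopZ IH -natr1 mulrDl mul1r expRD.
  by rewrite mulrCA mulrA.
exists h, K, c; split => //.
  by rewrite !mulr_gt0 ?expR_gt0 ?divr_gt0.
move=> x; rewrite andbC; case/andP: (h01 x) => _ -> /=.
rewrite /c expRN (ler_pdivrMl _ _ (expR_gt0 _)) -(Ln m x).
rewrite iter_LopE.
rewrite (big_rem w) ?mem_words ?size_code//=; apply: ler_wpDr.
  rewrite sumr_ge0// => v _; rewrite mulr_ge0 ?expR_ge0//.
  by case/andP: (h01 (br v x)).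
rewrite ler_pM ?expR_ge0 ?divr_ge0 ?(ltW hz)//.
  rewrite ler_expR -mulrN -[in X in X%:R * _](size_code alpha m z).
  by apply: bs_ge => y; have := uB y; rewrite ler_norml => /andP[].
have := hm _ hK w x (iter m (intermittent_map alpha) z).
rewrite size_code br_code => /(_ (leqnn _)).
by rewrite ler_norml => /andP[+ _]; lra.
Unshelve. all: by end_near. Qed.

End eigenfunction.

(** * The normalized operator and its exponential decay *)

Section normalized.
Context {R : realType} (alpha : {posnum R}).
Local Notation X := (unit_itv R).
Local Notation br := (br alpha).
Local Notation Lop := (Lop alpha).
Local Notation bs := (bs alpha).
Implicit Types (x y z : X) (b : bool) (w v : seq bool) (n m : nat).
Implicit Types (psi : X -> R).
Variables (u h : X -> R) (p c : R).
Hypotheses (c_gt0 : 0 < c) (h01 : forall x, c <= h x <= 1).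
Hypothesis hL : forall x, Lop u h x = expR p * h x.

Lemma eig_gt0 x : 0 < h x.
Proof. by case/andP: (h01 x) => h1 _; exact: lt_le_trans h1. Qed.

Lemma iter_Lop_eig n x : iter n (Lop u) h x = expR (n%:R * p) * h x.
Proof.
elim: n => [|n IH]; first by rewrite mul0r expR0 mul1r.
rewrite iterSr (eq_iter_Lop alpha u n x hL) iter_LopZ IH -natr1 mulrDl mul1r expRD.
by rewrite mulrCA mulrA.
Qed.

(** Conjugating by the eigenfunction turns the weights of the words of length n into a probability
    vector at every x, and makes them multiplicative under concatenation. *)
Definition th w x : R := expR (bs u w x - (size w)%:R * p) * h (br w x) / h x.

Definition NL n psi x : R := \sum_(w <- words n) th w x * psi (br w x).

Lemma th_gt0 w x : 0 < th w x.
Proof. by rewrite /th !mulr_gt0 ?expR_gt0 ?invr_gt0 ?eig_gt0. Qed.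

Lemma th_ge0 w x : 0 <= th w x. Proof. exact/ltW/th_gt0. Qed.

Lemma th_nil x : th [::] x = 1.
Proof. by rewrite /th /= mul0r subr0 expR0 mul1r divff// gt_eqF ?eig_gt0. Qed.

Lemma th_cat v w x : th (v ++ w) x = th v (br w x) * th w x.
Proof.
rewrite /th bs_cat br_cat size_cat natrD.
have -> : bs u v (br w x) + bs u w x - ((size v)%:R + (size w)%:R) * p =
  (bs u v (br w x) - (size v)%:R * p) + (bs u w x - (size w)%:R * p) by ring.
rewrite expRD; field; apply/andP; split; rewrite gt_eqF ?eig_gt0//.
Qed.

Lemma NLE n psi x : NL n psi x =
  expR (- (n%:R * p)) * iter n (Lop u) (fun z => h z * psi z) x / h x.
Proof.
rewrite iter_LopE mulr_sumr mulr_suml /NL big_seq [RHS]big_seq.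
apply: eq_bigr => w; rewrite mem_words => /eqP sw; rewrite /th sw expRD.
by field; rewrite gt_eqF ?eig_gt0.
Qed.

Lemma sum_th n x : \sum_(w <- words n) th w x = 1.
Proof.
transitivity (NL n (fun=> 1) x); first by apply: eq_bigr => w _; rewrite mulr1.
rewrite NLE (@eq_iter_Lop _ alpha u _ h); last by move=> z; rewrite mulr1.
rewrite iter_Lop_eig mulrA -expRD addNr expR0 mul1r divff// gt_eqF ?eig_gt0//.
Qed.

Lemma NL_add m n psi x : NL (m + n) psi x = NL n (NL m psi) x.
Proof.
rewrite /NL big_words_add exchange_big; apply: eq_bigr => v _.
rewrite mulr_sumr; apply: eq_bigr => w _; rewrite th_cat br_cat; ring.
Qed.

Lemma NL_le n psi1 psi2 x : (forall z, psi1 z <= psi2 z) -> NL n psi1 x <= NL n psi2 x.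
Proof. by move=> le; rewrite ler_sum// => w _; rewrite ler_wpM2l ?th_ge0. Qed.

Lemma NL_cst n (a : R) x : NL n (fun=> a) x = a.
Proof. by rewrite /NL -mulr_suml sum_th mul1r. Qed.

Lemma NL_range n psi (a b : R) x : (forall z, a <= psi z <= b) -> a <= NL n psi x <= b.
Proof.
move=> ab; rewrite -{1}(NL_cst n a x) -{1}(NL_cst n b x).
by apply/andP; split; apply: NL_le => z; case/andP: (ab z).
Qed.

Lemma NLD n psi1 psi2 x :
  NL n (fun z => psi1 z + psi2 z) x = NL n psi1 x + NL n psi2 x.
Proof. by rewrite /NL -big_split; apply: eq_bigr => w _; rewrite mulrDr. Qed.

Lemma NLZ n (a : R) psi x : NL n (fun z => a * psi z) x = a * NL n psi x.
Proof. by rewrite /NL mulr_sumr; apply: eq_bigr => w _; rewrite mulrCA. Qed.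

Lemma NLB n psi (a : R) x : NL n (fun z => psi z - a) x = NL n psi x - a.
Proof. by rewrite (NLD n psi (fun=> - a)) NL_cst. Qed.

Lemma th_ge (B : R) w x : (forall z, - B <= u z) ->
  c * expR (- ((size w)%:R * (B + p))) <= th w x.
Proof.
move=> uB; rewrite /th.
have h1 : expR (- ((size w)%:R * (B + p))) <= expR (bs u w x - (size w)%:R * p).
  by rewrite ler_expR; have := bs_ge alpha w x uB; lra.
case/andP: (h01 x) => _ hx1; case/andP: (h01 (br w x)) => hc _.
rewrite ler_pdivlMr ?eig_gt0//.
apply: (@le_trans _ _ (c * expR (- ((size w)%:R * (B + p))))).
  by rewrite ler_piMr// mulr_ge0 ?expR_ge0// ltW.
by rewrite mulrC ler_pM ?expR_ge0// ltW.
Qed.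

Lemma th_le (e : R) w x y : `|bs u w x - bs u w y| <= e ->
  th w x <= c ^- 2 * expR e * th w y.
Proof.
rewrite ler_norml => /andP[_ he].
case/andP: (h01 x) => hx0 hx1; case/andP: (h01 y) => hy0 hy1.
case/andP: (h01 (br w x)) => bx0 bx1; case/andP: (h01 (br w y)) => by0 by1.
rewrite /th ler_pdivrMr ?eig_gt0//.
have e1 : expR (bs u w x - (size w)%:R * p) <= expR e * expR (bs u w y - (size w)%:R * p).
  by rewrite -expRD ler_expR; lra.
have -> : c ^- 2 * expR e * (expR (bs u w y - (size w)%:R * p) * h (br w y) / h y) * h x
  = (expR e * expR (bs u w y - (size w)%:R * p)) * (c ^- 2 * h (br w y) * h x / h y) by field; rewrite !gt_eqF ?eig_gt0.
apply: ler_pM; rewrite ?expR_ge0// ?(ltW (eig_gt0 _))//.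
rewrite ler_pdivlMr ?eig_gt0// -mulrA ler_pdivlMl ?exprn_gt0//.
apply: (@le_trans _ _ (c ^+ 2)); last by rewrite expr2 ler_pM// ltW.
by rewrite ler_piMr ?exprn_ge0 ?(ltW c_gt0)// mulr_ile1// ltW// eig_gt0.
Qed.

Section decay.
Variables (g : R) (A B K : R).
Local Notation H := (holder_with g).
Hypotheses (g_gt0 : 0 < g) (uA : H u A) (uB : forall x, `|u x| <= B) (hK : H h K).
Hypothesis pP : forall q, p < q -> grows_le alpha u q.
Hypothesis u0p : u X0 < p.

Let K_ge0 : 0 <= K. Proof. exact: holder_ge0 hK. Qed.

(** The raw inequality is used with c / 4, since dividing by h >= c costs 1 / c. Constants are fixed
    by the normalized operator, so subtracting a beforehand replaces the sup norm by the oscillation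
    E. *)
Let NL_lasota_yorke : exists n, (0 < n)%N /\ exists2 C : R, 0 < C &
  forall psi D (a E : R), H psi D -> (forall x, a <= psi x <= a + E) ->
  H (NL n psi) (4^-1 * D + C * E).
Proof.
have k0 : 0 < c / 4 by rewrite divr_gt0.
have [n [n0 [S S0 hS]]] := lasota_yorke g_gt0 uA uB pP u0p k0.
exists n; split => //.
pose S' := expR (- (n%:R * p)) * S.
have S'0 : 0 <= S' by rewrite mulr_ge0// expR_ge0.
have ic0 : 0 < c^-1 by rewrite invr_gt0.
exists (4^-1 * K + S' / c + K / c ^+ 2 + 1).
  have a1 : 0 <= S' / c by rewrite divr_ge0// ltW.
  have a2 : 0 <= K / c ^+ 2 by rewrite divr_ge0// exprn_ge0// ltW.
  by have := K_ge0; lra.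
move=> psi D a E hD hE.
have E0 : 0 <= E by case/andP: (hE X1); lra.
have D0 := holder_ge0 hD.
pose q z := h z * (psi z - a).
have qE x : 0 <= q x <= E.
  case/andP: (hE x) => h1 h2; case/andP: (h01 x) => h3 h4.
  rewrite /q mulr_ge0 ?(ltW (eig_gt0 _)) ?subr_ge0//=.
  by rewrite -[leRHS]mul1r ler_pM ?(ltW (eig_gt0 _)) ?subr_ge0//; lra.
have qH : H q (K * E + 1 * D).
  apply: holderM => //.
  - have := holderD hD (@holder_cst R g (- a)); apply: le_holder; lra.
  - by move=> x; rewrite ger0_norm ?(ltW (eig_gt0 _))//; case/andP: (h01 x).
  - by move=> x; case/andP: (hE x) => *; rewrite ger0_norm; lra.
have qN x : `|q x| <= E by case/andP: (qE x) => ? ?; rewrite ger0_norm.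
have GH := holderZ (expR (- (n%:R * p))) (hS _ _ _ qH qN).
set G := fun x => _ in GH.
have GE x : G x = NL n (fun z => psi z - a) x * h x.
  by rewrite NLE -mulrA mulVf ?mulr1// gt_eqF ?eig_gt0.
have GN x : `|G x| <= E.
  have /andP[r0 r1] : 0 <= NL n (fun z => psi z - a) x <= E.
    by apply: NL_range => z; case/andP: (hE z) => *; apply/andP; split; lra.
  rewrite GE ger0_norm ?mulr_ge0 ?(ltW (eig_gt0 _))//.
  rewrite -[leRHS]mulr1 ler_pM ?(ltW (eig_gt0 _))//; by case/andP: (h01 x).
have VN x : `|(h x)^-1| <= c^-1.
  rewrite ger0_norm ?invr_ge0 ?(ltW (eig_gt0 _))// lef_pV2 ?posrE ?eig_gt0//.
  by case/andP: (h01 x).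
have hc x : c <= h x by case/andP: (h01 x).
have := holderM GH (holderV hK c_gt0 hc) GN VN.
have -> : (fun x => G x * (h x)^-1) = (fun x => NL n psi x - a).
  by apply/funext => x; rewrite GE mulfK ?gt_eqF ?eig_gt0// NLB.
move=> hh x y; have := hh x y.
have -> : NL n psi x - a - (NL n psi y - a) = NL n psi x - NL n psi y by ring.
move/le_trans; apply; rewrite ler_wpM2r ?powR_ge0//.
rewrite ger0_norm ?expR_ge0//.
have -> : expR (- (n%:R * p)) * (c / 4 * expR (n%:R * p) * (K * E + 1 * D) + S * E) / c + E * (K / c ^+ 2) = 
   (expR (- (n%:R * p)) * expR (n%:R * p)) * (4^-1 * (K * E + D)) + S' / c * E + K / c ^+ 2 * E.
  by rewrite /S'; field; rewrite gt_eqF.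
rewrite -expRD addNr expR0 mul1r.
by lra.
Qed.

(* One step of the Doeblin-Fortet argument: on a single short cylinder psi is
   almost constant, and every point has a preimage there with weight >= eta. *)
Let contraction : exists2 N, (0 < N)%N & exists C k : R,
  [/\ 0 < C, 0 < k < 1 & forall psi (a E : R), 0 < E -> H psi (C * E) ->
  (forall x, a <= psi x <= a + E) ->
  H (NL N psi) (C * (k * E)) /\
  exists a', forall x, a' <= NL N psi x <= a' + k * E].
Proof.
have [n [n0 [C C0 LY]]] := NL_lasota_yorke.
(* The constant 4 C E drops to 2 C E after one block and stays below it, since 2 C / 4 + C <= 2
   C. *)
have it psi a E : 0 < E -> H psi (4 * C * E) -> (forall x, a <= psi x <= a + E) ->
  forall j, H (NL (j.+1 * n) psi) (2 * C * E).
  move=> E0 hp hr; elim=> [|j IH].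
    rewrite mul1n; apply: le_holder (LY _ _ _ _ hp hr); lra.
  have -> : NL (j.+2 * n) psi = NL n (NL (j.+1 * n) psi).
    by apply/funext => x; rewrite mulSn addnC NL_add.
  have hr' x : a <= NL (j.+1 * n) psi x <= a + E by exact: NL_range.
  apply: le_holder (LY _ _ _ _ IH hr').
  have : 0 <= C * E by rewrite mulr_ge0 ?ltW.
  lra.
have C40 : 0 <= 4 * C by rewrite mulr_ge0// ltW.
have q0 : 0 < 4^-1 :> R by rewrite invr_gt0.
have [m hm] := holder_cylinder alpha g_gt0 C40 q0.
pose N := (m.+1 * n)%N.
have mN : (m <= N)%N by rewrite /N; apply: leq_trans (leq_pmulr _ n0).
have uB' z : - B <= u z by have := uB z; rewrite ler_norml => /andP[].
pose eta := c * expR (- (N%:R * (B + p))).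
have eta0 : 0 < eta by rewrite mulr_gt0 ?expR_gt0.
exists N; first by rewrite muln_gt0.
(* The first entry is the contraction of the oscillation, the second that of the Hoelder
   constant. *)
pose k := Num.max (1 - eta / 4) 2^-1.
have k1 : k < 1 by rewrite gt_max; apply/andP; split; lra.
have k2 : 2^-1 <= k by rewrite le_max lexx orbT.
have k3 : 1 - eta / 4 <= k by rewrite le_max lexx.
exists (4 * C), k; split.
- by rewrite mulr_gt0.
- by rewrite k1 andbT; lra.
move=> psi a E E0 hp hr; split.
  apply: le_holder (it _ _ _ E0 hp hr m); have : 0 < C * E by rewrite mulr_gt0.
  by move=> CE; have := ler_wpM2l (ltW CE) k2; lra.
pose w := nseq N false; have sw : size w = N by rewrite size_nseq.
have wN : w \in words N by rewrite mem_words sw.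
have var x y : `|psi (br w x) - psi (br w y)| <= E / 4.
  have hE : H (fun x => E^-1 * psi x) (4 * C).
    have := holderZ E^-1 hp; apply: le_holder.
    by rewrite gtr0_norm ?invr_gt0// mulrCA mulVf ?mulr1// gt_eqF.
  have := hm _ hE w x y; rewrite sw => /(_ mN).
  rewrite -mulrBr normrM gtr0_norm ?invr_gt0// ler_pdivrMl//.
have thw x : eta <= th w x.
  by have := th_ge w x uB'; rewrite sw.
have NLw x : NL N psi x = th w x * psi (br w x) +
    \sum_(v <- rem w (words N)) th v x * psi (br v x).
  by rewrite /NL (big_rem w).
have S1 x : \sum_(v <- rem w (words N)) th v x = 1 - th w x.
  by have := sum_th N x; rewrite (big_rem w)//= => <-; ring.
have thw1 x : th w x <= 1.
  by rewrite -subr_ge0 -S1 sumr_ge0// => v _; exact: th_ge0.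
have low x : a * (1 - th w x) <= \sum_(v <- rem w (words N)) th v x * psi (br v x).
  rewrite mulrC -S1 mulr_suml ler_sum// => v _; rewrite ler_wpM2l ?th_ge0//.
  by case/andP: (hr (br v x)).
have upp x : \sum_(v <- rem w (words N)) th v x * psi (br v x) <= (a + E) * (1 - th w x).
  rewrite mulrC -S1 mulr_suml ler_sum// => v _; rewrite ler_wpM2l ?th_ge0//.
  by case/andP: (hr (br v x)).
(* The values of psi at the points [br w x] are all within E / 4 of [psi (br w X1)]. If the latter
   lies in the upper half of the range, the lower bound rises by (1 - k) E; otherwise the upper
   bound drops by as much. *)
have [hv|hv] := leP (a + E / 2) (psi (br w X1)).
  exists (a + (1 - k) * E) => x.
  have /andP[_ r1] := NL_range N x hr.
  rewrite (_ : a + (1 - k) * E + k * E = a + E); last by ring.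
  rewrite r1 andbT NLw.
  have : a + E / 4 <= psi (br w x).
    by have := var x X1; rewrite ler_norml => /andP[+ _]; lra.
  move=> hx; have := low x; have := ler_wpM2l (th_ge0 w x) hx.
  have := ler_wpM2r (ltW E0) (thw x); have := ler_wpM2r (ltW E0) k3; lra.
exists a => x; have /andP[-> _] := NL_range N x hr; rewrite /= NLw.
have : psi (br w x) <= a + E - E / 4.
  by have := var x X1; rewrite ler_norml => /andP[_]; lra.
move=> hx; have := upp x; have := ler_wpM2l (th_ge0 w x) hx.
have := ler_wpM2r (ltW E0) (thw x); have := ler_wpM2r (ltW E0) k3; lra.
Qed.

Theorem NL_decay : exists Q r : R, [/\ 0 < Q, 0 < r < 1 &
  forall psi D n x y, H psi D -> `|NL n psi x - NL n psi y| <= Q * D * r ^+ n].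
Proof.
have [N N0 [C [k [C0 /andP[k0 k1] ctr]]]] := contraction.
pose r := k `^ (N%:R^-1).
have rN : r ^+ N = k.
  by rewrite -powR_mulrn ?powR_ge0// -powRrM mulVf ?powRr1 ?(ltW k0)// pnatr_eq0 -lt0n.
have r0 : 0 < r by rewrite powR_gt0.
have r1 : r < 1.
  by rewrite -(@expr_lt1 _ N)// ?rN// ltW.
have iC : 0 < C^-1 by rewrite invr_gt0.
exists ((2 + C^-1) / k), r; split.
- by rewrite divr_gt0// addr_gt0.
- by rewrite r0.
move=> psi D n x y hD; have D0 := holder_ge0 hD.
have [D00|Dn0] := eqVneq D 0.
  rewrite D00 mulr0 mul0r.
  have -> : psi = fun=> psi X1.
    apply/funext => z; apply/eqP; rewrite -subr_eq0 -normr_le0.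
    by have := hD z X1; rewrite D00 mul0r.
  by rewrite !NL_cst subrr normr0.
have {Dn0}D1 : 0 < D by rewrite lt_def Dn0.
(* Large enough to start the iteration: the oscillation is at most 2 D <= E, and D <= C E. *)
pose E := (2 + C^-1) * D; have E0 : 0 < E by rewrite mulr_gt0// addr_gt0.
have its j : H (NL (j * N) psi) (C * (k ^+ j * E)) /\
    exists a, forall z, a <= NL (j * N) psi z <= a + k ^+ j * E.
  elim: j => [|j [IH1 [a IH2]]].
    have N0' : NL 0 psi = psi.
      by apply/funext => z; rewrite /NL big_seq1 th_nil mul1r.
    rewrite mul0n N0' expr0 mul1r; split.
      apply: le_holder hD; rewrite /E mulrA mulrDr mulfV ?gt_eqF//.
      by rewrite ler_peMl// lerDr mulr_ge0// ltW.
    exists (psi X1 - D) => z; have := holder_bounded g_gt0 hD z X1.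
    rewrite ler_norml => /andP[h1 h2]; have CD : 0 < C^-1 * D by rewrite mulr_gt0.
    by apply/andP; rewrite /E; split; lra.
  have Ej : 0 < k ^+ j * E by rewrite mulr_gt0// exprn_gt0.
  have -> : NL (j.+1 * N) psi = NL N (NL (j * N) psi).
    by apply/funext => z; rewrite mulSn addnC NL_add.
  by have := ctr _ _ _ Ej IH1 IH2; rewrite exprS -!mulrA.
have [_ [a ha]] := its (n %/ N)%N.
have {}ha z : a <= NL n psi z <= a + k ^+ (n %/ N) * E.
  by rewrite {1 2}(divn_eq n N) NL_add; exact: NL_range.
have hk : k ^+ (n %/ N) <= r ^+ n / k.
  rewrite ler_pdivlMr// -exprSr -{1}rN -exprM ler_wiXn2l ?(ltW r0) ?(ltW r1)//.
  by rewrite mulnC ltnW// ltn_ceil.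
apply: (@le_trans _ _ (k ^+ (n %/ N) * E)).
  have := ha x; have := ha y => /andP[? ?] /andP[? ?].
  by rewrite ler_norml; apply/andP; split; lra.
apply: le_trans (ler_wpM2r (ltW E0) hk) _.
by rewrite /E le_eqVlt; apply/orP; left; apply/eqP; ring.
Qed.

End decay.
End normalized.

(** * The invariant functional and the cylinder masses *)

Section functional.
Context {R : realType} (alpha : {posnum R}).
Local Notation X := (unit_itv R).
Local Notation br := (br alpha).
Local Notation Lop := (Lop alpha).
Local Notation bs := (bs alpha).
Implicit Types (x y z : X) (b : bool) (w v : seq bool) (n m : nat).
Implicit Types (psi : X -> R).
Variables (u h : X -> R) (p c : R).
Hypotheses (c_gt0 : 0 < c) (h01 : forall x, c <= h x <= 1).
Hypothesis hL : forall x, Lop u h x = expR p * h x.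
Variables (g : R) (A B K : R).
Local Notation H := (holder_with g).
Hypotheses (g_gt0 : 0 < g) (uA : H u A) (uB : forall x, `|u x| <= B) (hK : H h K).
Local Notation NL := (NL alpha u h p).
Local Notation th := (th alpha u h p).
Variables (Q r : R).
Hypotheses (Q_gt0 : 0 < Q) (r01 : 0 < r < 1).
Hypothesis decay : forall psi D n x y, H psi D ->
  `|NL n psi x - NL n psi y| <= Q * D * r ^+ n.

Let r0 : 0 < r. Proof. by case/andP: r01. Qed.

Let geo_small (a e : R) : 0 <= a -> 0 < e -> exists n, a * r ^+ n <= e.
Proof.
move=> a0 e0; case/andP: r01 => _ r1.
have cr : r ^+ n @[n --> \oo] --> (0 : R) by apply: cvg_expr; rewrite ger0_norm// ltW.
have e1 : 0 < e / (a + 1) by rewrite divr_gt0// ltr_wpDl.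
move/cvgrPdist_le : cr => /(_ _ e1)[n _ /(_ n (leqnn n))] /=; rewrite sub0r normrN.
rewrite ger0_norm ?exprn_ge0 ?(ltW r0)// ler_pdivlMr ?ltr_wpDl// => hn.
exists n; apply: le_trans hn; rewrite mulrC ler_wpM2l ?exprn_ge0 ?(ltW r0)//.
by rewrite lerDl.
Qed.

(** Integration against the future Gibbs state, available before that measure exists. By [decay] the
    base point [X1] is immaterial for Hoelder psi. *)
Definition Lam psi : R := lim (NL n psi X1 @[n --> \oo]).

Let NL_tail psi D n m x : H psi D ->
  `|NL n psi x - NL (n + m) psi X1| <= Q * D * r ^+ n.
Proof.
move=> hD; rewrite (NL_add _ _ _ c_gt0 h01).
have hr z : NL n psi x - Q * D * r ^+ n <= NL n psi z <=
    NL n psi x + Q * D * r ^+ n.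
  have := decay n x z hD; rewrite ler_norml => /andP[? ?].
  by apply/andP; split; lra.
have /andP[? ?] := NL_range c_gt0 h01 hL m X1 hr.
by rewrite ler_norml; apply/andP; split; lra.
Qed.

Lemma Lam_cvg psi : is_holder g psi -> NL n psi X1 @[n --> \oo] --> Lam psi.
Proof.
move=> [D hD]; apply/cvg_ex.
suff /cauchy_cvgP : cauchy (NL n psi X1 @[n --> \oo]) by move=> ?; apply/cvg_ex.
apply: cauchy_exP => e e0.
have D0 := holder_ge0 hD.
have e2 : 0 < e / 2 by rewrite divr_gt0.
have [n hn] := geo_small (mulr_ge0 (ltW Q_gt0) D0) e2.
exists (NL n psi X1); exists n => // m /= nm.
rewrite -ball_normE /=; apply: le_lt_trans (_ : _ <= e / 2) _; last by lra.
apply: le_trans hn; rewrite -(subnKC nm); exact: NL_tail.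
Qed.

Lemma Lam_dist psi D n x : H psi D -> `|NL n psi x - Lam psi| <= Q * D * r ^+ n.
Proof.
move=> hD; have c1 : `|NL n psi x - NL m psi X1| @[m --> \oo] --> `|NL n psi x - Lam psi|.
  by apply: cvg_norm; apply: cvgB; [exact: cvg_cst|apply: Lam_cvg; exists D].
apply: (cvgr_to_le c1); exists n => // m /= nm.
by rewrite -(subnKC nm); exact: NL_tail.
Qed.

Lemma LamD psi1 psi2 : is_holder g psi1 -> is_holder g psi2 ->
  Lam (fun x => psi1 x + psi2 x) = Lam psi1 + Lam psi2.
Proof.
move=> h1 h2; apply: (cvg_lim (@Rhausdorff R)).
under eq_fun do rewrite NLD; apply: cvgD; exact: Lam_cvg.
Qed.

Lemma LamZ (a : R) psi : is_holder g psi ->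
  Lam (fun x => a * psi x) = a * Lam psi.
Proof.
move=> h1; apply: (cvg_lim (@Rhausdorff R)).
by under eq_fun do rewrite NLZ; apply: cvgMl_tmp; exact: Lam_cvg.
Qed.

Lemma Lam_cst (a : R) : Lam (fun=> a) = a.
Proof.
apply: (cvg_lim (@Rhausdorff R)).
by under eq_fun do rewrite (NL_cst c_gt0 h01 hL); exact: cvg_cst.
Qed.

Lemma Lam_le psi1 psi2 : is_holder g psi1 -> is_holder g psi2 ->
  (forall x, psi1 x <= psi2 x) -> Lam psi1 <= Lam psi2.
Proof.
move=> h1 h2 le; apply: ler_cvg_to (Lam_cvg h1) (Lam_cvg h2) _.
by apply: nearW => n; exact: (NL_le _ _ _ c_gt0 h01).
Qed.

Lemma Lam_NL n psi : is_holder g psi -> is_holder g (NL n psi) ->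
  Lam (NL n psi) = Lam psi.
Proof.
move=> h1 h2; apply: (cvg_unique (@Rhausdorff R) (Lam_cvg h2)).
have := Lam_cvg h1; rewrite -(cvg_shiftn n).
suff -> : (fun m => NL (m + n) psi X1) = (fun m => NL m (NL n psi) X1) by [].
by apply/funext => m; rewrite addnC (NL_add _ _ _ c_gt0 h01).
Qed.

Lemma holder_sum (I : Type) (s : seq I) (F : I -> X -> R) :
  (forall i, is_holder g (F i)) -> is_holder g (fun x => \sum_(i <- s) F i x).
Proof.
move=> hF; elim: s => [|i s [D hD]].
  by exists 0 => x y; rewrite !big_nil subrr normr0 mul0r.
have [E hE] := hF i; exists (E + D) => x y; rewrite !big_cons.
exact: (holderD hE hD).
Qed.

Lemma Lam_sum (I : Type) (s : seq I) (F : I -> X -> R) :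
  (forall i, is_holder g (F i)) ->
  Lam (fun x => \sum_(i <- s) F i x) = \sum_(i <- s) Lam (F i).
Proof.
move=> hF; elim: s => [|i s IH].
  by rewrite big_nil; under eq_fun do rewrite big_nil; exact: Lam_cst.
rewrite big_cons -IH -LamD//; last exact: holder_sum.
by congr Lam; apply/funext => x; rewrite big_cons.
Qed.

Let h_gt0 x : 0 < h x. Proof. exact: (eig_gt0 c_gt0 h01). Qed.

Lemma th_holder w : is_holder g (th w).
Proof.
have hc x : c <= h x by case/andP: (h01 x).
have h1 x : `|h x| <= 1 by rewrite gtr0_norm//; case/andP: (h01 x).
have hb := holder_bs alpha g_gt0 w uA.
have hbw : H (fun x => h (br w x)) K.
  move=> x y; apply: le_trans (hK _ _) _; rewrite ler_wpM2l ?(holder_ge0 hK)//.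
  exact: br_distg1.
have he : H (fun x => expR (bs u w x - (size w)%:R * p))
    (expR ((size w)%:R * B - (size w)%:R * p) * ((size w)%:R * A)).
  move=> x y.
  have le z : bs u w z - (size w)%:R * p <= (size w)%:R * B - (size w)%:R * p.
    by rewrite lerD2r; apply: bs_le => t; apply: le_trans (ler_norm _) (uB t).
  apply: le_trans (expR_dist (le x) (le y)) _.
  rewrite -[leRHS]mulrA ler_wpM2l ?expR_ge0//.
  have -> : forall q s t : R, q - t - (s - t) = q - s by move=> *; ring.
  exact: hb.
have heb : forall x, `|expR (bs u w x - (size w)%:R * p)| <=
    expR ((size w)%:R * B - (size w)%:R * p).
  move=> x; rewrite ger0_norm ?expR_ge0// ler_expR lerD2r.
  by apply: bs_le => t; apply: le_trans (ler_norm _) (uB t).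
have hm := holderM he hbw heb (fun x => h1 (br w x)).
have hmb x : `|expR (bs u w x - (size w)%:R * p) * h (br w x)| <=
    expR ((size w)%:R * B - (size w)%:R * p) * 1.
  by rewrite normrM ler_pM.
have hv : forall x, `|(h x)^-1| <= c^-1.
  by move=> x; rewrite gtr0_norm ?invr_gt0// lef_pV2 ?posrE.
by eexists; exact: (holderM hm (holderV hK c_gt0 hc) hmb hv).
Qed.

Lemma holder_mul psi1 psi2 : is_holder g psi1 -> is_holder g psi2 ->
  is_holder g (fun x => psi1 x * psi2 x).
Proof.
move=> h1 h2; have [M1 b1] := is_holder_bounded g_gt0 h1.
have [M2 b2] := is_holder_bounded g_gt0 h2.
by case: h1 => D1 h1; case: h2 => D2 h2; eexists; exact: (holderM h1 h2 b1 b2).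
Qed.

Lemma holder_br psi w : is_holder g psi -> is_holder g (fun x => psi (br w x)).
Proof.
move=> [D hD]; exists D => x y; apply: le_trans (hD _ _) _.
by rewrite ler_wpM2l ?(holder_ge0 hD)//; exact: br_distg1.
Qed.

Lemma NL_holder n psi : is_holder g psi -> is_holder g (NL n psi).
Proof.
move=> hp; apply: holder_sum => w; apply: holder_mul; first exact: th_holder.
exact: holder_br.
Qed.

(** The mass of the cylinder of w. Its indicator is not Hoelder, but |w| steps of the normalized
    operator send it to [th w] at positive points, which is Hoelder. *)
Definition M w : R := Lam (th w).

Lemma M_nil : M [::] = 1.
Proof.
rewrite -(Lam_cst 1); congr Lam; apply/funext => x; exact: (th_nil _ _ _ c_gt0 h01).
Qed.

Lemma M_ge (a : R) w : (forall x, a <= th w x) -> a <= M w.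
Proof.
by move=> h1; rewrite -(Lam_cst a) Lam_le//; [exists 0; exact: holder_cst|exact: th_holder].
Qed.

Lemma M_le (a : R) w : (forall x, th w x <= a) -> M w <= a.
Proof.
by move=> h1; rewrite -(Lam_cst a) Lam_le//; [exact: th_holder|exists 0; exact: holder_cst].
Qed.

(** Refining a cylinder by one more digit: this is the invariance of [Lam] under one step of the
    normalized operator, applied to [th w]. *)
Lemma M_rcons w : M w = M (rcons w false) + M (rcons w true).
Proof.
rewrite /M -LamD; try exact: th_holder.
rewrite -(Lam_NL (n := 1) (th_holder w)); last exact/NL_holder/th_holder.
congr Lam; apply/funext => x; rewrite /NL big_words_cons !big_seq1.
by rewrite -!cats1 !(th_cat _ _ _ c_gt0 h01) mulrC [in X in _ + X]mulrC.
Qed.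

(** Prepending a letter is taking a preimage, so this is the invariance of the future measure; it
    holds because the two one-letter weights add up to 1. *)
Lemma M_cons w : M (false :: w) + M (true :: w) = M w.
Proof.
rewrite /M -LamD; try exact: th_holder.
congr Lam; apply/funext => x.
rewrite -[false :: w]/([:: false] ++ w) -[true :: w]/([:: true] ++ w).
rewrite !(th_cat _ _ _ c_gt0 h01) -mulrDl.
have := sum_th c_gt0 h01 hL 1 (br w x); rewrite big_words_cons !big_seq1 => ->.
by rewrite mul1r.
Qed.

Lemma M_ge_cat (a : R) w v : (forall x, a <= th w (br v x)) -> a * M v <= M (w ++ v).
Proof.
move=> h1; rewrite /M -LamZ; last exact: th_holder.
apply: Lam_le; [|exact: th_holder|].
  have [D hD] := th_holder v; exists (`|a| * D); exact: holderZ.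
move=> x; rewrite (th_cat _ _ _ c_gt0 h01) ler_wpM2r//; exact: (th_ge0 _ _ _ c_gt0 h01).
Qed.

Lemma M_gt0 w : 0 < M w.
Proof.
have uB' z : - B <= u z by have := uB z; rewrite ler_norml => /andP[].
apply: lt_le_trans (M_ge (fun x => th_ge _ _ c_gt0 h01 w x uB')).
by rewrite mulr_gt0 ?expR_gt0.
Qed.

(** Each one-letter weight is at least d, hence the other one is at most 1 - d. The decay serves
    twice: it makes the nested intervals of the construction shrink, and it gives positive
    entropy. *)
Lemma M_exp : exists2 s : R, 0 < s < 1 & forall w, M w <= s ^+ size w.
Proof.
have uB' z : - B <= u z by have := uB z; rewrite ler_norml => /andP[].
pose d := c * expR (- (1 * (B + p))).
have hd b x : d <= th [:: b] x by exact: (th_ge _ _ c_gt0 h01 [:: b] x uB').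
have d0 : 0 < d by rewrite mulr_gt0 ?expR_gt0.
have hs b x : th [:: b] x <= 1 - d.
  have := sum_th c_gt0 h01 hL 1 x; rewrite big_words_cons !big_seq1.
  by have := hd (~~ b) x; case: b => /=; lra.
exists (1 - d).
  by apply/andP; split; [have := hs true X1; have := hd true X1; have := hd false X1; have := sum_th c_gt0 h01 hL 1 X1; rewrite big_words_cons !big_seq1; lra|lra].
have s0 : 0 <= 1 - d by apply: le_trans (hs true X1); exact/ltW/(th_gt0 _ _ _ c_gt0 h01).
move=> w; apply: M_le => x; elim: w => [|b w IH].
  by rewrite (th_nil _ _ _ c_gt0 h01)// expr0.
rewrite -[b :: w]/([:: b] ++ w) (th_cat _ _ _ c_gt0 h01) exprS ler_pM//.
  exact: (th_ge0 _ _ _ c_gt0 h01).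
exact: (th_ge0 _ _ _ c_gt0 h01).
Qed.

End functional.

(** * Measures on cylinders *)

Section cylinders.
Context {R : realType} (alpha : {posnum R}).
Local Notation X := (unit_itv R).
Local Notation f := (intermittent_map alpha).
Local Notation br := (br alpha).
Local Notation code := (code alpha).
Implicit Types (x y z : X) (b : bool) (w v : seq bool) (n m : nat).

Lemma pt_open (B : set R) : open B -> open (pt @^-1` B : set X).
Proof. by move=> oB; exists B. Qed.

Lemma openX_preimage (A : set X) : open A -> exists2 B : set R, open B & A = pt @^-1` B.
Proof. by case=> B oB <-; exists B. Qed.

Lemma measurable_pt : measurable_fun [set: X] (@pt R).
Proof.
apply: (measurability _ (RGenOInfty.measurableE R)) => _ [_ [a ->] <-].
rewrite setTI; apply: sub_sigma_algebra; apply: pt_open; exact: interval_open.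
Qed.

Definition level n (U : set (seq bool)) : set X := [set x | U (code n x)].

Lemma take_code n m x : take n (code (n + m) x) = code n x.
Proof. by rewrite code_add take_size_cat ?size_code. Qed.

Lemma levelI n m U V : level n U `&` level m V =
  level (n + m) [set w | U (take n w) /\ V (take m w)].
Proof.
by apply/seteqP; split => x; rewrite /level /= take_code addnC take_code.
Qed.

Lemma levelU n m U V : level n U `|` level m V =
  level (n + m) [set w | U (take n w) \/ V (take m w)].
Proof.
by apply/seteqP; split => x; rewrite /level /= take_code addnC take_code.
Qed.

Lemma levelC n U : ~` level n U = level n (~` U).
Proof. by []. Qed.

Definition cyl w : set X := [set x | code (size w) x = w].

Lemma measurable_singleton0 : measurable [set (X0 : X)].
Proof.
rewrite (_ : [set X0] = setT `&` pt @^-1` `]-oo, 0]).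
  by apply: measurable_pt => //; exact: measurable_itv.
apply/seteqP; split => x /=; first by move=> ->; rewrite in_itv/=.
rewrite in_itv/= => -[_ x0]; apply: pt_inj; apply/eqP.
by rewrite eq_le x0 pt_ge0.
Qed.

Lemma iter_map_gt0 n x : 0 < pt x -> 0 < pt (iter n f x).
Proof. by move=> x0; elim: n => // n IH; rewrite iterS map_gt0. Qed.

Lemma cyl_between w x : 0 < pt x -> cyl w x ->
  pt (br w X0) < pt x <= pt (br w X1).
Proof.
move=> x0 cx; have E : br w (iter (size w) f x) = x by rewrite -{1}cx br_code.
by rewrite -E br_lt br_le pt_le1 andbT iter_map_gt0.
Qed.

Lemma measurable_cyl w : measurable (cyl w).
Proof.
pose I : set X := setT `&` pt @^-1` `]pt (br w X0), pt (br w X1)].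
have mI : measurable I by apply: measurable_pt => //; exact: measurable_itv.
(* The half-open interval misses the point 0, which belongs to the cylinder exactly when w has only
   letters 0. *)
have [/eqP w0|w0] := boolP (w == nseq (size w) false).
  rewrite (_ : cyl w = I `|` [set X0]); last first.
    apply/seteqP; split => x /=.
      move=> cx; have [x0|] := ltP 0 (pt x).
        by left; split => //=; rewrite in_itv/=; exact: cyl_between.
      move=> x0; right; apply: pt_inj; apply/eqP.
      by rewrite eq_le x0 pt_ge0.
    case=> [[_ /=]|->]; last by rewrite /cyl /= code0.
    by rewrite in_itv/= => /andP[]; exact: code_between.
  by apply: measurableU => //; exact: measurable_singleton0.
rewrite (_ : cyl w = I)//; apply/seteqP; split => x /=; last first.
  by case=> _ /=; rewrite in_itv/= => /andP[]; exact: code_between.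
move=> cx; split => //=; rewrite in_itv/=.
have x0 : 0 < pt x.
  rewrite lt_def pt_ge0 andbT; apply: contra w0 => /eqP x0.
  have E : x = X0 by exact: pt_inj.
  by apply/eqP; rewrite -[LHS]cx E code0.
exact: cyl_between.
Qed.

Lemma level_cyl n U : level n U = \bigcup_(w in [set` words n] `&` U) cyl w.
Proof.
apply/seteqP; split => x; rewrite /level /=.
  move=> Ux; exists (code n x); rewrite /= ?mem_words ?size_code//.
  by rewrite /cyl /= size_code.
by case=> w /= []; rewrite mem_words => /eqP <- Uw; rewrite /cyl /= => ->.
Qed.

Lemma measurable_level n U : measurable (level n U).
Proof.
rewrite level_cyl; apply: fin_bigcup_measurable => [|w _]; last exact: measurable_cyl.
exact: finite_setIl.
Qed.

Definition levels : set (set X) := [set A | exists n U, A = level n U].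

Lemma levels_cyl w : levels (cyl w).
Proof. by exists (size w), [set w]. Qed.

Lemma levels_setI : setI_closed levels.
Proof.
by move=> _ _ [n [U ->]] [m [V ->]]; rewrite levelI; eexists; eexists.
Qed.

Lemma levelsT : levels setT.
Proof. by exists 0%N, setT. Qed.

(** Cylinders shrink, so every point of O has one inside O. The union runs over all words, with the
    empty set as filler, to keep a fixed countable index type. *)
Lemma open_cyl (O : set X) : open O ->
  O = \bigcup_(w in [set: seq bool]) (if `[< cyl w `<=` O >] then cyl w else set0).
Proof.
move=> oO; apply/seteqP; split => x; last first.
  by case=> w _; case: ifPn => // /asboolP; exact.
have [B oB ->] := openX_preimage oO; move=> Bx.
have : nbhs (pt x) B by exact: open_nbhs_nbhs.
move=> /nbhs_ballP[e e0 he].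
have e2 : 0 < e / 2 by rewrite divr_gt0.
have [m hm] := cylinder_shrink alpha e2.
exists (code m x) => //; case: ifPn => [_|/asboolP []].
  by rewrite /cyl /= size_code.
move=> y; rewrite /cyl /= size_code => cy; apply: he.
rewrite -ball_normE /=; apply: le_lt_trans (_ : _ <= e / 2) _; last by lra.
have := hm (code m x) (iter m f x) (iter m f y); rewrite size_code => /(_ (leqnn _)).
by rewrite br_code -cy br_code.
Qed.

Lemma measurable_levels : @measurable _ X = <<s levels >>.
Proof.
apply/seteqP; split.
  apply: smallest_sub; first exact: smallest_sigma_algebra.
  move=> O /open_cyl ->.
  have cb : countable [set: seq bool] by exact: countableP.
  have [F [hF1 hF2]] : exists F : nat -> set X, (forall i, <<s levels >> (F i)) /\
      \bigcup_w (if `[< cyl w `<=` O >] then cyl w else set0) = \bigcup_i F i.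
    pose G w := if `[< cyl w `<=` O >] then cyl w else set0.
    exists (fun i => oapp G set0 (unpickle i : option (seq bool))); split.
      move=> i; case: unpickle => [w|] /=; last exact: sigma_algebra0.
      rewrite /G; case: ifP => _; last exact: sigma_algebra0.
      by apply: sub_sigma_algebra; exact: levels_cyl.
    apply/seteqP; split => x [w _].
      by exists (pickle w) => //; rewrite pickleK.
    by case: (unpickle w) => //= v Gv; exists v.
  by rewrite hF2; exact: sigma_algebra_bigcup.
apply: smallest_sub; first exact: sigma_algebra_measurable.
by move=> _ [n [U ->]]; exact: measurable_level.
Qed.

Lemma measurable_map : measurable_fun setT f.
Proof.
apply: (measurability _ measurable_levels) => _ [_ [n [U ->]] <-].
rewrite setTI (_ : f @^-1` _ = level n.+1 [set w | U (behead w)])//.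
exact: measurable_level.
Qed.

Lemma measurable_iter n : measurable_fun setT (iter n f).
Proof.
elim: n => [|n IH]; first exact: measurable_id.
exact: (measurableT_comp measurable_map IH).
Qed.

Lemma measure_eq_cyl (m1 m2 : {measure set X -> \bar R}) :
  (m1 setT < +oo)%E ->
  (forall w, m1 (cyl w) = m2 (cyl w)) ->
  forall A, measurable A -> m1 A = m2 A.
Proof.
move=> fin1 h; apply: (measure_unique levels (fun=> setT)).
- exact: measurable_levels.
- exact: levels_setI.
- by move=> _; exact: levelsT.
- by rewrite bigcup_const//; exists 0%N.
- move=> _ [n [U ->]]; rewrite level_cyl.
  have ft : finite_set ([set` words n] `&` U) by exact: finite_setIl.
  have tr : trivIset ([set` words n] `&` U) cyl.
    move=> v w [/= v1 _] [/= w1 _] [x []]; rewrite /cyl /=.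
    by move: v1 w1; rewrite !mem_words => /eqP -> /eqP -> -> .
  have mc w : ([set` words n] `&` U) w -> measurable (cyl w).
    by move=> _; exact: measurable_cyl.
  rewrite (measure_fin_bigcup m1 ft tr mc) (measure_fin_bigcup m2 ft tr mc).
  by apply: eq_fsbigr => w _; exact: h.
- by [].
Qed.

Definition approx (mu : set X -> \bar R) (A : set X) := forall e : R, 0 < e ->
  exists n U, (mu ((A `\` level n U) `|` (level n U `\` A)) <= e%:E)%E.

(** The approximable sets form a sigma-algebra containing the levels. For a countable union,
    continuity of the measure along the decreasing remainders first reduces to a finite union. *)
Lemma measurable_approx (mu : probability X R) (A : set X) :
  measurable A -> approx mu A.
Proof.
suff : (@measurable _ X) `<=` [set A | measurable A /\ approx mu A].
  by move=> h /h[].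
move=> {A}; rewrite {1}measurable_levels; apply: smallest_sub; last first.
  move=> _ [n [U ->]]; split; first exact: measurable_level.
  by move=> e e0; exists n, U; rewrite setDv setU0 measure0 lee_fin ltW.
have D A n U : measurable A ->
    measurable ((A `\` level n U) `|` (level n U `\` A)).
  by move=> mA; apply: measurableU; apply: measurableD => //; exact: measurable_level.
have aU A B : measurable A -> measurable B -> approx mu A -> approx mu B ->
    approx mu (A `|` B).
  move=> mA mB aA aB e e0; have e2 : 0 < e / 2 by rewrite divr_gt0.
  have [n [U hU]] := aA _ e2; have [m [V hV]] := aB _ e2.
  exists (n + m)%N, [set w | U (take n w) \/ V (take m w)]; rewrite -levelU.
  rewrite [X in (_ <= X)%E](_ : _ = (e / 2)%:E + (e / 2)%:E)%E; last first.
    by rewrite -EFinD -splitr.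
  apply: le_trans (leeD hU hV); apply: le_trans (measureU2 _ _ _); try exact: D.
  apply: le_measure; rewrite ?inE.
  - apply: measurableU; apply: measurableD; by do ?[exact: measurable_level|apply: measurableU => //].
  - by apply: measurableU; exact: D.
  - move=> x /= [[[Ax|Bx] /not_orP[nU nV]]|[[Ux|Vx] /not_orP[nA nB]]].
    + by left; left.
    + by right; left.
    + by left; right.
    + by right; right.
split.
- split; first exact: measurable0.
  move=> e e0; exists 0%N, set0; rewrite (_ : level 0 set0 = set0)//.
  by rewrite setDv setU0 measure0 lee_fin ltW.
- move=> A [mA aA]; split; first by apply: measurableD.
  move=> e /aA[n [U hU]]; exists n, (~` U); rewrite -levelC.
  apply: le_trans hU; rewrite le_eqVlt; apply/orP; left; apply/eqP; congr (mu _).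
  by rewrite setTD setUC; apply/seteqP; split => x /= [[? ?]|[? ?]]; (try by left; split=> //; apply: contrapT); (try by right; split=> //; apply: contrapT); tauto.
- move=> F hF; split; first by apply: bigcup_measurable => i _; have [] := hF i.
  move=> e e0; have e2 : 0 < e / 2 by rewrite divr_gt0.
  pose G n := \bigcup_(i < n) F i.
  have mG n : measurable (G n) by apply: bigcup_measurable => i _; have [] := hF i.
  have aG n : approx mu (G n).
    elim: n => [|n IH].
      move=> d d0; exists 0%N, set0; rewrite /G bigcup_mkord big_ord0.
      by rewrite (_ : level 0 set0 = set0)// setDv setU0 measure0 lee_fin ltW.
    have -> : G n.+1 = G n `|` F n by rewrite /G !bigcup_mkord big_ord_recr.
    by apply: aU => //; have [] := hF n.
  pose A := \bigcup_i F i.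
  have mA : measurable A by apply: bigcup_measurable => i _; have [] := hF i.
  pose T n := A `\` G n.
  have mT n : measurable (T n) by exact: measurableD.
  have cT : mu \o T @ \oo --> mu (\bigcap_n T n).
    apply: nonincreasing_cvg_mu => //.
    - by apply: le_lt_trans (probability_le1 mu (mT 0%N)) _; exact: ltry.
    - exact: bigcap_measurable.
    - move=> m n mn; apply/subsetPset => x [Ax nG]; split => // -[i /= im Fi].
      by apply: nG; exists i => //=; exact: leq_trans mn.
  have T0 : \bigcap_n T n = set0.
    apply/seteqP; split => // x h; have [[i _ Fi] _] := h 0%N I.
    by have [_] := h i.+1 I; apply; exists i => /=.
  rewrite T0 measure0 in cT.
  have [n hn] : exists n, (mu (T n) <= (e / 2)%:E)%E.
    move/fine_cvgP : cT => [_ /cvgrPdist_le/(_ _ e2)[n _ /(_ n (leqnn n))]] /=.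
    rewrite sub0r normrN ger0_norm ?fine_ge0// => hn; exists n.
    by rewrite -[leLHS]fineK ?lee_fin//; exact: fin_num_measure.
  have [m [U hU]] := aG n _ e2; exists m, U.
  rewrite [X in (_ <= X)%E](_ : _ = (e / 2)%:E + (e / 2)%:E)%E; last first.
    by rewrite -EFinD -splitr.
  apply: le_trans (leeD hn hU); apply: le_trans (measureU2 _ _ _) => //; last exact: D.
  apply: le_measure; rewrite ?inE; first exact: D.
    by apply: measurableU => //; exact: D.
  move=> x /= [[Ax nU]|[Ux nA]].
    by have [Gx|nGx] := pselect (G n x); [right; left|left].
  by right; right; split => // -[i _ Fi]; apply: nA; exists i.
Qed.

End cylinders.

(** * A measure with prescribed cylinder masses *)

Section construction.
Context {R : realType} (alpha : {posnum R}).
Local Notation X := (unit_itv R).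
Local Notation f := (intermittent_map alpha).
Local Notation br := (br alpha).
Local Notation code := (code alpha).
Local Notation cyl := (cyl alpha).
Implicit Types (x y z : X) (b : bool) (w v : seq bool) (n m : nat) (t : R).

Definition mfun_of d d' (T : measurableType d) (T' : measurableType d')
  (F : T -> T') (mF : measurable_fun setT F) : {mfun T >-> T'} :=
  HB.pack F (isMeasurableFun.Build _ _ _ _ F mF).

Variables (M : seq bool -> R) (s : R).
Hypotheses (M_nil : M [::] = 1) (M_gt0 : forall w, 0 < M w).
Hypothesis M_rcons : forall w, M w = M (rcons w false) + M (rcons w true).
Hypothesis M_cons : forall w, M (false :: w) + M (true :: w) = M w.
Hypotheses (s01 : 0 < s < 1) (M_exp : forall w, M w <= s ^+ size w).

Fixpoint lpos_from (v w : seq bool) : R :=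
  if w is b :: w' then
    (if b then M (rcons v false) else 0) + lpos_from (rcons v b) w'
  else 0.

(* ]lpos w, lpos w + M w] is the interval of ]0,1] coded by w. *)
Definition lpos w := lpos_from [::] w.

Lemma lpos_rcons w b :
  lpos (rcons w b) = lpos w + (if b then M (rcons w false) else 0).
Proof.
rewrite /lpos -[in M _](cat0s w); elim: w [::] => [|a w IH] v /=.
  by rewrite cats0 addr0 add0r.
by rewrite IH cat_rcons addrA.
Qed.

(** A search for t among nested intervals of lengths [M w]: the quantile coding associated with the
    masses. *)
Fixpoint digits n t : seq bool :=
  if n is n'.+1 then
    let w := digits n' t in rcons w (lpos w + M (rcons w false) < t)
  else [::].

Lemma size_digits n t : size (digits n t) = n.
Proof. by elim: n => //= n IH; rewrite size_rcons IH. Qed.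

Lemma digitsP n t w : 0 < t <= 1 -> size w = n ->
  (digits n t = w) <-> (lpos w < t <= lpos w + M w).
Proof.
move=> t01; elim: n w => [|n IH] w.
  by move/size0nil ->; rewrite M_nil /lpos /= add0r.
elim/last_ind: w => // w b _; rewrite size_rcons => -[sw].
have -> : digits n.+1 t = rcons w b <->
    (lpos w < t <= lpos w + M w) /\ (lpos w + M (rcons w false) < t) = b.
  rewrite -IH//=; split => [/eqP|[-> ->]//].
  by rewrite eqseq_rcons => /andP[/eqP -> /eqP].
rewrite lpos_rcons M_rcons; have m0 := M_gt0 (rcons w false); have m1 := M_gt0 (rcons w true).
case: b; split.
- by case=> /andP[h1 h2] h3; apply/andP; split=> //; lra.
- by move=> /andP[h1 h2]; split; [apply/andP; split; lra|].
- by case=> /andP[h1 h2] /negbT; rewrite -leNgt addr0 => h3; apply/andP.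
- rewrite addr0 => /andP[h1 h2]; split; last by apply/negbTE; rewrite -leNgt.
  by apply/andP; split; lra.
Qed.

Lemma digits_in n t : 0 < t <= 1 ->
  lpos (digits n t) < t <= lpos (digits n t) + M (digits n t).
Proof. by move=> t01; apply/(digitsP t01 (size_digits n t)). Qed.

Lemma digits_add n m t : exists v, digits (n + m) t = digits n t ++ v.
Proof.
elim: m => [|m [v E]]; first by exists [::]; rewrite addn0 cats0.
by rewrite addnS /= E rcons_cat; eexists.
Qed.

Let s_small (a : R) : 0 < a -> exists n, s ^+ n < a.
Proof.
case/andP: s01 => s0 s1 a0.
have cr : s ^+ n @[n --> \oo] --> (0 : R) by apply: cvg_expr; rewrite ger0_norm// ltW.
have a2 : 0 < a / 2 by rewrite divr_gt0.
move/cvgrPdist_le : cr => /(_ _ a2)[n _ /(_ n (leqnn n))] /=; rewrite sub0r normrN.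
rewrite ger0_norm ?exprn_ge0 ?(ltW s0)// => hn; exists n; lra.
Qed.

(** If only 0s followed, the left ends would stay fixed strictly below t while the lengths tend to
    0. The letter 1 is what yields the strict inequality required by [code_between]. *)
Lemma digits_one n t : 0 < t <= 1 -> exists m, exists v, exists v',
  digits m t = digits n t ++ v ++ true :: v'.
Proof.
move=> t01; apply: contrapT => H.
have z m : digits (n + m) t = digits n t ++ nseq m false.
  elim: m => [|m IH]; first by rewrite addn0 cats0.
  rewrite addnS /= {1}IH; case E : (_ < t); last first.
    by rewrite rcons_cat -[false :: _]/(nseq m.+1 false) -(addn1 m) nseqD cats1.
  exfalso; apply: H; exists (n + m).+1, (nseq m false), [::].
  by rewrite /= {1}IH E rcons_cat -cats1.
have L m : lpos (digits (n + m) t) = lpos (digits n t).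
  elim: m => [|m IH]; first by rewrite addn0.
  by rewrite z -(addn1 m) nseqD catA cats1 lpos_rcons addr0 -z.
have /andP[h1 _] := digits_in n t01.
have h0 : 0 < t - lpos (digits n t) by rewrite subr_gt0.
have [m hm] := s_small h0.
have /andP[_] := digits_in (n + m) t01; rewrite L => h2.
have := M_exp (digits (n + m) t); rewrite size_digits.
have : s ^+ (n + m) <= s ^+ m.
  case/andP: s01 => s0 s1; rewrite exprD ler_piMl ?exprn_ge0 ?(ltW s0)//.
  by rewrite exprn_ile1// ltW.
by lra.
Qed.

Lemma point_ex t : exists x, 0 < t <= 1 -> forall n, code n x = digits n t.
Proof.
have [t01|nt] := boolP (0 < t <= 1); last by exists X0.
pose A := [set pt (br (digits n t) X1) | n in [set: nat]].
have low m a : A a -> pt (br (digits m t) X0) <= a.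
  case=> k _ <-; have [km|/ltnW mk] := leqP k m.
    have [v] := digits_add k (m - k) t; rewrite subnKC// => ->.
    by rewrite br_cat br_le pt_le1.
  have [v] := digits_add m (k - m) t; rewrite subnKC// => ->.
  by rewrite br_cat br_le pt_ge0.
have Ai : has_inf A.
  by split; [eexists; exists 0%N|exists 0 => a /(low 0%N); apply: le_trans; exact: pt_ge0].
have le n : inf A <= pt (br (digits n t) X1) by apply: ge_inf; [case: Ai|exists n].
have ge n : pt (br (digits n t) X0) <= inf A.
  by apply: lb_le_inf; [case: Ai|move=> a; exact: low].
have i01 : 0 <= inf A <= 1.
  by rewrite (le_trans (pt_ge0 _) (ge 0%N)) (le_trans (le 0%N) (pt_le1 _)).
exists (mkX i01) => _ n; rewrite -[n in code n](size_digits n t).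
apply: code_between; last exact: le.
(* A later letter 1 pushes the left end of a deeper interval strictly above that of the n-th one,
   and hence [inf A] too. *)
have [m [v [v' E]]] := digits_one n t01.
apply: lt_le_trans (ge m); rewrite E !br_cat br_lt.
apply: le_lt_trans (pt_ge0 (br v X0)) _; rewrite br_lt br_cons.
by apply: lt_le_trans (tpt_gt0 alpha 1) _; exact: branch_true_ge.
Qed.

Let pnt t : X := projT1 (cid (point_ex t)).

(** The value at points outside ]0,1] is a default; they form a null set for the uniform law, but
    they account for the extra term in [T_cyl]. *)
Let T t : X := if 0 < t <= 1 then pnt t else X0.

Let codeT t n : 0 < t <= 1 -> code n (T t) = digits n t.
Proof. by move=> t01; rewrite /T t01 /pnt; case: cid => x /= /(_ t01). Qed.

Let lpos_ge0 w : 0 <= lpos w.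
Proof.
elim/last_ind: w => [|w b IH]; first by rewrite /lpos.
by rewrite lpos_rcons addr_ge0//; case: b => //; exact/ltW.
Qed.

Let lpos_le1 w : lpos w + M w <= 1.
Proof.
elim/last_ind: w => [|w b IH]; first by rewrite /lpos /= M_nil add0r.
rewrite lpos_rcons; have := M_rcons w; have := M_gt0 (rcons w true); have := M_gt0 (rcons w false).
by case: b; lra.
Qed.

Let T_cyl w : T @^-1` cyl w = `]lpos w, lpos w + M w] `|`
  (if `[< cyl w X0 >] then ~` `]0, 1] else set0).
Proof.
apply/seteqP; split => t /=.
  have [t01|nt] := boolP (0 < t <= 1).
    rewrite /Submission.cyl /= codeT// => ct; left; rewrite in_itv/=.
    exact/(digitsP t01).
  rewrite /T (negbTE nt) => cw; right; case: asboolP => // _ /=.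
  by rewrite in_itv/=; exact/negP.
case=> [|]; last first.
  by case: asboolP => //= cw; rewrite in_itv/= => /negP/negbTE nt; rewrite /T nt.
rewrite in_itv/= => /andP[h1 h2]; have t01 : 0 < t <= 1.
  by rewrite (le_lt_trans _ h1)//= (le_trans h2).
by rewrite /Submission.cyl /= codeT//; apply/(digitsP t01) => //; rewrite h1.
Qed.

Let mT : measurable_fun [set: measurableTypeR R] T.
Proof.
apply: (measurability _ (measurable_levels alpha)) => _ [_ [n [U ->]] <-].
rewrite setTI level_cyl preimage_bigcup; apply: fin_bigcup_measurable.
  exact: finite_setIl.
move=> w _; rewrite T_cyl; apply: measurableU; first exact: measurable_itv.
by case: ifP => _; [apply: measurableC; exact: measurable_itv|exact: measurable0].
Qed.

Let unif_itv (a b : R) : 0 <= a -> a <= b -> b <= 1 ->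
  uniform_prob (@ltr01 R) `]a, b] = (b - a)%:E.
Proof.
move=> a0 ab b1; rewrite /uniform_prob integral_uniform_pdf setIidl; last first.
  move=> t; rewrite /= !in_itv/= => /andP[h1 h2].
  by rewrite (le_trans a0 (ltW h1)) (le_trans h2).
rewrite (eq_integral (fun=> 1%:E)); last first.
  move=> t; rewrite inE/= in_itv/= => /andP[h1 h2].
  by rewrite /uniform_pdf (le_trans a0 (ltW h1)) (le_trans h2)//= subr0 invr1.
rewrite integral_cst//= mul1e lebesgue_measure_itv/= lte_fin.
case: ltP => [_|ba]; first by rewrite EFinB.
have -> : b = a by apply/eqP; rewrite eq_le ab ba.
by rewrite subrr.
Qed.

(** The image of the uniform law under T has the prescribed masses. Measures are determined by
    cylinders, and there invariance is [M_cons]. *)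
Theorem gibbs_measure_ex : exists nu : probability X R,
  invariant_measure f nu /\ forall w, nu (cyl w) = (M w)%:E.
Proof.
pose nu := distribution (uniform_prob (@ltr01 R)) (mfun_of mT).
have nuE w : nu (cyl w) = (M w)%:E.
  rewrite /nu /distribution /pushforward /= T_cyl.
  have l0 := lpos_ge0 w; have l1 := lpos_le1 w; have Mw := M_gt0 w.
  have mI : measurable (`]lpos w, lpos w + M w] : set (measurableTypeR R)) by exact: measurable_itv.
  have mJ : measurable (`]0, 1] : set (measurableTypeR R)) by exact: measurable_itv.
  pose P : probability (measurableTypeR R) R := uniform_prob (@ltr01 R).
  pose I : set R := [set` `]lpos w, lpos w + M w]]; pose J : set R := [set` `]0, 1]].
  change (P (setU I (if asbool (cyl w X0) then setC J else set0)) = (M w)%:E).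
  have PE (a b : R) : 0 <= a -> a <= b -> b <= 1 -> P `]a, b]%classic = (b - a)%:E := @unif_itv a b.
  have PJ : P (setC J) = 0%E.
    rewrite probability_setC// [X in (1 - X)%E](_ : _ = 1%E) ?subee//.
    by rewrite /J PE// subr0.
  have PI : P I = (M w)%:E.
    by rewrite /I PE ?lerDl ?(ltW Mw)//; congr (_%:E); ring.
  case: asboolP => _; last by rewrite setU0.
  apply/eqP; rewrite eq_le; apply/andP; split.
    apply: (@le_trans _ _ (P I + P (setC J))%E).
      exact: (measureU2 P mI (measurableC mJ)).
    by rewrite PJ PI adde0.
  rewrite -PI; apply: le_measure; rewrite ?inE.
  - exact: mI.
  - by apply: measurableU => //; exact: measurableC.
  - exact: subsetUl.
exists nu; split=> // A mA.
pose nf := distribution nu (mfun_of (measurable_map alpha)).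
change (nf A = nu A); apply: (measure_eq_cyl (alpha := alpha)) => //.
  by apply: le_lt_trans (probability_le1 nf measurableT) _; rewrite ltry.
move=> w; transitivity ((M w)%:E); last by rewrite -nuE.
rewrite -M_cons EFinD -!nuE; change (nu (f @^-1` cyl w) = nu (cyl (false :: w)) + nu (cyl (true :: w)))%E.
pose nu' : probability X R := nu; rewrite -[nu]/(nu' : set X -> \bar R).
rewrite -measureU; try exact: measurable_cyl.
  congr (nu' _); apply/seteqP; split => x; rewrite /Submission.cyl /=.
    by move=> ->; case: (digit alpha x); [right|left].
  by case=> -[].
by apply/seteqP; split => // x []; rewrite /Submission.cyl /= => -[-> _] [].
Qed.

End construction.

(** * Expectations of bounded measurable functions *)

Section expectation.
Context {R : realType}.
Local Notation X := (unit_itv R).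
Implicit Types (psi : X -> R) (A : set X).

Definition bm psi := measurable_fun [set: X] psi /\
  exists M : R, forall x, `|psi x| <= M.

Lemma bm_cst (a : R) : bm (fun=> a).
Proof. by split; [exact: measurable_cst|exists `|a|]. Qed.

Lemma bmD psi1 psi2 : bm psi1 -> bm psi2 -> bm (fun x => psi1 x + psi2 x).
Proof.
move=> [m1 [M1 b1]] [m2 [M2 b2]]; split; first exact: measurable_funD.
by exists (M1 + M2) => x; apply: le_trans (ler_normD _ _) _; exact: lerD.
Qed.

Lemma bmM psi1 psi2 : bm psi1 -> bm psi2 -> bm (fun x => psi1 x * psi2 x).
Proof.
move=> [m1 [M1 b1]] [m2 [M2 b2]]; split; first exact: measurable_funM.
by exists (M1 * M2) => x; rewrite normrM ler_pM.
Qed.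

Lemma bmZ (a : R) psi : bm psi -> bm (fun x => a * psi x).
Proof. by move=> h; apply: bmM => //; exact: bm_cst. Qed.

Lemma bmN psi : bm psi -> bm (fun x => - psi x).
Proof.
move=> [m1 [M1 b1]]; split; first exact: measurableT_comp.
by exists M1 => x; rewrite normrN.
Qed.

Lemma bmB psi1 psi2 : bm psi1 -> bm psi2 -> bm (fun x => psi1 x - psi2 x).
Proof. by move=> h1 h2; apply: bmD => //; exact: bmN. Qed.

Lemma bm_sum (I : Type) (s : seq I) (F : I -> X -> R) :
  (forall i, bm (F i)) -> bm (fun x => \sum_(i <- s) F i x).
Proof.
move=> h; elim: s => [|i s IH].
  by under eq_fun do rewrite big_nil; exact: bm_cst.
by under eq_fun do rewrite big_cons; exact: bmD.
Qed.

Lemma bm_indic A : measurable A -> bm (\1_A : X -> R).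
Proof.
move=> mA; split; first exact: measurable_indic.
by exists 1 => x; rewrite indicE; case: (_ \in _); rewrite /= ?normr1 ?normr0.
Qed.

Variable mu : probability X R.

Definition Ex psi : R := \int[mu]_x psi x.

Lemma bm_integrable psi : bm psi -> mu.-integrable setT (EFin \o psi).
Proof.
move=> [mp [M hM]]; apply: measurable_bounded_integrable => //.
  by apply: le_lt_trans (probability_le1 mu measurableT) _; rewrite ltry.
by exists M; split; [exact: num_real|move=> N MN x _ /=; exact: le_trans (hM x) (ltW MN)].
Qed.

Lemma EFin_Ex psi : bm psi -> (\int[mu]_x (psi x)%:E)%E = (Ex psi)%:E.
Proof.
move=> h; rewrite /Ex /Rintegral fineK//; apply: integrable_fin_num => //.
exact: bm_integrable.
Qed.

Lemma Ex_cst (a : R) : Ex (fun=> a) = a.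
Proof.
rewrite /Ex Rintegral_cst// -[RHS]mulr1; congr (_ * _).
exact: (congr1 fine (probability_setT mu)).
Qed.

Lemma ExD psi1 psi2 : bm psi1 -> bm psi2 ->
  Ex (fun x => psi1 x + psi2 x) = Ex psi1 + Ex psi2.
Proof. by move=> h1 h2; rewrite /Ex RintegralD//; exact: bm_integrable. Qed.

Lemma ExZ (a : R) psi : bm psi -> Ex (fun x => a * psi x) = a * Ex psi.
Proof. by move=> h1; rewrite /Ex RintegralZl//; exact: bm_integrable. Qed.

Lemma ExB psi1 psi2 : bm psi1 -> bm psi2 ->
  Ex (fun x => psi1 x - psi2 x) = Ex psi1 - Ex psi2.
Proof. by move=> h1 h2; rewrite /Ex RintegralB//; exact: bm_integrable. Qed.

Lemma Ex_le psi1 psi2 : bm psi1 -> bm psi2 -> (forall x, psi1 x <= psi2 x) ->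
  Ex psi1 <= Ex psi2.
Proof. by move=> h1 h2 le; rewrite /Ex le_Rintegral//; exact: bm_integrable. Qed.

Lemma Ex_norm_le psi (e : R) : bm psi -> (forall x, `|psi x| <= e) -> `|Ex psi| <= e.
Proof.
move=> h le; rewrite ler_norml; apply/andP; split.
  rewrite -[leLHS]Ex_cst; apply: Ex_le => //; first exact: bm_cst.
  by move=> x; have := le x; rewrite ler_norml => /andP[].
rewrite -[leRHS]Ex_cst; apply: Ex_le => //; first exact: bm_cst.
by move=> x; have := le x; rewrite ler_norml => /andP[].
Qed.

Lemma Ex_sum (I : Type) (s : seq I) (F : I -> X -> R) : (forall i, bm (F i)) ->
  Ex (fun x => \sum_(i <- s) F i x) = \sum_(i <- s) Ex (F i).
Proof.
move=> h; elim: s => [|i s IH].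
  by rewrite big_nil; under [in LHS]eq_fun do rewrite big_nil; exact: Ex_cst.
rewrite big_cons -IH -ExD//; last exact: bm_sum.
by congr Ex; apply/funext => x; rewrite big_cons.
Qed.

Lemma Ex_indic A : measurable A -> Ex (\1_A : X -> R) = fine (mu A).
Proof. by move=> mA; rewrite /Ex /Rintegral integral_indic// setIT. Qed.

(* Finite-valued measurable maps, stated so that no measurable structure on the
   target is needed. *)
Definition mdisc (T : Type) (Y : X -> T) := forall S : set T, measurable (Y @^-1` S).

Lemma bm_mdisc (T : eqType) (s : seq T) (Y : X -> T) (G : T -> R) :
  mdisc Y -> (forall x, Y x \in s) -> bm (fun x => G (Y x)).
Proof.
move=> mY Ys; split.
  move=> _ B mB; rewrite setTI; exact: (mY [set t | B (G t)]).
exists (\sum_(t <- s) `|G t|) => x; rewrite (big_rem (Y x))//=.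
by rewrite lerDl sumr_ge0.
Qed.

Lemma Ex_mdisc (T : eqType) (s : seq T) (Y : X -> T) (G : T -> R) :
  uniq s -> mdisc Y -> (forall x, Y x \in s) ->
  Ex (fun x => G (Y x)) = \sum_(t <- s) G t * fine (mu (Y @^-1` [set t])).
Proof.
move=> us mY Ys.
rewrite (_ : (fun x => G (Y x)) = (fun x => \sum_(t <- s) G t * \1_(Y @^-1` [set t]) x)).
  rewrite Ex_sum; last by move=> t; apply: bmZ; apply: bm_indic; exact: mY.
  apply: eq_bigr => t _; rewrite ExZ; last by apply: bm_indic; exact: mY.
  by rewrite Ex_indic//; exact: mY.
apply/funext => x; rewrite (bigD1_seq (Y x))//= indicE mem_set//= mulr1.
rewrite big1 ?addr0// => t tY; rewrite indicE memNset ?mulr0//= => E.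
by rewrite E eqxx in tY.
Qed.

Lemma mdisc_pair (T1 : finType) (T2 : Type) (Y1 : X -> T1) (Y2 : X -> T2) :
  mdisc Y1 -> mdisc Y2 -> mdisc (fun x => (Y1 x, Y2 x)).
Proof.
move=> m1 m2 S; rewrite (_ : _ @^-1` S =
  \bigcup_(t in [set: T1]) (Y1 @^-1` [set t] `&` Y2 @^-1` [set r | S (t, r)])).
  apply: fin_bigcup_measurable => [|t _]; first exact: finite_finset.
  by apply: measurableI; [exact: m1|exact: m2].
apply/seteqP; split => x /=; first by move=> h; exists (Y1 x).
by case=> t _ [/= ->].
Qed.

Lemma mdisc_fin (T : finType) (Y : X -> T) :
  (forall t, measurable (Y @^-1` [set t])) -> mdisc Y.
Proof.
move=> h S; rewrite (_ : _ @^-1` S = \bigcup_(t in S) (Y @^-1` [set t])).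
  by apply: fin_bigcup_measurable => // ; exact: finite_finset.
apply/seteqP; split => x /=; first by move=> Sx; exists (Y x).
by case=> t St ->.
Qed.

Lemma mdisc_ffun (T : finType) n (Y : 'I_n -> X -> T) :
  (forall i, mdisc (Y i)) -> mdisc (fun x => [ffun i => Y i x]).
Proof.
move=> h; apply: mdisc_fin => t.
rewrite (_ : _ @^-1` _ = \bigcap_(i in [set: 'I_n]) (Y i @^-1` [set t i])).
  by apply: fin_bigcap_measurable => [|i _]; [exact: finite_finset|exact: h].
apply/seteqP; split => x /=.
  by move=> <- i _; rewrite /= ffunE.
by move=> E; apply/ffunP => i; rewrite ffunE; exact: E.
Qed.

Variable alpha : {posnum R}.
Local Notation f := (intermittent_map alpha).
Local Notation br := (br alpha).
Local Notation code := (code alpha).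
Local Notation cyl := (cyl alpha).

Lemma mdisc_code n : mdisc (code n).
Proof. by move=> S; exact: measurable_level. Qed.

Lemma bm_code n (G : seq bool -> R) : bm (fun x => G (code n x)).
Proof.
apply: (bm_mdisc (s := words n)) => [|x]; first exact: mdisc_code.
by rewrite mem_words size_code.
Qed.

Lemma Ex_code n (G : seq bool -> R) :
  Ex (fun x => G (code n x)) = \sum_(w <- words n) G w * fine (mu (cyl w)).
Proof.
rewrite (Ex_mdisc (s := words n)); first last.
- by move=> x; rewrite mem_words size_code.
- exact: mdisc_code.
- exact: uniq_words.
rewrite big_seq [RHS]big_seq; apply: eq_bigr => w; rewrite mem_words => /eqP sw.
by rewrite /Submission.cyl sw.
Qed.

Lemma mdisc_iter (T : Type) (Y : X -> T) n : mdisc Y -> mdisc (fun x => Y (iter n f x)).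
Proof.
move=> h S; have := measurable_iter alpha n measurableT (h S).
by rewrite setTI.
Qed.

Lemma bm_iter n psi : bm psi -> bm (fun x => psi (iter n f x)).
Proof.
move=> [mp [M hM]]; split; last by exists M => x.
exact: (measurableT_comp mp (measurable_iter alpha n)).
Qed.

(** A uniformly continuous function is the pointwise limit of functions of finitely many digits,
    which are measurable. *)
Lemma ucont_bm psi : ucont psi -> bm psi.
Proof.
move=> uc; split; last first.
  have [d d0 hd] := uc 1 ltr01; have [m hm] := cylinder_shrink alpha d0.
  exists (1 + \sum_(w <- words m) `|psi (br w X1)|) => x.
  have -> : psi x = (psi x - psi (br (code m x) X1)) + psi (br (code m x) X1) by rewrite subrK.
  apply: le_trans (ler_normD _ _) _; apply: lerD.
    apply: hd; rewrite -{1}(br_code alpha m x); apply: hm.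
    by rewrite size_code.
  rewrite (big_rem (code m x)) ?mem_words ?size_code//= lerDl.
  by rewrite sumr_ge0.
apply: (@measurable_fun_cvg _ _ _ _ (fun n x => psi (br (code n x) X1))) => //.
  by move=> n; case: (bm_code n (fun w => psi (br w X1))).
move=> x _; apply/cvgrPdist_le => e e0.
have [m hm] := cylinder_var alpha uc e0.
exists m => // n /= mn; rewrite -{1}(br_code alpha n x); apply: hm.
by rewrite size_code.
Qed.

Hypothesis mu_inv : invariant_measure f mu.

Lemma Ex_map psi : bm psi -> Ex (fun x => psi (f x)) = Ex psi.
Proof.
move=> h; pose mf := mfun_of (measurable_map alpha).
have h' : bm (fun x => psi (f x)) by exact: (bm_iter 1 h).
suff : (\int[mu]_x (psi (f x))%:E)%E = (\int[mu]_x (psi x)%:E)%E.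
  by rewrite !EFin_Ex// => -[].
have := @integral_distribution _ _ _ _ _ mu mf (EFin \o psi) _ (bm_integrable h').
move=> <-; last by apply/measurable_EFinP; case: h.
by apply: eq_measure_integral => A mA _; exact: mu_inv.
Qed.

Lemma Ex_iter n psi : bm psi -> Ex (fun x => psi (iter n f x)) = Ex psi.
Proof.
move=> h; elim: n => // n IH; rewrite -[RHS]IH -(Ex_map (bm_iter n h)).
by congr Ex; apply/funext => x; rewrite iterSr.
Qed.

End expectation.

(** * The variational inequality *)

Section variational.
Context {R : realType} (alpha : {posnum R}).
Local Notation X := (unit_itv R).
Local Notation f := (intermittent_map alpha).
Local Notation br := (br alpha).
Local Notation code := (code alpha).
Local Notation bs := (bs alpha).
Local Notation Zn := (Zn alpha).
Implicit Types (x y z : X) (w : seq bool) (n m : nat).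

(** Nonnegativity of relative entropy, from ln t <= t - 1 at t = b i / p i; indices with p i = 0 are
    separate because of the division. *)
Lemma gibbs_ineq (I : finType) (p b : I -> R) :
  (forall i, 0 <= p i) -> \sum_i p i = 1 ->
  (forall i, 0 < b i) -> \sum_i b i <= 1 ->
  \sum_i - (p i * ln (p i)) <= \sum_i p i * - ln (b i).
Proof.
move=> p0 p1 b0 b1; rewrite -subr_ge0 -sumrB.
apply: (@le_trans _ _ (\sum_i (p i - b i))); first by rewrite sumrB p1 subr_ge0.
apply: ler_sum => i _; have [->|pn0] := eqVneq (p i) 0.
  by rewrite !mul0r oppr0 subr0 sub0r oppr_le0 ltW.
have pi : 0 < p i by rewrite lt_def pn0 p0.
have : ln (b i / p i) <= b i / p i - 1.
  rewrite -[X in ln X](subrKC 1); apply: le_ln1Dx.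
  by rewrite ltrBrDl subrr divr_gt0.
rewrite lnM ?posrE ?invr_gt0// lnV ?posrE// => h.
have := ler_wpM2l (ltW pi) h; rewrite !mulrBr mulr1 (mulrC (p i) (b i / p i)) mulfVK//.
lra.
Qed.

Lemma lnN_prod_le (I : finType) (F G : I -> R) :
  (forall i, 0 < F i) -> (forall i, - ln (F i) <= G i) ->
  - ln (\prod_i F i) <= \sum_i G i.
Proof.
move=> F0 FG; suff [] : 0 < \prod_i F i /\ - ln (\prod_i F i) <= \sum_i G i by [].
elim/big_ind2: _ => [|x1 x2 y1 y2 [h1 h2] [h3 h4]|i _] //; first by rewrite ln1 oppr0.
by split; [exact: mulr_gt0|rewrite lnM ?posrE// opprD lerD].
Qed.

Lemma entropy_term_ge0 (t : R) : 0 <= t <= 1 -> 0 <= - (t * ln t).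
Proof.
case/andP=> t0 t1; rewrite oppr_ge0 mulr_ge0_le0//.
by rewrite ln_le0.
Qed.

Section partition.
Variables (mu : probability X R) (k : nat) (P : 'I_k -> set X).
Hypotheses (mu_inv : invariant_measure f mu) (mP : measurable_partition P).

Let cls_ex x : exists i, P i x.
Proof.
case: mP => _ _ PT; have : [set: X] x by [].
by rewrite -PT => -[i _ Pi]; exists i.
Qed.

Definition cls x : 'I_k := projT1 (cid (cls_ex x)).

Lemma clsP x i : (cls x = i) <-> P i x.
Proof.
rewrite /cls; case: cid => j /= Pj; split=> [<- //|Pi].
case: mP => _ /trivIsetP tP _; apply/eqP/negPn/negP => ji.
by have := tP j i I I ji => /seteqP[/(_ x) + _]; apply.
Qed.

Lemma mdisc_cls : mdisc cls.
Proof.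
apply: mdisc_fin => i; rewrite (_ : _ @^-1` _ = P i); first by case: mP.
by apply/seteqP; split => x /= /clsP.
Qed.

Definition itin n x : {ffun 'I_n -> 'I_k} := [ffun i : 'I_n => cls (iter i f x)].

Lemma mdisc_itin n : mdisc (itin n).
Proof. by apply: mdisc_ffun => i; apply: mdisc_iter; exact: mdisc_cls. Qed.

Lemma join_atomE n (v : {ffun 'I_n -> 'I_k}) : join_atom f P v = itin n @^-1` [set v].
Proof.
apply/seteqP; split => x /=.
  by move=> h; apply/ffunP => i; rewrite ffunE; apply/clsP; exact: h.
by move=> <- i; rewrite ffunE; apply/clsP.
Qed.

Let pr n (v : {ffun 'I_n -> 'I_k}) : R := fine (mu (itin n @^-1` [set v])).

Lemma join_entropyE n :
  join_entropy mu f P n = \sum_(v : {ffun 'I_n -> 'I_k}) - (pr v * ln (pr v)).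
Proof. by apply: eq_bigr => v _; rewrite join_atomE. Qed.

Let pr_ge0 n (v : {ffun 'I_n -> 'I_k}) : 0 <= pr v.
Proof. by rewrite fine_ge0. Qed.

Lemma Ex_itin n (G : {ffun 'I_n -> 'I_k} -> R) :
  Ex mu (fun x => G (itin n x)) = \sum_v pr v * G v.
Proof.
rewrite (Ex_mdisc mu (s := enum {ffun 'I_n -> 'I_k})).
- by rewrite big_enum/=; apply: eq_bigr => v _; rewrite mulrC.
- exact: enum_uniq.
- exact: mdisc_itin.
- by move=> x; rewrite mem_enum.
Qed.

Let pr_sum n : \sum_(v : {ffun 'I_n -> 'I_k}) pr v = 1.
Proof.
rewrite -[RHS](Ex_cst mu 1); transitivity (\sum_(v : {ffun 'I_n -> 'I_k}) pr v * 1).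
  by apply: eq_bigr => v _; rewrite mulr1.
by rewrite -(Ex_itin (fun=> 1)).
Qed.

Let pr_le1 n (v : {ffun 'I_n -> 'I_k}) : pr v <= 1.
Proof. by rewrite -(pr_sum n) (bigD1 v)//= lerDl sumr_ge0. Qed.

Lemma join_entropy_ge0 n : 0 <= join_entropy mu f P n.
Proof.
by rewrite join_entropyE sumr_ge0// => v _; rewrite entropy_term_ge0// pr_ge0 pr_le1.
Qed.

Lemma join_entropy_le n (b : {ffun 'I_n -> 'I_k} -> R) :
  (forall v, 0 < b v) -> \sum_v b v <= 1 ->
  join_entropy mu f P n <= Ex mu (fun x => - ln (b (itin n x))).
Proof.
move=> b0 b1; rewrite join_entropyE (Ex_itin (fun v => - ln (b v))).
exact: gibbs_ineq.
Qed.

Lemma bm_itin n (G : {ffun 'I_n -> 'I_k} -> R) : bm (fun x => G (itin n x)).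
Proof.
apply: (bm_mdisc (s := enum {ffun 'I_n -> 'I_k})); first exact: mdisc_itin.
by move=> x; rewrite mem_enum.
Qed.

(** Each atom is replaced by a set depending on finitely many digits, and the label is any i whose
    replacement contains the word. It can be wrong only inside one of the k symmetric
    differences. *)
Lemma label_approx (e : R) : 0 < e -> exists N (lab : seq bool -> 'I_k),
  fine (mu [set x | cls x != lab (code N x)]) <= e.
Proof.
move=> e0; have k0 : (0 < k)%N by case: (cls X0) => i; case: (k).
have ek : 0 < e / k%:R by rewrite divr_gt0// ltr0n.
have mPi i : measurable (P i) by case: mP.
have /choice[nU hU] i : exists nU : nat * set (seq bool),
    (mu ((P i `\` level alpha nU.1 nU.2) `|` (level alpha nU.1 nU.2 `\` P i)) <= (e / k%:R)%:E)%E.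
  have [n [U h]] := measurable_approx alpha mu (mPi i) ek.
  by exists (n, U).
pose N := (\sum_(i < k) (nU i).1)%N.
pose lab w := odflt (cls X0) [pick i | `[< (nU i).2 (take (nU i).1 w) >]].
exists N, lab.
have nN i : ((nU i).1 <= N)%N by rewrite /N (bigD1 i)//= leq_addr.
have tk i x : take (nU i).1 (code N x) = code (nU i).1 x.
  by rewrite -(subnKC (nN i)) take_code.
pose D i := (P i `\` level alpha (nU i).1 (nU i).2) `|` (level alpha (nU i).1 (nU i).2 `\` P i).
have mD i : measurable (D i).
  by apply: measurableU; apply: measurableD => //; exact: measurable_level.
have mB : mdisc (fun x => (cls x, code N x)).
  by apply: mdisc_pair; [exact: mdisc_cls|exact: mdisc_code].
have mE : measurable [set x | cls x != lab (code N x)].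
  exact: (mB [set t | t.1 != lab t.2]).
rewrite -Ex_indic//.
apply: (@le_trans _ _ (Ex mu (fun x => \sum_(i < k) \1_(D i) x))).
  apply: Ex_le; [exact: bm_indic|by apply: bm_sum => i; exact: bm_indic|].
  move=> x; rewrite indicE; case: (boolP (x \in _)) => [|_]; last first.
    by rewrite sumr_ge0// => i _; rewrite indicE.
  rewrite inE /= => hx.
  have [[i Di]|nD] := pselect (exists i, D i x).
    by rewrite (bigD1 i)//= indicE mem_set//= lerDl sumr_ge0// => j _; rewrite indicE.
  exfalso; move/negP: hx; apply; rewrite /lab.
  have same i : P i x <-> (nU i).2 (take (nU i).1 (code N x)).
    rewrite tk; split => h; apply: contrapT => nh; apply: nD; exists i.
      by left.
    by right.
  case: pickP => [i /asboolP/same/clsP -> //|/(_ (cls x))/asboolP []].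
  by apply/same/clsP.
rewrite Ex_sum; last by move=> i; exact: bm_indic.
apply: (@le_trans _ _ (\sum_(i < k) e / k%:R)).
  apply: ler_sum => i _; rewrite Ex_indic// -lee_fin fineK; first exact: hU.
  by rewrite fin_num_measure.
by rewrite sumr_const card_ord -[X in X <= _]mulr_natr mulfVK// pnatr_eq0 -lt0n.
Qed.

Variables (u : X -> R) (B : R).
Hypotheses (uu : ucont u) (uB : forall x, `|u x| <= B).

Let bmu : bm u. Proof. exact: ucont_bm alpha _ uu. Qed.

(* The Gibbs inequality against the weights which charge an itinerary v by the
   transfer-operator weights of the binary words w, randomly relabelled by q. *)
Lemma join_entropy_growth (C b t : R) : 0 < t ->
  (forall n, Zn u n X1 <= C * expR (n%:R * b)) ->
  exists K : R, forall n,
    join_entropy mu f P n <= n%:R * (b - Ex mu u + t) + K.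
Proof.
move=> t0 hC; have k0 : (0 < k)%N by case: (cls X0) => i; case: (k).
have kR0 : 0 < k%:R :> R by rewrite ltr0n.
have t4 : 0 < t / 4 by rewrite divr_gt0.
have [C0 C00 hC0] := bs_var alpha uu uB t4.
(* This d makes - ln (1 - d) equal to t / 4, the price of a correct label. *)
pose d : R := 1 - expR (- (t / 4)).
have d0 : 0 < d by rewrite subr_gt0 -[ltRHS]expR0 ltr_expR oppr_lt0.
have d1 : d < 1 by rewrite ltrBlDr ltrDl expR_gt0.
pose L2 : R := `|ln (d / k%:R)|.
have L20 : 0 <= L2 by exact: normr_ge0.
have e0 : 0 < t / 4 / (L2 + 1) by rewrite divr_gt0// ltr_wpDl.
have [N [lab hlab]] := label_approx e0.
(* The noise kernel: the label j is kept with weight 1 - d, and d is spread evenly over all labels.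
   Full support keeps the price of a wrong label below [L2], up to t / 4. *)
pose q (i j : 'I_k) : R := (if i == j then 1 - d else 0) + d / k%:R.
have dk0 : 0 < d / k%:R by rewrite divr_gt0.
have q0 i j : 0 < q i j.
  by rewrite /q ltr_wpDl//; case: ifP => // _; rewrite subr_ge0 ltW.
have qs j : \sum_i q i j = 1.
  rewrite /q big_split/= -big_mkcond/= big_pred1_eq sumr_const card_ord.
  by rewrite -[X in _ + X]mulr_natr mulfVK ?gt_eqF// subrK.
have lnq i j : - ln (q i j) <= t / 4 + (if i == j then 0 else L2).
  rewrite /q; case: eqP => _.
    rewrite addr0 lerNl -[leLHS]expRK ler_ln ?posrE ?expR_gt0//; last first.
      by rewrite addr_gt0// subr_gt0.
    by rewrite /d opprB addrCA subrr addr0 lerDl ltW.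
  rewrite add0r; apply: ler_wpDl; first exact: ltW.
  by rewrite /L2 -normrN ler_norm.
have Zpos n : 0 < Zn u n X1.
  apply: lt_le_trans (Zn_ge alpha n X1 (M := - B) _); first exact: expR_gt0.
  by move=> z; have := uB z; rewrite ler_norml => /andP[].
have C1 : 0 < C.
  by have := lt_le_trans (Zpos 0%N) (hC 0%N); rewrite mul0r expR0 mulr1.
exists (ln C + N%:R * `|b - Ex mu u + t / 4| + C0) => n.
(* N extra letters, since the label at each time i < n reads the N letters that start there. *)
set m := (n + N)%N.
pose a w := expR (bs u w X1) / Zn u m X1.
have a0 w : 0 < a w by rewrite divr_gt0 ?expR_gt0.
pose wt (v : {ffun 'I_n -> 'I_k}) w := a w * \prod_(i < n) q (v i) (lab (take N (drop i w))).
have wt0 v w : 0 < wt v w by rewrite mulr_gt0// prodr_gt0.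
pose bb (v : {ffun 'I_n -> 'I_k}) := \sum_(w <- words m) wt v w.
have bb_ge v w : w \in words m -> wt v w <= bb v.
  by move=> hw; rewrite /bb (big_rem w)//= lerDl sumr_ge0// => w' _; exact: ltW.
have bb0 v : 0 < bb v.
  by apply: lt_le_trans (bb_ge v (nseq m false) _); rewrite ?mem_words ?size_nseq.
(* Summing over v first factorizes the product over times, and each factor sums to 1. *)
have bb1 : \sum_v bb v <= 1.
  rewrite exchange_big/= (_ : \sum_(j <- words m) _ = \sum_(w <- words m) a w).
    by rewrite -mulr_suml -ZnE divff// gt_eqF.
  apply: eq_bigr => w _; rewrite -mulr_sumr.
  rewrite -(bigA_distr_bigA (fun (i : 'I_n) (j : 'I_k) => q j (lab (take N (drop i w))))).
  by rewrite big1 ?mulr1.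
apply: le_trans (join_entropy_le bb0 bb1) _.
pose mis x : R := (cls x != lab (code N x))%:R.
have bmis : bm mis.
  apply: (@bm_mdisc _ _ [seq (i, w) | i <- enum 'I_k, w <- words N] (fun x => (cls x, code N x)) (fun t => (t.1 != lab t.2)%:R)).
    by apply: mdisc_pair; [exact: mdisc_cls|exact: mdisc_code].
  by move=> x; apply: allpairs_f; rewrite ?mem_enum// mem_words size_code.
have Emis : Ex mu mis <= t / 4 / (L2 + 1).
  apply: le_trans hlab; rewrite -Ex_indic.
    rewrite le_eqVlt; apply/orP; left; apply/eqP; congr Ex; apply/funext => x.
    by rewrite indicE /mis; case: (boolP (cls x != _)) => h; [rewrite mem_set|rewrite memNset//; exact/negP].
  have mB : mdisc (fun x => (cls x, code N x)).
    by apply: mdisc_pair; [exact: mdisc_cls|exact: mdisc_code].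
  exact: (mB [set t | t.1 != lab t.2]).
pose S x := \sum_(i < m) u (iter i f x).
pose L x := \sum_(i < n) (t / 4 + L2 * mis (iter i f x)).
have bS : bm S by apply: bm_sum => i; exact: bm_iter.
have bL : bm L.
  by apply: bm_sum => i; apply: bmD; [exact: bm_cst|apply: bmZ; exact: bm_iter].
have bZ := bm_cst (ln (Zn u m X1) + (m%:R * (t / 4) + C0)).
have pw x : - ln (bb (itin n x)) <=
    ((ln (Zn u m X1) + (m%:R * (t / 4) + C0)) - S x) + L x.
  have cw : code m x \in words m by rewrite mem_words size_code.
  have h1 : - ln (bb (itin n x)) <= - ln (wt (itin n x) (code m x)).
    by rewrite lerN2 ler_ln ?posrE//; exact: bb_ge.
  apply: le_trans h1 _.
  rewrite /wt lnM ?posrE ?prodr_gt0// /a lnM ?posrE ?expR_gt0 ?invr_gt0// lnV ?posrE// expRK.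
  have h2 : S x - (m%:R * (t / 4) + C0) <= bs u (code m x) X1.
    have := hC0 (code m x) X1 (iter m f x); rewrite size_code bs_code ler_norml -/(S x).
    by case/andP=> + _; lra.
  have h3 : - ln (\prod_(i < n) q (itin n x i) (lab (take N (drop i (code m x))))) <= L x.
    apply: lnN_prod_le => // i; rewrite ffunE.
    have -> : take N (drop i (code m x)) = code N (iter i f x).
      have -> : m = (i + (N + (n - i)))%N.
        by rewrite addnCA subnKC ?(ltnW (ltn_ord i))// addnC.
      by rewrite code_add drop_size_cat ?size_code// take_code.
    apply: le_trans (lnq _ _) _; rewrite lerD2l /mis.
    by case: eqP => _; rewrite ?mulr0 ?mulr1.
  lra.
apply: le_trans (Ex_le mu (bm_itin (fun v => - ln (bb v))) (bmD (bmB bZ bS) bL) pw) _.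
rewrite ExD//; last exact: bmB.
rewrite ExB// Ex_cst.
have -> : Ex mu S = m%:R * Ex mu u.
  rewrite /S Ex_sum; last by move=> i; exact: bm_iter.
  under eq_bigr do rewrite (Ex_iter mu_inv)//.
  by rewrite sumr_const card_ord mulr_natl.
have -> : Ex mu L = n%:R * (t / 4 + L2 * Ex mu mis).
  rewrite /L Ex_sum; last by move=> i; apply: bmD; [exact: bm_cst|apply: bmZ; exact: bm_iter].
  rewrite mulr_natl -[X in _ = _ *+ X](card_ord n) -sumr_const; apply: eq_bigr => i _.
  rewrite ExD ?Ex_cst ?ExZ ?(Ex_iter mu_inv)//; first exact: bm_iter.
    exact: bm_cst.
  by apply: bmZ; exact: bm_iter.
have hL : L2 * Ex mu mis <= t / 4.
  apply: le_trans (ler_wpM2l (normr_ge0 _) Emis) _.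
  by rewrite mulrA ler_pdivrMr ?ltr_wpDl// mulrC ler_wpM2l ?(ltW t4)// lerDl.
have hZ : ln (Zn u m X1) <= ln C + m%:R * b.
  by rewrite -[m%:R * b]expRK -lnM ?posrE ?expR_gt0// ler_ln ?posrE ?mulr_gt0 ?expR_gt0.
have mE : m%:R = n%:R + N%:R :> R by rewrite natrD.
have hN : N%:R * (b - Ex mu u + t / 4) <= N%:R * `|b - Ex mu u + t / 4|.
  by rewrite ler_wpM2l// ler_norm.
have := ler_wpM2l (ler0n R n) hL; rewrite mE in hZ *.
have : 0 <= n%:R * (t / 4) by rewrite mulr_ge0// ltW.
lra.
Qed.

Lemma partition_entropy_le (C b : R) :
  (forall n, Zn u n X1 <= C * expR (n%:R * b)) ->
  partition_entropy mu f P <= b - Ex mu u.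
Proof.
move=> hC; apply/ler_addgt0Pr => t t0.
have t2 : 0 < t / 2 by rewrite divr_gt0.
have [K hK] := join_entropy_growth t2 hC.
have bnd (e : R) : 0 < e -> exists n0, forall n, (n0 <= n)%N ->
    join_entropy mu f P n / n%:R <= b - Ex mu u + t / 2 + e.
  move=> e0; exists (Num.truncn (`|K| / e)).+1 => n hn.
  have n0 : 0 < n%:R :> R by rewrite ltr0n; apply: leq_trans hn.
  rewrite ler_pdivrMr//; apply: le_trans (hK n) _.
  rewrite mulrC [leRHS]mulrDl lerD2l.
  have : `|K| / e <= n%:R.
    by apply: ltW; apply: lt_le_trans (truncnS_gt _) _; rewrite ler_nat.
  by rewrite ler_pdivrMr// mulrC; apply: le_trans; exact: ler_norm.
(* If the sequence diverges, [limn] returns the default value 0, so the bound itself must be shown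
   nonnegative. *)
have b0 : 0 <= b - Ex mu u + t.
  have [n0 /(_ n0.+1 (leqnSn _))] := bnd _ t2.
  have : 0 <= join_entropy mu f P n0.+1 / n0.+1%:R by rewrite divr_ge0// join_entropy_ge0.
  by move=> h1 h2; have := le_trans h1 h2; lra.
rewrite /partition_entropy.
have [cv|/dvgP ->] := pselect (cvgn (fun n => join_entropy mu f P n / n%:R)).
  apply: limr_le => //; have [n0 h0] := bnd _ t2.
  exists n0 => // n /= hn; apply: le_trans (h0 n hn) _; lra.
exact: b0.
Qed.

End partition.

Theorem entropy_le (mu : probability X R) (u : X -> R) (B C b : R) :
  invariant_measure f mu -> ucont u -> (forall x, `|u x| <= B) ->
  (forall n, Zn u n X1 <= C * expR (n%:R * b)) ->
  (entropy f mu <= (b - Ex mu u)%:E)%E.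
Proof.
move=> mi uu uB hC; apply: ge_ereal_sup => _ [k [P [mP ->]]].
rewrite lee_fin; exact: (@partition_entropy_le mu k P mi mP u B uu uB C b hC).
Qed.

End variational.

(** * Gibbs states *)

Lemma code_mkseq (R : realType) (alpha : {posnum R}) n (x : unit_itv R) :
  code alpha n x = [seq digit alpha (iter i (intermittent_map alpha) x) | i <- iota 0 n].
Proof.
elim: n x => //= n IH x; rewrite IH; congr cons.
by rewrite -[1%N]addn0 iotaDl -map_comp; apply: eq_map => i /=; rewrite -iterSr.
Qed.

Lemma holder_lip (R : realType) (g : R) (psi : unit_itv R -> R) (D : R) :
  0 < g -> g <= 1 -> holder_with 1 psi D -> holder_with g psi D.
Proof.
move=> g0 g1 h x y; apply: le_trans (h x y) _.
rewrite ler_wpM2l ?(holder_ge0 h)// -![val _]/(pt _).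
have [->|d0] := eqVneq `|pt x - pt y| 0; first by rewrite !powR0// ?gt_eqF.
by rewrite ger_powR// dist_le1 andbT lt_def d0 normr_ge0.
Qed.

Section simple_approx.
Context {R : realType} (alpha : {posnum R}).
Local Notation X := (unit_itv R).
Local Notation code := (code alpha).

Lemma bm_norm (psi : X -> R) : bm psi -> bm (fun x => `|psi x|).
Proof.
move=> [m1 [M1 b1]]; split; first exact: measurableT_comp.
by exists M1 => x; rewrite normr_id.
Qed.

Lemma Ex_norm (mu : probability X R) (psi psi' : X -> R) : bm psi -> bm psi' ->
  (forall x, `|psi x| <= psi' x) -> `|Ex mu psi| <= Ex mu psi'.
Proof.
move=> h h' le; rewrite ler_norml -mulN1r -ExZ//; apply/andP; split.
  apply: Ex_le => //; first exact: bmZ.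
  by move=> x; have := le x; rewrite ler_norml mulN1r => /andP[].
by apply: Ex_le => // x; have := le x; rewrite ler_norml => /andP[].
Qed.

(* psi is first rounded down to a multiple of 1/j, which partitions the space
   into finitely many level sets, approximated in turn by cylinders. *)
Lemma simple_approx (mu : probability X R) (psi : X -> R) (B e : R) :
  measurable_fun setT psi -> (forall x, `|psi x| <= B) -> 0 < e ->
  exists N (cc : seq bool -> R), [/\ forall w, `|cc w| <= B,
    bm (fun x => cc (code N x)) &
    Ex mu (fun x => `|psi x - cc (code N x)|) <= e].
Proof.
move=> mpsi pB e0; have B0 : 0 <= B by apply: le_trans (pB X0).
pose j : R := 2 / e.
have j0 : 0 < j by rewrite divr_gt0.
pose v x := (psi x + B) * j.
have v0 x : 0 <= v x.
  by rewrite mulr_ge0 ?(ltW j0)//; have := pB x; rewrite ler_norml => /andP[]; lra.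
have vB x : v x <= 2 * B * j.
  by rewrite ler_wpM2r ?(ltW j0)//; have := pB x; rewrite ler_norml => /andP[]; lra.
pose k := (Num.truncn (2 * B * j)).+1.
pose P (i : 'I_k) : set X := [set x | Num.truncn (v x) = i].
have mv : measurable_fun setT v.
  by apply: measurable_funM => //; apply: measurable_funD.
have PE i : P i = v @^-1` `[(i : nat)%:R, (i : nat).+1%:R[%classic.
  apply/seteqP; split => x /=; rewrite in_itv /= /P.
    by move=> <-; exact: truncn_itv.
  by move=> h; apply/truncn_def.
have mP : measurable_partition P.
  split.
  - by move=> i; rewrite PE -[X in measurable X]setTI; exact: mv.
  - apply/trivIsetP => i i' _ _; apply: contraNP => /eqP/set0P[x [/= hi hi']].
    by apply/eqP/val_inj; move: hi hi'; rewrite /P /= => -> .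
  - apply/seteqP; split => // x _.
    have lt : (Num.truncn (v x) < k)%N by rewrite ltnS; apply: le_truncn.
    by exists (Ordinal lt).
have eB : 0 < e / (4 * B + 1) / 2 by rewrite !divr_gt0//; lra.
have [N [lab hlab]] := label_approx alpha mu mP eB.
pose cc w : R := (lab w : nat)%:R / j - B.
have ccB w : `|cc w| <= B.
  have : (lab w : nat)%:R <= 2 * B * j.
    have := ltn_ord (lab w); rewrite ltnS => h.
    apply: le_trans (_ : (Num.truncn (2 * B * j))%:R <= _); first by rewrite ler_nat.
    by have /andP[] := truncn_itv (mulr_ge0 (mulr_ge0 (ler0n R 2) B0) (ltW j0)).
  rewrite -ler_pdivrMr// ler_norml => h1; rewrite /cc.
  have : 0 <= (lab w : nat)%:R / j by rewrite divr_ge0// ltW.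
  by move=> h2; apply/andP; split; lra.
exists N, cc; split=> //; first exact: (bm_code alpha N cc).
have mB : mdisc (fun x => (cls mP x, code N x)).
  by apply: mdisc_pair; [exact: mdisc_cls|exact: mdisc_code].
have mE : measurable [set x | cls mP x != lab (code N x)].
  exact: (mB [set t | t.1 != lab t.2]).
have bpsi : bm psi by split=> //; exists B.
have bd : bm (fun x => `|psi x - cc (code N x)|).
  by apply: bm_norm; apply: bmB => //; exact: (bm_code alpha N cc).
set E := [set x | _] in mE hlab.
apply: (@le_trans _ _ (Ex mu (fun x => e / 2 + 2 * B * \1_E x))).
  apply: Ex_le => //.
    by apply: bmD; [exact: bm_cst|apply: bmZ; exact: bm_indic].
  move=> x; rewrite indicE; case: (boolP (x \in E)) => [_|].
    rewrite mulr1; apply: le_trans (ler_normB _ _) _.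
    by have := pB x; have := ccB (code N x); lra.
  rewrite mulr0 addr0 notin_setE /E /= => /negP; rewrite negbK => /eqP Ec.
  have : Num.truncn (v x) = cls mP x by have /clsP := erefl (cls mP x).
  rewrite Ec => El; rewrite /cc -El.
  have /andP[t1 t2] := truncn_itv (v0 x).
  have -> : psi x - ((Num.truncn (v x))%:R / j - B) = (v x - (Num.truncn (v x))%:R) / j.
    by rewrite /v; field; rewrite gt_eqF.
  rewrite normrM normfV (gtr0_norm j0) ler_pdivrMr// ger0_norm ?subr_ge0//.
  have -> : e / 2 * j = 1 by rewrite /j; field; rewrite gt_eqF.
  by rewrite lerBlDl natr1 ltW.
rewrite ExD; first last.
- by apply: bmZ; exact: bm_indic.
- exact: bm_cst.
have bE : bm (\1_E : X -> R) by exact: bm_indic.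
rewrite (ExZ _ _ bE) Ex_cst Ex_indic//.
have : 2 * B * fine (mu E) <= 2 * B * (e / (4 * B + 1) / 2) by rewrite ler_wpM2l// mulr_ge0.
have : 2 * B * (e / (4 * B + 1) / 2) <= e / 2.
  have -> : 2 * B * (e / (4 * B + 1) / 2) = e / 2 * (2 * B / (4 * B + 1)).
    by field; rewrite gt_eqF//; lra.
  by rewrite ler_piMr ?divr_ge0 ?(ltW e0)// ler_pdivrMr ?mul1r; lra.
lra.
Qed.

End simple_approx.

Section gibbs.
Context {R : realType} (alpha : {posnum R}).
Local Notation X := (unit_itv R).
Local Notation f := (intermittent_map alpha).
Local Notation br := (br alpha).
Local Notation code := (code alpha).
Local Notation cyl := (cyl alpha).
Local Notation Lop := (Lop alpha).
Local Notation bs := (bs alpha).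
Local Notation Zn := (Zn alpha).
Implicit Types (x y z : X) (w : seq bool) (n m : nat).
Implicit Types (psi : X -> R).
Variables (u h : X -> R) (p c : R).
Hypotheses (c_gt0 : 0 < c) (h01 : forall x, c <= h x <= 1).
Hypothesis hL : forall x, Lop u h x = expR p * h x.
Variables (g : R) (A B K : R).
Local Notation H := (holder_with g).
Hypotheses (g_gt0 : 0 < g) (uA : H u A) (uB : forall x, `|u x| <= B) (hK : H h K).
Local Notation NL := (NL alpha u h p).
Local Notation th := (th alpha u h p).
Local Notation Lam := (Lam alpha u h p).
Local Notation M := (M alpha u h p).
Variables (Q r : R).
Hypotheses (Q_gt0 : 0 < Q) (r01 : 0 < r < 1).
Hypothesis decay : forall psi D n x y, H psi D ->
  `|NL n psi x - NL n psi y| <= Q * D * r ^+ n.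
Variable nu : probability X R.
Hypotheses (nu_inv : invariant_measure f nu) (nuM : forall w, nu (cyl w) = (M w)%:E).

Let Mle := M_le c_gt0 h01 hL g_gt0 uA uB hK Q_gt0 r01 decay.
Let Mge := M_ge c_gt0 h01 hL g_gt0 uA uB hK Q_gt0 r01 decay.

Let M_pos w : 0 < M w.
Proof. exact: (M_gt0 c_gt0 h01 hL g_gt0 uA uB hK Q_gt0 r01 decay). Qed.

Lemma eig_Zn_le n x : Zn u n x <= c^-1 * expR (n%:R * p).
Proof.
rewrite ler_pdivlMl//; apply: (@le_trans _ _ (iter n (Lop u) h x)).
  rewrite -iter_LopZ; apply: iter_Lop_le => z; rewrite mulr1.
  by case/andP: (h01 z).
rewrite (iter_Lop_eig hL) ler_piMr ?expR_ge0//.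
by case/andP: (h01 x).
Qed.

Let P2 (i : 'I_2) : set X := [set x | digit alpha x = (i == 1 :> nat)].

Let mP2 : measurable_partition P2.
Proof.
have E i : P2 i = cyl [:: (i == 1 :> nat)].
  apply/seteqP; split => x; rewrite /P2 /Submission.cyl /=; first by move=> ->.
  by case.
split.
- by move=> i; rewrite E; exact: measurable_cyl.
- apply/trivIsetP => i j _ _; apply: contraNP => /eqP/set0P[x [/= hi hj]].
  apply/eqP/val_inj; move: hi hj; rewrite /P2 /= => -> /eqP.
  by case: i j => [[|[|//]] ?] [[|[|//]] ?].
- apply/seteqP; split => // x _; case: (boolP (digit alpha x)) => d.
    by exists (Ordinal (ltnSn 1)).
  by exists (Ordinal (ltn0Sn 1)); rewrite //= /P2 /= (negbTE d).
Qed.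

Let itin_code n x y : itin alpha mP2 n x = itin alpha mP2 n y <-> code n x = code n y.
Proof.
rewrite !code_mkseq; split=> [E|E].
  apply/eq_in_map => i; rewrite mem_iota add0n => /andP[_ ni].
  have := congr1 (fun v : {ffun 'I_n -> 'I_2} => v (Ordinal ni)) E.
  rewrite !ffunE /= => Ec.
  have /clsP := erefl (cls mP2 (iter i f x)); rewrite Ec /P2 /= => ->.
  by have /clsP := erefl (cls mP2 (iter i f y)); rewrite /P2 /= => ->.
apply/ffunP => i; rewrite !ffunE.
have Ei : digit alpha (iter i f x) = digit alpha (iter i f y).
  have : nth false [seq digit alpha (iter i f x) | i <- iota 0 n] i =
         nth false [seq digit alpha (iter i f y) | i <- iota 0 n] i by rewrite E.
  by rewrite !(nth_map 0%N) ?size_iota// nth_iota// add0n.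
apply/clsP; rewrite /P2 /= Ei.
by have /clsP := erefl (cls mP2 (iter i f y)).
Qed.

Lemma join_entropy_M n :
  join_entropy nu f P2 n = Ex nu (fun x => - ln (M (code n x))).
Proof.
rewrite (join_entropyE alpha nu mP2).
pose pr v := fine (nu (itin alpha mP2 n @^-1` [set v])).
transitivity (Ex nu (fun x => - ln (pr (itin alpha mP2 n x)))).
  rewrite (Ex_itin alpha nu mP2 (fun v => - ln (pr v))).
  by apply: eq_bigr => v _; rewrite mulrN.
congr Ex; apply/funext => x; congr (- ln _).
rewrite /pr (_ : _ @^-1` _ = cyl (code n x)) ?nuM//.
by apply/seteqP; split => y /=; rewrite /Submission.cyl /= size_code => /itin_code.
Qed.

(** A weak Gibbs property with an error sublinear in n. The distortion of the Birkhoff sums gives n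
    e + C; of the three - ln c, two come from comparing [th w] at two points and one from h in
    [th w y]. *)
Let M_code (e C : R) : (forall w x y, `|bs u w x - bs u w y| <= (size w)%:R * e + C) ->
  forall n x, `|- ln (M (code n x)) - (n%:R * p - \sum_(i < n) u (iter i f x))| <=
    n%:R * e + (C + 3 * - ln c).
Proof.
move=> hC n x; set w := code n x; set y := iter n f x.
have sw : size w = n by rewrite size_code.
set S := \sum_(i < n) _.
have bS : bs u w y = S by rewrite /w /y bs_code.
have c1 : c <= 1 by case/andP: (h01 X1) => h1; exact: le_trans.
have lnc : ln c <= 0 by rewrite ln_le0.
have hw z z' : `|bs u w z - bs u w z'| <= n%:R * e + C by have := hC w z z'; rewrite sw.
have thy : c * expR (S - n%:R * p) <= th w y <= c^-1 * expR (S - n%:R * p).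
  rewrite /Submission.th bS sw.
  case/andP: (h01 (br w y)) => b1 b2; case/andP: (h01 y) => y1 y2.
  have hy := eig_gt0 c_gt0 h01 y.
  apply/andP; split.
    rewrite ler_pdivlMr// (mulrC c) -mulrA ler_wpM2l ?expR_ge0//.
    by apply: le_trans b1; rewrite ler_piMr// ltW.
  rewrite -mulrA mulrC ler_wpM2r ?expR_ge0//.
  rewrite -[leRHS]mul1r ler_pM ?invr_ge0 ?(ltW hy)//.
    exact/ltW/(eig_gt0 c_gt0 h01).
  by rewrite lef_pV2 ?posrE.
case/andP: thy => thy1 thy2.
have E0 : 0 < c ^- 2 * expR (n%:R * e + C) by rewrite mulr_gt0 ?expR_gt0// invr_gt0 exprn_gt0.
have up : M w <= c ^- 2 * expR (n%:R * e + C) * (c^-1 * expR (S - n%:R * p)).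
  apply: Mle => z; apply: le_trans (th_le p c_gt0 h01 (hw z y)) _.
  by rewrite ler_wpM2l// ltW.
have lo : (c ^- 2 * expR (n%:R * e + C))^-1 * (c * expR (S - n%:R * p)) <= M w.
  apply: Mge => z; rewrite ler_pdivrMl//; apply: le_trans thy1 _.
  exact: (th_le p c_gt0 h01 (hw y z)).
have l2 : ln (c ^- 2) = - (2 * ln c).
  by rewrite lnV ?posrE ?exprn_gt0// lnXn// mulr_natl.
have c20 : 0 < c ^- 2 by rewrite invr_gt0 exprn_gt0.
have ci0 : 0 < c^-1 by rewrite invr_gt0.
have up' : ln (M w) <= - (2 * ln c) + (n%:R * e + C) + (- ln c + (S - n%:R * p)).
  rewrite -l2 -[X in _ + X + _]expRK -[X in _ <= _ + (_ + X)]expRK.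
  rewrite -lnV ?posrE// -!lnM ?posrE ?mulr_gt0 ?expR_gt0//.
  by rewrite ler_ln ?posrE ?mulr_gt0 ?expR_gt0.
have lo' : - (- (2 * ln c) + (n%:R * e + C)) + (ln c + (S - n%:R * p)) <= ln (M w).
  rewrite -l2 -[X in - (_ + X)]expRK -[X in _ + (_ + X)]expRK.
  rewrite -[X in - X]lnM ?posrE ?expR_gt0// -lnV ?posrE// -!lnM ?posrE ?mulr_gt0 ?expR_gt0 ?invr_gt0//.
  by rewrite ler_ln ?posrE ?mulr_gt0 ?expR_gt0// ?invr_gt0.
by rewrite ler_norml; apply/andP; split; lra.
Qed.

Let uu : ucont u. Proof. exact: (holder_ucont g_gt0 uA). Qed.
Let bmu : bm u. Proof. exact: (ucont_bm alpha uu). Qed.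

Let Hn_cvg : join_entropy nu f P2 n / n%:R @[n --> \oo] --> p - Ex nu u.
Proof.
apply/cvgrPdist_le => t t0; have t2 : 0 < t / 2 by rewrite divr_gt0.
have [C C0 hC] := bs_var alpha uu uB t2.
set C' := C + 3 * - ln c.
exists (Num.truncn (`|C'| / (t / 2))).+1 => // n /= hn.
have n0 : 0 < n%:R :> R by rewrite ltr0n; apply: leq_trans hn.
have bS : bm (fun x => \sum_(i < n) u (iter i f x)) by apply: bm_sum => i; exact: bm_iter.
have bM : bm (fun x => - ln (M (code n x))) by exact: (bm_code alpha n (fun w => - ln (M w))).
have bT : bm (fun x => n%:R * p - \sum_(i < n) u (iter i f x)) by apply: bmB => //; exact: bm_cst.
have : `|Ex nu (fun x => - ln (M (code n x)) - (n%:R * p - \sum_(i < n) u (iter i f x)))| <=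
    n%:R * (t / 2) + C'.
  by apply: Ex_norm_le; [exact: bmB|exact: M_code].
rewrite ExB// ExB//; last exact: bm_cst.
rewrite Ex_cst Ex_sum; last by move=> i; exact: bm_iter.
under eq_bigr do rewrite (Ex_iter nu_inv)//.
rewrite sumr_const card_ord -[Ex nu u *+ n]mulr_natl -mulrBr -join_entropy_M => hh.
have -> : p - Ex nu u - join_entropy nu f P2 n / n%:R =
    - (join_entropy nu f P2 n - n%:R * (p - Ex nu u)) / n%:R.
  by field; rewrite gt_eqF.
rewrite mulNr normrN normrM normfV (gtr0_norm n0) ler_pdivrMr//.
apply: le_trans hh _; have : C' <= n%:R * (t / 2).
  rewrite -ler_pdivrMr//; apply: le_trans (_ : _ <= `|C'| / (t / 2)) _.
    by rewrite ler_wpM2r ?invr_ge0 ?(ltW t2)// ler_norm.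
  by apply: ltW; apply: lt_le_trans (truncnS_gt _) _; rewrite ler_nat.
lra.
Qed.

(** The upper bound holds for every partition by [entropy_le], and the two-set partition by the
    first digit attains it, so no generator theorem enters. *)
Lemma gibbs_entropy : entropy f nu = (p - Ex nu u)%:E.
Proof.
apply/eqP; rewrite eq_le; apply/andP; split.
  exact: (entropy_le nu_inv uu uB (eig_Zn_le ^~ X1)).
apply: ereal_sup_ubound; exists 2%N, P2; split; first exact: mP2.
by congr EFin; apply/esym/(cvg_lim (@Rhausdorff R)).
Qed.

Lemma gibbs_entropy_gt0 : 0 < p - Ex nu u.
Proof.
have [s /andP[s0 s1] hs] := M_exp c_gt0 h01 hL g_gt0 uA uB hK Q_gt0 r01 decay.
apply: (@lt_le_trans _ _ (- ln s)); first by rewrite oppr_gt0 ln_lt0// s0.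
apply: (cvgr_to_ge Hn_cvg); exists 1%N => // n /= n1.
rewrite ler_pdivlMr ?ltr0n// join_entropy_M.
rewrite -[leLHS](Ex_cst nu); apply: Ex_le; [exact: bm_cst|exact: (bm_code alpha n (fun w => - ln (M w)))|move=> x].
rewrite mulNr lerN2 mulrC mulr_natl -lnXn// ler_ln ?posrE ?exprn_gt0//.
by have := hs (code n x); rewrite size_code.
Qed.

Let ExM n (G : seq bool -> R) : Ex nu (fun x => G (code n x)) = \sum_(w <- words n) G w * M w.
Proof. by rewrite Ex_code; apply: eq_bigr => w _; rewrite nuM. Qed.

Let sumM n : \sum_(w <- words n) M w = 1.
Proof.
rewrite -[RHS](Ex_cst nu 1) (ExM n (fun=> 1)).
by apply: eq_bigr => w _; rewrite mul1r.
Qed.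

(** Fix the word b read from time n on. Up to the variation of chi on cylinders, the average of chi
    over the prefixes a of length n is the normalized operator at [br b y], which is within Q D r^n
    of [Lam chi]. *)
Let mix_cyl (chi : X -> R) (D Bc e : R) (N n : nat) (cc : seq bool -> R) :
  H chi D -> 0 < e -> (forall w, `|cc w| <= Bc) ->
  `|Ex nu (fun x => cc (code N (iter n f x)) * chi x) -
    Lam chi * Ex nu (fun x => cc (code N x))| <= Bc * (Q * D * r ^+ n + e).
Proof.
move=> hD e0 hB; have e2 : 0 < e / 2 by rewrite divr_gt0.
have uchi : ucont chi by exact: (holder_ucont g_gt0 hD).
have [m0 hm0] := cylinder_var alpha uchi e2.
(* N letters determine [cc]; the m0 others make the variation of chi on cylinders at most e / 2 even
   for n = 0. *)
pose m := (N + m0)%N.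
have Bc0 : 0 <= Bc by apply: le_trans (hB [::]).
pose c' w := cc (take N w).
have c'E x : cc (code N x) = c' (code m x) by rewrite /c' take_code.
pose chim x := chi (br (code (n + m) x) X1).
have chimE x : `|chi x - chim x| <= e / 2.
  rewrite -{1}(br_code alpha (n + m) x); apply: hm0.
  by rewrite size_code /m; lia.
have bchi : bm chi by exact: (ucont_bm alpha uchi).
have bchim : bm chim by exact: (bm_code alpha (n + m) (fun w => chi (br w X1))).
have bcN : bm (fun x => cc (code N x)) by exact: (bm_code alpha N cc).
have bcn : bm (fun x => cc (code N (iter n f x))) by exact: (bm_iter alpha n bcN).
have s1 : `|Ex nu (fun x => cc (code N (iter n f x)) * chi x) -
    Ex nu (fun x => cc (code N (iter n f x)) * chim x)| <= Bc * (e / 2).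
  rewrite -ExB; try exact: bmM.
  apply: Ex_norm_le; first by apply: bmB; exact: bmM.
  by move=> x; rewrite -mulrBr normrM ler_pM.
have hchi : is_holder g chi by exists D.
have -> : Ex nu (fun x => cc (code N x)) = \sum_(b <- words m) c' b * M b.
  by rewrite -(ExM m c'); congr Ex; apply/funext => x.
have s2 : Ex nu (fun x => cc (code N (iter n f x)) * chim x) =
    \sum_(b <- words m) c' b * \sum_(a <- words n) chi (br a (br b X1)) * M (a ++ b).
  have -> : (fun x => cc (code N (iter n f x)) * chim x) =
      (fun x => (fun w => c' (drop n w) * chi (br w X1)) (code (n + m) x)).
    apply/funext => x; rewrite c'E /chim code_add drop_size_cat ?size_code//.
  rewrite (ExM (n + m) (fun w => c' (drop n w) * chi (br w X1))) big_words_add exchange_big/= big_seq [RHS]big_seq.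
  apply: eq_bigr => b _; rewrite mulr_sumr big_seq [RHS]big_seq.
  apply: eq_bigr => a; rewrite mem_words => /eqP sa.
  by rewrite drop_size_cat// br_cat mulrA.
have s3 b : b \in words m ->
    `|\sum_(a <- words n) chi (br a (br b X1)) * M (a ++ b) - Lam chi * M b| <=
    (Q * D * r ^+ n + e / 2) * M b.
  rewrite mem_words => /eqP sb.
  have thH := th_holder alpha p c_gt0 h01 g_gt0 uA uB hK.
  pose F y := \sum_(a <- words n) chi (br a (br b X1)) * th (a ++ b) y.
  have FH : forall a, is_holder g (fun y => chi (br a (br b X1)) * th (a ++ b) y).
    by move=> a; have [E hE] := thH (a ++ b); eexists; exact: holderZ hE.
  have -> : \sum_(a <- words n) chi (br a (br b X1)) * M (a ++ b) = Lam F.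
    rewrite (Lam_sum c_gt0 h01 hL Q_gt0 r01 decay)//.
    by apply: eq_bigr => a _; rewrite (LamZ c_gt0 h01 hL Q_gt0 r01 decay).
  have Fle y : `|F y - Lam chi * th b y| <= (Q * D * r ^+ n + e / 2) * th b y.
    have thb := th_ge0 alpha u p c_gt0 h01 b y.
    have -> : F y = (\sum_(a <- words n) th a (br b y) * chi (br a (br b X1))) * th b y.
      rewrite mulr_suml; apply: eq_bigr => a _.
      by rewrite (th_cat _ _ _ c_gt0 h01); ring.
    rewrite -mulrBl normrM (ger0_norm thb) ler_wpM2r//.
    have d1 : `|NL n chi (br b y) - Lam chi| <= Q * D * r ^+ n.
      exact: (Lam_dist c_gt0 h01 hL Q_gt0 r01 decay).
    have d2 : `|\sum_(a <- words n) th a (br b y) * chi (br a (br b X1)) - NL n chi (br b y)| <= e / 2.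
      rewrite /Submission.NL -sumrB; apply: le_trans (ler_norm_sum _ _ _) _.
      have -> : e / 2 = \sum_(a <- words n) th a (br b y) * (e / 2).
        by rewrite -mulr_suml (sum_th c_gt0 h01 hL) mul1r.
      apply: ler_sum => a _; rewrite -mulrBr normrM ger0_norm ?(th_ge0 _ _ _ c_gt0 h01)//.
      rewrite ler_wpM2l ?(th_ge0 _ _ _ c_gt0 h01)// -!(br_cat alpha).
      by apply: hm0; rewrite size_cat sb /m; lia.
    have -> : forall s t : R, s - t = (s - NL n chi (br b y)) + (NL n chi (br b y) - t).
      by move=> *; ring.
    by apply: le_trans (ler_normD _ _) _; rewrite addrC lerD.
  have LF : is_holder g F by exact: holder_sum.
  have Lb (a : R) : Lam (fun y => a * th b y) = a * M b.
    by rewrite (LamZ c_gt0 h01 hL Q_gt0 r01 decay).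
  have bH (a : R) : is_holder g (fun y => a * th b y).
    by have [E hE] := thH b; eexists; exact: holderZ hE.
  have Lle := Lam_le c_gt0 h01 hL Q_gt0 r01 decay.
  rewrite ler_norml; apply/andP; split.
    rewrite lerBrDr -mulNr -mulrDl -Lb; apply: Lle => // y.
    by have := Fle y; rewrite ler_norml => /andP[+ _]; lra.
  rewrite lerBlDr -mulrDl -Lb; apply: Lle => // y.
  by have := Fle y; rewrite ler_norml => /andP[_]; lra.
have s4 : `|Ex nu (fun x => cc (code N (iter n f x)) * chim x) -
    Lam chi * \sum_(b <- words m) c' b * M b| <= Bc * (Q * D * r ^+ n + e / 2).
  rewrite s2 mulr_sumr -sumrB; apply: le_trans (ler_norm_sum _ _ _) _.
  have -> : Bc * (Q * D * r ^+ n + e / 2) =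
      \sum_(b <- words m) Bc * ((Q * D * r ^+ n + e / 2) * M b).
    by rewrite -mulr_sumr -mulr_sumr (sumM m) mulr1.
  rewrite big_seq [leRHS]big_seq.
  apply: ler_sum => b hb; rewrite mulrCA -mulrBr normrM ler_pM//; last exact: s3.
  exact: hB.
set V := Ex nu (fun x => _ * chim x) in s1 s4.
have -> : forall s t : R, s - t = (s - V) + (V - t) by move=> *; ring.
apply: le_trans (ler_normD _ _) _; apply: le_trans (lerD s1 s4) _.
lra.
Qed.

Let mix_const (chi : X -> R) (D : R) n : H chi D ->
  `|Ex nu chi - Lam chi| <= Q * D * r ^+ n.
Proof.
move=> hD; apply/ler_addgt0Pr => e e0.
have := @mix_cyl chi D 1 e 0%N n (fun=> 1) hD e0.
rewrite Ex_cst mulr1 mul1r normr1 => /(_ (fun=> lexx _)).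
by under [X in Ex _ X]eq_fun do rewrite mul1r.
Qed.

(** The first observable is only bounded and measurable, so it is approximated in L^1 by a function
    of finitely many digits with the same bound; invariance transports the error to time n. One Q
    comes from [mix_cyl], the other from replacing [Lam chi] by the integral. *)
Lemma gibbs_mixing : g <= 1 -> exponentially_mixing alpha nu.
Proof.
move=> g1; exists (2 * Q), r; split=> //; first by rewrite mulr_gt0.
move=> psi chi n [Bp [_ hBp]] mpsi hchi.
set B' := sup_norm psi; set D := holder_seminorm 1 chi.
have pB x : `|psi x| <= B'.
  apply: ub_le_sup; last by exists x.
  by exists (Bp + 1) => _ [y _ <-]; apply: hBp => //; rewrite ltrDl.
have bpsi : bm psi by split => //; exists B'.
have B0 : 0 <= B' by apply: le_trans (pB X0).
have hD1 : holder_with 1 chi D by exact: le_holder_seminorm.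
have hD : H chi D by exact: holder_lip.
have uchi : ucont chi by exact: (holder_ucont g_gt0 hD).
have bchi : bm chi by exact: (ucont_bm alpha uchi).
have [Bx hBx] := bchi.2.
have Bx0 : 0 <= Bx by apply: le_trans (hBx X0).
rewrite -!/(Ex _ _) -/(Ex nu chi).
have rn : 0 <= r ^+ n by rewrite exprn_ge0//; case/andP: r01 => /ltW.
pose KK := Bx + B' + `|Lam chi| + 1.
have KK0 : 0 < KK by rewrite /KK; have := normr_ge0 (Lam chi); lra.
apply/ler_addgt0Pr => e' e'0; pose e : R := e' / KK.
have e0 : 0 < e by rewrite divr_gt0.
have [N [cc [hcc bcc he]]] := simple_approx alpha nu mpsi pB e0.
have mc := mix_cyl N n hD e0 hcc.
have mk := mix_const n hD.
have bcn : bm (fun x => cc (code N x)) := bm_code alpha N cc.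
have t1 : `|Ex nu (fun x => psi (iter n f x) * chi x) -
    Ex nu (fun x => cc (code N (iter n f x)) * chi x)| <= Bx * e.
  have b1 := bm_iter alpha n bpsi; have b2 := bm_iter alpha n bcn.
  rewrite -ExB; try exact: bmM.
  have bd : bm (fun x => `|psi x - cc (code N x)|) by apply: bm_norm; exact: bmB.
  have bdn := bm_iter alpha n bd.
  apply: (@le_trans _ _ (Ex nu (fun x => Bx * `|psi (iter n f x) - cc (code N (iter n f x))|))).
    apply: Ex_norm; first by apply: bmB; exact: bmM.
      exact: bmZ.
    by move=> x; rewrite -mulrBl normrM mulrC ler_wpM2r.
  by rewrite (ExZ nu Bx bdn) (Ex_iter nu_inv n bd) ler_wpM2l.
have t2 : `|Ex nu psi - Ex nu (fun x => cc (code N x))| <= e.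
  rewrite -ExB//; apply: le_trans he; apply: Ex_norm => //; first exact: bmB.
  by apply: bm_norm; exact: bmB.
have t3 : `|Ex nu psi| <= B' by exact: Ex_norm_le.
set V := Ex nu (fun x => cc (code N (iter n f x)) * chi x) in mc t1.
set W := Ex nu (fun x => cc (code N x)) in mc t2.
set Y := Ex nu (fun x => psi (iter n f x) * chi x) in t1 *.
have -> : Y - Ex nu psi * Ex nu chi = (Y - V) + (V - Lam chi * W) +
   (Lam chi * (W - Ex nu psi) + Ex nu psi * (Lam chi - Ex nu chi)) by ring.
apply: le_trans (ler_normD _ _) _; apply: le_trans (lerD (ler_normD _ _) (ler_normD _ _)) _.
rewrite !normrM (distrC W) (distrC (Lam chi)).
have t4 : `|Lam chi| * `|Ex nu psi - W| <= `|Lam chi| * e by rewrite ler_wpM2l.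
have t5 : `|Ex nu psi| * `|Ex nu chi - Lam chi| <= B' * (Q * D * r ^+ n) by rewrite ler_pM.
have -> : e' = KK * e by rewrite mulrC mulfVK ?gt_eqF.
rewrite /KK; move: (`|Lam chi|) t4 => l t4.
have : 0 <= e by exact: ltW.
move: t1 mc t4 t5 => t1 mc t4 t5 e0'; rewrite mulrDr in mc; lra.
Qed.

End gibbs.

Lemma le0_geometric (R : realType) (a b r : R) :
  0 < r < 1 -> (forall n, a <= b * r ^+ n) -> a <= 0.
Proof.
case/andP=> r0 r1 h.
have lr : b * r ^+ n @[n --> \oo] --> b * 0.
  by apply: cvgMl_tmp; apply: cvg_expr; rewrite gtr0_norm.
rewrite mulr0 in lr; apply: (cvgr_to_ge lr).
by exists 0%N => // n _; exact: h.
Qed.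

(** * Growth exponents and the assembled spectral gap *)

Section spectral_gap.
Context {R : realType} (alpha : {posnum R}).
Local Notation X := (unit_itv R).
Local Notation f := (intermittent_map alpha).
Local Notation br := (br alpha).
Local Notation Lop := (Lop alpha).
Local Notation bs := (bs alpha).
Local Notation Zn := (Zn alpha).
Implicit Types (x y z : X) (w v : seq bool) (n m : nat).

(** p is the infimum of the admissible rates, a set that contains B + ln 2 and is bounded below by -
    B. No bound at the rate p itself is claimed, whence the two one-sided clauses. *)
Lemma growth_exponent_ex (u : X -> R) (B : R) : (forall x, `|u x| <= B) ->
  exists p : R, (forall q, p < q -> grows_le alpha u q) /\
    (forall q, grows_le alpha u q -> p <= q).
Proof.
move=> uB; pose S : set R := [set q | grows_le alpha u q].
have uB1 z : - B <= u z by have := uB z; rewrite ler_norml => /andP[].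
have uB2 z : u z <= B by have := uB z; rewrite ler_norml => /andP[].
have S0 : S (B + ln 2) by exists 1 => n x; rewrite mul1r; exact: Zn_le.
have Slb : lbound S (- B).
  move=> q [C hC]; rewrite -subr_le0.
  apply/ler_addgt0Pr => e e0; rewrite add0r.
  rewrite leNgt; apply/negP => lt.
  pose n := (Num.truncn (ln `|C| / (e / 1))).+1.
  have Cn k : expR (k%:R * - B) <= `|C| * expR (k%:R * q).
    apply: le_trans (Zn_ge alpha k X1 uB1) _; apply: le_trans (hC k X1) _.
    by rewrite ler_wpM2r ?expR_ge0// ler_norm.
  have C0 : 0 < `|C|.
    by have := Cn 0%N; rewrite !mul0r expR0 mulr1 => h; exact: lt_le_trans h.
  have := Cn n; rewrite -{1}(@lnK _ `|C|) ?posrE// -expRD ler_expR => h.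
  have lnn : ln `|C| < n%:R * e.
    by rewrite -ltr_pdivrMr// -[e in X in X < _]divr1; exact: truncnS_gt.
  have n0 : 0 < n%:R :> R by rewrite ltr0n.
  have := ltr_pM2l n0 e (- B - q); rewrite lt => /idP h2.
  by move: h h2; rewrite mulrBr; lra.
exists (inf S); split=> q.
  move=> lt; have [s Ss sq] : exists2 s, S s & s < q.
    by have [|s Ss sq] := @inf_lt _ S q _ lt; [exists (B + ln 2)|exists s].
  case: Ss => C hC; exists `|C| => n x; apply: le_trans (hC n x) _.
  apply: (@le_trans _ _ (`|C| * expR (n%:R * s))).
    by rewrite ler_wpM2r ?expR_ge0// ler_norm.
  by rewrite ler_wpM2l// ler_expR ler_wpM2l// ltW.
by move=> hq; apply: ge_inf => //; exists (- B).
Qed.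

Lemma free_energy_le (u : X -> R) (B p : R) (mu : probability X R) :
  invariant_measure f mu -> ucont u -> (forall x, `|u x| <= B) ->
  (forall q, p < q -> grows_le alpha u q) ->
  (entropy f mu + (Ex mu u)%:E <= p%:E)%E.
Proof.
move=> inv uu uB pP.
apply/lee_addgt0Pr => e e0.
have [|C hC] := pP (p + e); first by rewrite ltrDl.
apply: le_trans (leeD2r _ (entropy_le inv uu uB (hC ^~ X1))) _.
by rewrite -!EFinD lee_fin subrK.
Qed.

(** The last clause transfers Harnack inequalities from Z_n to h: e^(- n p) Z_n is h times the
    normalized operator applied n times to 1/h, and the latter converges to a constant which is at
    least 1. *)
Lemma spectral_gap (g A B p : R) (u : X -> R) :
  0 < g -> g <= 1 -> holder_with g u A -> (forall x, `|u x| <= B) ->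
  (forall q, p < q -> grows_le alpha u q) ->
  (forall q, grows_le alpha u q -> p <= q) ->
  u X0 < p ->
  exists (nu : probability X R) (h : X -> R) (M : seq bool -> R),
  [/\ [/\ invariant_measure f nu, exponentially_mixing alpha nu,
        entropy f nu = (p - Ex nu u)%:E & 0 < p - Ex nu u],
      [/\ forall w, nu (cyl alpha w) = (M w)%:E, forall w, 0 < M w, M [::] = 1,
        forall w, M w = M (rcons w false) + M (rcons w true)
        & forall w, M (false :: w) + M (true :: w) = M w],
      forall x, 0 < h x,
      forall (a : R) w v, (forall x, a <= th alpha u h p w (br v x)) ->
        a * M v <= M (w ++ v)
    & forall x y (K : R), 0 <= K ->
        (forall n, Zn u n x <= K * Zn u n y) -> h x <= K * h y].
Proof.
move=> g0 g1 uA uB pP p_min u0p.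
have [h [K [c [c0 hK h01 hL]]]] := eigenfunction g0 uA uB pP p_min u0p.
have [Q [r [Q0 r01 decay]]] := NL_decay c0 h01 hL g0 uA uB hK pP u0p.
have Mn := M_nil c0 h01 hL.
have M0 := M_gt0 c0 h01 hL g0 uA uB hK Q0 r01 decay.
have Mr := M_rcons c0 h01 hL g0 uA uB hK Q0 r01 decay.
have Mc := M_cons c0 h01 hL g0 uA uB hK Q0 r01 decay.
have [s s01 Ms] := M_exp c0 h01 hL g0 uA uB hK Q0 r01 decay.
have [nu [inv nuM]] := gibbs_measure_ex alpha Mn M0 Mr Mc s01 Ms.
exists nu, h, (M alpha u h p); split.
- split=> //; first exact: (gibbs_mixing c0 h01 hL g0 uA uB hK Q0 r01 decay inv nuM).
    exact: (gibbs_entropy c0 h01 hL g0 uA uB hK Q0 r01 decay inv nuM).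
  exact: (gibbs_entropy_gt0 c0 h01 hL g0 uA uB hK Q0 r01 decay inv nuM).
- by split.
- exact: (eig_gt0 c0 h01).
- exact: (M_ge_cat c0 h01 hL g0 uA uB hK Q0 r01 decay).
move=> x y K' K'0 hZ.
have h0 := eig_gt0 c0 h01.
have hV := holderV hK c0 (fun z => proj1 (andP (h01 z))).
set D := K / c ^+ 2 in hV; pose hi z := (h z)^-1.
have NLh n z : h z * NL alpha u h p n hi z = expR (- (n%:R * p)) * Zn u n z.
  rewrite (NLE alpha u p c0 h01) mulrC divfK ?gt_eqF// /Submission.Zn; congr (_ * _).
  apply: eq_iter_Lop => t; rewrite /hi mulfV// gt_eqF//.
set L := Lam alpha u h p hi.
have L1 : 1 <= L.
  rewrite -(Lam_cst c0 h01 hL 1); apply: (Lam_le c0 h01 hL Q0 r01 decay).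
  - by exists 0; exact: holder_cst.
  - by exists D.
  - by move=> z; rewrite /hi invf_ge1//; case/andP: (h01 z).
have hd n z : `|NL alpha u h p n hi z - L| <= Q * D * r ^+ n.
  exact: (Lam_dist c0 h01 hL Q0 r01 decay).
rewrite -subr_le0; suff : (h x - K' * h y) * L <= 0 by rewrite pmulr_lle0//; lra.
apply: (@le0_geometric _ _ ((h x + K' * h y) * (Q * D)) r r01) => n.
have := hd n x; have := hd n y; rewrite !ler_norml => /andP[y1 y2] /andP[x1 x2].
have : h x * NL alpha u h p n hi x <= K' * (h y * NL alpha u h p n hi y).
  by rewrite !NLh mulrCA ler_wpM2l ?expR_ge0.
have a1 : h x * (L - NL alpha u h p n hi x) <= h x * (Q * D * r ^+ n).
  by rewrite ler_wpM2l ?(ltW (h0 x))//; lra.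
have a2 : K' * h y * (NL alpha u h p n hi y - L) <= K' * h y * (Q * D * r ^+ n).
  by rewrite ler_wpM2l ?mulr_ge0 ?(ltW (h0 y))//; lra.
lra.
Qed.

End spectral_gap.

(** * Distortion *)

Section sublinear.
Context {R : realType}.
Implicit Types (s : nat -> R).

(** A one-sided o(n), by which only upper growth is controlled. *)
Definition sublin s := forall e : R, 0 < e -> exists C : R, forall n, s n <= C + e * n%:R.

Lemma sublinD s1 s2 : sublin s1 -> sublin s2 -> sublin (fun n => s1 n + s2 n).
Proof.
move=> h1 h2 e e0; have e2 : 0 < e / 2 by rewrite divr_gt0.
have [C1 hC1] := h1 _ e2; have [C2 hC2] := h2 _ e2.
by exists (C1 + C2) => n; have := hC1 n; have := hC2 n; lra.
Qed.

Lemma sublinZ (k : R) s : 0 <= k -> sublin s -> sublin (fun n => k * s n).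
Proof.
rewrite le_eqVlt => /orP[/eqP <- _ e e0|k0 h e e0].
  by exists 0 => n; rewrite mul0r add0r mulr_ge0// ltW.
have [C hC] := h (e / k) (divr_gt0 e0 k0); exists (k * C) => n.
have -> : k * C + e * n%:R = k * (C + e / k * n%:R) by field; rewrite gt_eqF.
by rewrite ler_wpM2l// ltW.
Qed.

Lemma sublin_cst (k : R) : sublin (fun=> k).
Proof. by move=> e e0; exists k => n; rewrite lerDl mulr_ge0// ltW. Qed.

Lemma le_sublin s1 s2 : (forall n, s1 n <= s2 n) -> sublin s2 -> sublin s1.
Proof.
move=> h h2 e e0; have [C hC] := h2 e e0.
by exists C => n; exact: le_trans (h n) (hC n).
Qed.

Lemma sublin_sum s : (forall e, 0 < e -> exists n, forall m, (n <= m)%N -> s m <= e) ->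
  sublin (fun n => \sum_(0 <= i < n) s i).
Proof.
move=> h e e0; have [N hN] := h e e0.
exists (\sum_(0 <= i < N) `|s i|); elim=> [|n IH].
  by rewrite big_nil mulr0 addr0 sumr_ge0.
have [nN|Nn] := ltnP n N; last first.
  by rewrite big_nat_recr//= -natr1 mulrDr mulr1 addrA lerD// hN.
apply: (@le_trans _ _ (\sum_(0 <= i < n.+1) `|s i|)).
  by apply: ler_sum => i _; exact: ler_norm.
apply: (@le_trans _ _ (\sum_(0 <= i < N) `|s i|)).
  by rewrite [leRHS](@big_cat_nat _ _ _ n.+1)//= lerDl sumr_ge0.
by rewrite lerDl mulr_ge0// ltW.
Qed.

Lemma sublin_ln : sublin (fun n => ln (n.+1%:R : R)).
Proof.
move=> e e0; exists (1 + e - ln e) => n.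
have : ln (1 + (e * n.+1%:R - 1)) <= e * n.+1%:R - 1.
  by apply: le_ln1Dx; rewrite ltrBDl subrr mulr_gt0.
rewrite subrKC lnM ?posrE// -natr1; lra.
Qed.

Lemma sublin_lt (k : R) s : 0 < k -> sublin s ->
  exists N, forall n, (N <= n)%N -> s n < k * n%:R.
Proof.
move=> k0 h; have k2 : 0 < k / 2 by rewrite divr_gt0.
have [C hC] := h _ k2.
exists (Num.truncn (`|C| / (k / 2))).+1 => n hn; apply: le_lt_trans (hC n) _.
have : `|C| / (k / 2) < n%:R by apply: lt_le_trans (truncnS_gt _) _; rewrite ler_nat.
rewrite ltr_pdivrMr// => h2; have := ler_norm C; lra.
Qed.

End sublinear.

Section distortion.
Context {R : realType} (alpha : {posnum R}).
Local Notation X := (unit_itv R).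
Local Notation a := (alpha%:num).
Local Notation br := (br alpha).
Local Notation tpt := (tpt alpha).
Local Notation bs := (bs alpha).
Local Notation Zn := (Zn alpha).
Local Notation expand := (expand alpha).
Implicit Types (x y z : X) (w v : seq bool) (n m k : nat).

Let a_gt0 : 0 < a. Proof. by []. Qed.

Lemma powRS1 (x : R) : 0 <= x -> x `^ (1 + a) = x * x `^ a.
Proof.
rewrite le_eqVlt => /orP[/eqP <-|x0]; first by rewrite mul0r powR0// gt_eqF ?addr_gt0.
by rewrite powRD ?powRr1 ?(ltW x0)// gt_eqF ?implybT.
Qed.

(** The tangent line of a convex function, obtained without derivatives from Young's inequality for
    y and x^alpha with exponents 1 + alpha and (1 + alpha) / alpha. *)
Lemma expand_tangent (x y : R) : 0 <= x -> 0 <= y ->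
  expand x + (1 + (1 + a) * x `^ a) * (y - x) <= expand y.
Proof.
move=> x0 y0; rewrite /Submission.expand.
have s0 : 0 < 1 + a by rewrite addr_gt0.
have q0 : 0 < (1 + a) / a by rewrite divr_gt0.
have := conjugate_powR y0 (powR_ge0 x a) s0 q0.
have -> : (1 + a)^-1 + ((1 + a) / a)^-1 = 1 by field; rewrite !gt_eqF.
move=> /(_ erefl); rewrite -powRrM mulrC.
have -> : a * ((1 + a) / a) = 1 + a by field; rewrite gt_eqF.
rewrite !powRS1// => h.
have := ler_wpM2l (ltW s0) h.
have -> : (1 + a) * (y * y `^ a / (1 + a) + x * x `^ a / ((1 + a) / a)) =
  y * y `^ a + a * (x * x `^ a) by field; rewrite !gt_eqF.
lra.
Qed.

Lemma expand_convex (A B C D : R) : 0 <= A -> A <= B -> B <= C -> C <= D ->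
  (expand B - expand A) * (D - C) <= (expand D - expand C) * (B - A).
Proof.
move=> A0 AB BC CD; have B0 := le_trans A0 AB; have C0 := le_trans B0 BC.
have t1 := expand_tangent B0 A0.
have t2 := expand_tangent C0 (le_trans C0 CD).
have h : B `^ a <= C `^ a by rewrite ge0_ler_powR ?nnegrE.
set p := B `^ a in t1 h; set q := C `^ a in t2 h.
apply: (@le_trans _ _ ((1 + (1 + a) * p) * (B - A) * (D - C))).
  by rewrite ler_wpM2r ?subr_ge0//; lra.
apply: (@le_trans _ _ ((1 + (1 + a) * q) * (D - C) * (B - A))).
  rewrite mulrAC ler_wpM2r ?subr_ge0// ler_wpM2r ?subr_ge0//.
  by rewrite lerD2l ler_wpM2l// addr_ge0.
by rewrite ler_wpM2r ?subr_ge0//; lra.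
Qed.

Let g0 k : X -> X := br (nseq k false).

(** Slopes of the iterated left branch decrease to the right, by induction from the convexity of
    [expand]. Cross-multiplication allows z = z'. *)
Lemma left_branches_concave k x y z z' :
  pt x < pt y -> pt y <= pt z -> pt z <= pt z' ->
  (pt (g0 k z') - pt (g0 k z)) * (pt y - pt x) <=
  (pt (g0 k y) - pt (g0 k x)) * (pt z' - pt z).
Proof.
move=> xy yz zz; elim: k => [|k IH]; first by rewrite mulrC.
have xy' : pt (g0 k x) < pt (g0 k y) by rewrite br_lt.
have yz' : pt (g0 k y) <= pt (g0 k z) by rewrite br_le.
have zz' : pt (g0 k z) <= pt (g0 k z') by rewrite br_le.
have := @expand_convex (pt (g0 k.+1 x)) (pt (g0 k.+1 y)) (pt (g0 k.+1 z)) (pt (g0 k.+1 z')) (pt_ge0 _).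
rewrite !br_le (ltW xy) yz zz => /(_ isT isT isT).
rewrite /= !branchE !addr0 -!/(g0 _ _) => h.
set p := pt (branch _ _ (g0 k z')) - _ in h *.
set q := pt (branch _ _ (g0 k y)) - _ in h *.
have q0 : 0 <= q by rewrite subr_ge0 branch_le ltW.
have d0 : 0 < pt (g0 k y) - pt (g0 k x) by rewrite subr_gt0.
rewrite -(ler_pM2l d0).
apply: (@le_trans _ _ (q * (pt (g0 k z') - pt (g0 k z)) * (pt y - pt x))).
  by rewrite mulrA ler_wpM2r ?subr_ge0 ?(ltW xy)// mulrC; lra.
rewrite -mulrA; apply: (@le_trans _ _ (q * ((pt (g0 k y) - pt (g0 k x)) * (pt z' - pt z)))).
  by rewrite ler_wpM2l.
by rewrite mulrCA.
Qed.

Definition gap k : R := pt (tpt k) - pt (tpt k.+1).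

Lemma gap_gt0 k : 0 < gap k. Proof. by rewrite subr_gt0 tpt_lt. Qed.

Lemma gap_le k : gap k.+1 <= gap k.
Proof.
rewrite /gap !tptB; have h : pt (tpt k.+2) <= pt (tpt k.+1) by exact/ltW/tpt_lt.
by rewrite ler_pM ?pt_ge0 ?powR_ge0// ge0_ler_powR ?nnegrE ?pt_ge0.
Qed.

(** By concavity, slopes over [t_1,1] are at most the slope over the reference interval [t_2,t_1],
    whose image has length [gap k.+1] <= [gap k]. *)
Lemma left_branches_dist k z z' : pt (tpt 1) <= pt z -> pt (tpt 1) <= pt z' ->
  `|pt (g0 k z) - pt (g0 k z')| <= gap k / gap 1 * `|pt z - pt z'|.
Proof.
wlog h : z z' / pt z' <= pt z.
  move=> H hz hz'; have [le|/ltW le] := leP (pt z') (pt z); first exact: H.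
  by rewrite distrC (distrC (pt z)); exact: H.
move=> hz hz'; rewrite !ger0_norm ?subr_ge0 ?br_le// mulrAC ler_pdivlMr ?gap_gt0//.
apply: le_trans (left_branches_concave k (tpt_lt alpha 1) hz' h) _.
rewrite ler_wpM2r ?subr_ge0//; apply: le_trans (gap_le k).
rewrite /gap /g0; have E m : br (nseq k false) (tpt m) = tpt (k + m).
  by elim: (k) => //= j ->.
by rewrite !E addn1 addn2.
Qed.

Variables (g : R) (u : X -> R) (A T : R) (tau : nat -> R).
Hypotheses (g_gt0 : 0 < g) (A0 : 0 <= A).
Hypothesis uJ : forall x y, pt (tpt 1) <= pt x -> pt (tpt 1) <= pt y ->
  `|u x - u y| <= A * `|pt x - pt y| `^ g.
Hypothesis utau : forall k x y, pt (tpt 1) <= pt x -> pt (tpt 1) <= pt y ->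
  `|u (g0 k.+1 x) - u (g0 k.+1 y)| <= tau k * `|pt x - pt y| `^ g.
Hypothesis tauT : forall k, \sum_(0 <= i < k) tau i <= T.

Let rho := rateg alpha g.
Let D := (T + A) / (1 - rho).

Let T0 : 0 <= T. Proof. by have := tauT 0; rewrite big_nil. Qed.

Let rho1 : 0 < 1 - rho. Proof. by rewrite subr_gt0 rateg_lt1. Qed.

Let TD : T <= D.
Proof.
rewrite ler_pdivlMr//; have := rateg_gt0 alpha g; rewrite -/rho => r0.
apply: (@le_trans _ _ T); last by rewrite lerDl.
by rewrite ler_piMr// gerBl ltW.
Qed.

(* With d the distance between the two orbits at their last common passage
   through [t_1,1], each return multiplies d^g by rho < 1, so the
   telescoping term D (d0^g - d^g) pays for the distortion between returns. *)
Let distortion_inv w x y : pt (tpt 1) <= pt x -> pt (tpt 1) <= pt y ->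
  exists k z z', [/\ br w x = g0 k z, br w y = g0 k z',
    pt (tpt 1) <= pt z, pt (tpt 1) <= pt z' &
    `|pt z - pt z'| `^ g <= `|pt x - pt y| `^ g /\
    `|bs u w x - bs u w y| <= D * (`|pt x - pt y| `^ g - `|pt z - pt z'| `^ g) +
       `|pt z - pt z'| `^ g * \sum_(0 <= i < k) tau i].
Proof.
move=> hx hy; elim: w => [|b w [k [z [z' [Ez Ez' hz hz' [dd le]]]]]].
  exists 0%N, x, y; split=> //; split=> //.
  by rewrite big_nil !subrr normr0 !mulr0 addr0.
set d := `|pt z - pt z'| `^ g in dd le; set d0 := `|pt x - pt y| `^ g in dd le.
have d_ge0 : 0 <= d by exact: powR_ge0.
case: b; last first.
  exists k.+1, z, z'; split=> //; [by rewrite /= Ez|by rewrite /= Ez'|split=> //].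
  rewrite /= Ez Ez' opprD addrACA; apply: le_trans (ler_normD _ _) _.
  rewrite big_nat_recr// [X in _ <= _ + X]mulrDr addrA [leLHS]addrC lerD//.
  by rewrite mulrC; exact: utau.
pose z1 := br (true :: w) x; pose z2 := br (true :: w) y.
have h1 : pt (tpt 1) <= pt z1 by exact: branch_true_ge.
have h2 : pt (tpt 1) <= pt z2 by exact: branch_true_ge.
exists 0%N, z1, z2; split=> //.
set d1 := `|pt z1 - pt z2| `^ g.
have d1d : d1 <= rho * d.
  rewrite /d1 /z1 /z2 /= Ez Ez'.
  have := br_distg alpha g_gt0 (true :: nseq k false) z z'.
  by rewrite /ones /= count_nseq mul0n addn0 expr1.
have rd : rho * d <= d by rewrite ler_piMl// ltW// rateg_lt1.
split; first exact: le_trans d1d (le_trans rd dd).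
rewrite big_nil mulr0 addr0 /= opprD addrACA.
apply: le_trans (ler_normD _ _) _; apply: le_trans (lerD (uJ h1 h2) le) _.
rewrite -/d1.
have s1 : d * \sum_(0 <= i < k) tau i <= d * T by rewrite ler_wpM2l.
have s2 : A * d1 <= A * d by rewrite ler_wpM2l// (le_trans d1d).
have D0 : 0 <= D by exact: le_trans TD.
have s3 : D * d1 <= D * (rho * d) by rewrite ler_wpM2l.
have s4 : D * (1 - rho) = T + A by rewrite /D divfK// gt_eqF.
have s5 : D * d - D * (rho * d) = d * (T + A) by rewrite -s4; ring.
move: s1 s2 s3 s5; rewrite -/d0; clearbody d d0 d1; lra.
Qed.

Lemma bs_distortion w x y : pt (tpt 1) <= pt x -> pt (tpt 1) <= pt y ->
  `|bs u w x - bs u w y| <= D.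
Proof.
move=> hx hy; have [k [z [z' [_ _ _ _ [dd le]]]]] := distortion_inv w hx hy.
apply: le_trans le _.
have h0 : 0 <= `|pt z - pt z'| `^ g by exact: powR_ge0.
have h1 : `|pt x - pt y| `^ g <= 1 by exact: dist_powR_le1.
have h2 := tauT k; have D0 := le_trans T0 TD.
have : `|pt z - pt z'| `^ g * \sum_(0 <= i < k) tau i <= `|pt z - pt z'| `^ g * D.
  by rewrite ler_wpM2l// (le_trans h2).
have : D * `|pt x - pt y| `^ g <= D by rewrite ler_piMr.
lra.
Qed.

Lemma Zn_harnack n x y : pt (tpt 1) <= pt x -> pt (tpt 1) <= pt y ->
  Zn u n x <= expR D * Zn u n y.
Proof.
move=> hx hy; rewrite !ZnE mulr_sumr; apply: ler_sum => w _.
rewrite -expRD ler_expR; have := bs_distortion w hx hy.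
by rewrite ler_norml => /andP[_]; lra.
Qed.

End distortion.

(** * Mixing and domination by the fixed point *)

Lemma sublin_shift (R : realType) (s : nat -> R) : sublin s -> sublin (fun n => s n.+1).
Proof.
move=> h e e0; have [C hC] := h e e0; exists (C + e) => n.
by apply: le_trans (hC n.+1) _; rewrite -natr1; lra.
Qed.

Section ramp.
Context {R : realType} (alpha : {posnum R}).
Local Notation X := (unit_itv R).
Local Notation f := (intermittent_map alpha).
Local Notation a := (alpha%:num).
Local Notation tpt := (tpt alpha).
Local Notation gap := (gap alpha).
Local Notation code := (code alpha).
Implicit Types (x y z : X) (w v : seq bool) (n m k l : nat).

Lemma clip_dist (s t : R) :
  `|Num.min 1 (Num.max 0 s) - Num.min 1 (Num.max 0 t)| <= `|s - t|.
Proof.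
rewrite /Num.min /Num.max.
have n1 := ler_norm (s - t); have n2 := ler_norm (t - s); rewrite distrC in n2.
case: (ltP 0 s) => ?; case: (ltP 0 t) => ?;
by repeat match goal with |- context [if ?p < ?q then _ else _] => case: (ltP p q) => ? end;
  rewrite ler_norml; apply/andP; split; lra.
Qed.

(** A Lipschitz substitute for the indicator of [0,t_l], squeezed between the indicators for l + 1
    and l. Mixing is only tested on Lipschitz functions, and the lowered potential must remain
    Hoelder. *)
Definition ramp l x : R := Num.min 1 (Num.max 0 ((pt (tpt l) - pt x) / gap l)).

Lemma ramp01 l x : 0 <= ramp l x <= 1.
Proof. by rewrite /ramp le_min ler01 le_max lexx /= ge_min lexx. Qed.

Lemma ramp_eq1 l x : pt x <= pt (tpt l.+1) -> ramp l x = 1.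
Proof.
move=> h; rewrite /ramp; apply/min_idPl; rewrite le_max; apply/orP; right.
by rewrite ler_pdivlMr ?gap_gt0// mul1r /Submission.gap; lra.
Qed.

Lemma ramp_eq0 l x : pt (tpt l) <= pt x -> ramp l x = 0.
Proof.
move=> h; rewrite /ramp (_ : Num.max _ _ = 0); first by apply/min_idPr.
by apply/max_idPl; rewrite pmulr_lle0 ?invr_gt0 ?gap_gt0// subr_le0.
Qed.

Lemma ramp_dist l x y : `|ramp l x - ramp l y| <= (gap l)^-1 * `|pt x - pt y|.
Proof.
apply: le_trans (clip_dist _ _) _.
rewrite -mulrBl normrM normfV (gtr0_norm (gap_gt0 _ _)) mulrC ler_wpM2l//.
  by rewrite invr_ge0 ltW// gap_gt0.
rewrite distrC le_eqVlt; apply/orP; left; apply/eqP; congr (`|_|); ring.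
Qed.

Lemma ramp_holder l : holder_with 1 (ramp l) (gap l)^-1.
Proof. by move=> x y; rewrite powRr1//; exact: ramp_dist. Qed.

Lemma code_nseq l x : code l x = nseq l false <-> pt x <= pt (tpt l).
Proof.
split=> [E|].
  by rewrite -[x](br_code alpha l) E -br_nseq br_le pt_le1.
elim: l x => // l IH x h.
have dx : digit alpha x = false.
  have : expand alpha (pt x) <= expand alpha (pt (tpt 1)).
    by rewrite expand_leP ?pt_ge0//; apply: le_trans h (tpt_le _ _).
  by rewrite /digit [tpt 1]tptS branchE addr0 => h1; apply/negbTE; rewrite -leNgt.
rewrite /= dx IH//; move: h; rewrite -{1}(branch_map alpha x) dx tptS branch_le.
exact.
Qed.

Lemma cyl_nseq l : cyl alpha (nseq l false) = [set x | pt x <= pt (tpt l)].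
Proof.
by apply/seteqP; split => x; rewrite /cyl /= size_nseq => /code_nseq.
Qed.

Lemma digit_ramp n x : digit alpha (iter n f x) -> ramp n.+1 x = 0.
Proof.
move=> dg; apply: ramp_eq0; rewrite leNgt; apply/negP => /ltW/code_nseq.
rewrite code_mkseq => /(congr1 (nth false ^~ n)).
by rewrite (nth_map 0%N) ?size_iota// nth_iota// add0n dg nth_nseq ltnSn.
Qed.

Lemma tpt_powR_small (g e : R) : 0 < g -> 0 < e ->
  exists n, forall m, (n <= m)%N -> pt (tpt m) `^ g <= e.
Proof.
move=> g0 e0; have [n hn] := tpt_small alpha (powR_gt0 g^-1 e0).
exists n => m /hn h; apply: (@le_trans _ _ ((e `^ g^-1) `^ g)).
  by rewrite ge0_ler_powR ?nnegrE ?pt_ge0 ?powR_ge0// ltW.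
by rewrite -powRrM mulVf ?gt_eqF// powRr1// ltW.
Qed.

(** The ratio of t_n to t_(n+1) is 1 + t_(n+1)^alpha, which tends to 1. Here the neutrality of the
    fixed point enters the comparison with mixing. *)
Lemma sublin_ln_tpt : sublin (fun n => - ln (pt (tpt n))).
Proof.
apply: (@le_sublin _ _ (fun n => \sum_(0 <= i < n) pt (tpt i.+1) `^ a)).
  elim=> [|n IH]; first by rewrite big_nil /= /pt /= ln1 oppr0.
  rewrite big_nat_recr//.
  have E : pt (tpt n) = pt (tpt n.+1) * (1 + pt (tpt n.+1) `^ a).
    by have := tptB alpha n; lra.
  have : ln (1 + pt (tpt n.+1) `^ a) <= pt (tpt n.+1) `^ a.
    by apply: le_ln1Dx; apply: lt_le_trans (powR_ge0 _ _); rewrite ltrN10.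
  have : ln (pt (tpt n)) = ln (pt (tpt n.+1)) + ln (1 + pt (tpt n.+1) `^ a).
    by rewrite {1}E lnM ?posrE ?tpt_gt0 ?ltr_wpDr ?powR_ge0.
  move: IH => /=; lra.
apply: sublin_sum => e e0; have a0 : 0 < a by [].
have [n hn] := tpt_powR_small a0 e0.
by exists n => m nm; apply: hn; apply: leq_trans nm _.
Qed.

Lemma ln_gap n : - ln (gap n) = (1 + a) * - ln (pt (tpt n.+1)).
Proof.
rewrite /Submission.gap tptB lnM ?posrE ?powR_gt0 ?tpt_gt0// ln_powR; ring.
Qed.

End ramp.

Section entropy_atom.
Context {R : realType} (alpha : {posnum R}).
Local Notation X := (unit_itv R).
Local Notation f := (intermittent_map alpha).
Local Notation tpt := (tpt alpha).
Implicit Types (x y z : X) (n m k l : nat) (mu : probability X R).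

Lemma measurable_X0 : measurable [set X0 : X].
Proof.
rewrite (_ : [set X0] = (@pt R) @^-1` [set 0]).
  by rewrite -[X in measurable X]setTI; exact: measurable_pt.
by apply/seteqP; split => x /= => [-> //|E]; exact/pt_inj.
Qed.

Lemma iter_map_X0 n : iter n f X0 = X0.
Proof. exact: iter_map0. Qed.

Lemma entropy_atom mu : mu [set X0] = 1%E -> entropy f mu = 0%E.
Proof.
move=> m1.
have H k (P : 'I_k -> set X) : measurable_partition P -> partition_entropy mu f P = 0.
  move=> mP; rewrite /partition_entropy.
  have E n : join_entropy mu f P n / n%:R = 0.
    rewrite (join_entropyE alpha mu mP) big1 ?mul0r// => v _.
    have mE : measurable (itin alpha mP n @^-1` [set v]) by exact: mdisc_itin.
    have [E|N] := eqVneq (itin alpha mP n X0) v.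
      suff -> : mu (itin alpha mP n @^-1` [set v]) = 1%E by rewrite /= ln1 mulr0 oppr0.
      apply/eqP; rewrite eq_le probability_le1//= -m1.
      by apply: le_measure; rewrite ?inE//; [exact: measurable_X0|move=> x /= ->].
    suff -> : mu (itin alpha mP n @^-1` [set v]) = 0%E by rewrite /= mul0r oppr0.
    have : mu (~` [set X0 : X]) = 0%E.
      by rewrite probability_setC ?m1 ?subee//; exact: measurable_X0.
    move=> m0; apply/eqP; rewrite eq_le measure_ge0 andbT -m0.
    apply: le_measure; rewrite ?inE//; first by apply: measurableC; exact: measurable_X0.
    by move=> x /= E' xX0; move: N; rewrite -E' xX0 eqxx.
  under eq_fun do rewrite E.
  exact: lim_cst.
apply/eqP; rewrite eq_le; apply/andP; split.
  by apply: ge_ereal_sup => _ [k [P [mP ->]]]; rewrite H.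
apply: ereal_sup_ubound; exists 1%N, (fun=> setT).
have mT : @measurable_partition _ X 1 (fun=> setT).
  split=> //; last by apply/seteqP; split => // x _; exists ord0.
  by apply/trivIsetP => i j _ _; rewrite (ord1 i) (ord1 j) eqxx.
by rewrite H.
Qed.

(** Every point except 0 enters (t_1,1] at some time. If that set is null, so are all its preimages
    by invariance, and mu is carried by 0. *)
Lemma entropy_digit mu : invariant_measure f mu ->
  mu (cyl alpha [:: true]) = 0%E -> entropy f mu = 0%E.
Proof.
move=> inv m0; apply: entropy_atom.
pose E i : set X := iter i f @^-1` (cyl alpha [:: true]).
have mE i : measurable (E i).
  have := measurable_iter alpha i measurableT (measurable_cyl alpha [:: true]).
  by rewrite setTI.
have E0 i : mu (E i) = 0%E.
  elim: i => // i IH; rewrite -IH -(inv _ (mE i)).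
  by rewrite /pushforward; congr (mu _); apply/seteqP; split => x; rewrite /E /= -iterSr.
have cov : ~` [set X0 : X] `<=` \bigcup_i E i.
  move=> x /= xX0; apply: contrapT => nE.
  have dx i : digit alpha (iter i f x) = false.
    apply/negbTE/negP => d; apply: nE; exists i => //.
    by rewrite /E /cyl /= d.
  apply: xX0; apply/pt_inj/eqP; rewrite eq_le pt_ge0 andbT /=.
  apply/ler_addgt0Pr => e e0; have [n hn] := tpt_small alpha e0.
  rewrite [pt (X0)]/(0 : R) add0r; apply: le_trans (hn n (leqnn _)).
  apply/code_nseq; rewrite code_mkseq.
  have -> : nseq n false = [seq false | i <- iota 0 n].
    by elim: (n) (0%N) => //= k IH j; rewrite -IH.
  by apply: eq_map => i; exact: dx.
have mu0 : mu (~` [set X0 : X]) = 0%E.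
  apply/eqP; rewrite eq_le measure_ge0 andbT.
  have mX := measurable_X0.
  apply: (@le_trans _ _ (\sum_(i <oo) mu (E i))%E).
    by apply: measure_sigma_subadditive => //; exact: measurableC.
  by rewrite eseries0.
have := probability_setC mu measurable_X0.
rewrite mu0 => h; have : (mu [set X0 : X] + (1 - mu [set X0 : X]) = mu [set X0 : X] + 0)%E by rewrite -h.
rewrite adde0 => <-; rewrite addeC subeK// fin_num_measure//; exact: measurable_X0.
Qed.

End entropy_atom.

Section mixing_decay.
Context {R : realType} (alpha : {posnum R}).
Local Notation X := (unit_itv R).
Local Notation f := (intermittent_map alpha).
Local Notation a := (alpha%:num).
Local Notation tpt := (tpt alpha).
Local Notation gap := (gap alpha).
Local Notation code := (code alpha).
Local Notation ramp := (ramp alpha).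
Implicit Types (x y z : X) (w v : seq bool) (n m k l : nat).

Lemma bm_ramp l : bm (ramp l).
Proof. exact: (ucont_bm alpha (holder_ucont ltr01 (ramp_holder alpha l))). Qed.

Lemma indic_cyl_nseq l x : \1_(cyl alpha (nseq l false)) x =
  ((pt x <= pt (tpt l))%R : bool)%:R :> R.
Proof.
rewrite indicE cyl_nseq; congr (_%:R).
by case: (boolP (_ <= _)) => h; [rewrite mem_set|rewrite memNset//; exact/negP].
Qed.

Lemma ramp_ge_indic l x : \1_(cyl alpha (nseq l.+1 false)) x <= ramp l x.
Proof.
rewrite indic_cyl_nseq; case: (boolP (pt x <= _)) => [h|_].
  by rewrite (ramp_eq1 h).
by case/andP: (ramp01 alpha l x).
Qed.

Lemma ramp_le_indic l x : ramp l x <= \1_(cyl alpha (nseq l false)) x.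
Proof.
rewrite indic_cyl_nseq; case: (boolP (pt x <= _)) => [_|].
  by case/andP: (ramp01 alpha l x).
by rewrite -ltNge => /ltW h; rewrite (ramp_eq0 h).
Qed.

(* Starting in [0, t_(n+1)] an orbit cannot be in (t_1, 1] at time n. *)
Lemma mixing_decay (nu : probability X R) : invariant_measure f nu ->
  exponentially_mixing alpha nu -> (0 < entropy f nu)%E ->
  exists (kappa : R) (s : nat -> R), [/\ 0 < kappa, sublin s &
    forall n, fine (nu (cyl alpha (nseq n.+2 false))) <= expR (s n - kappa * n%:R)].
Proof.
move=> inv [C [r [C0 /andP[r0 r1] mix]]] ent.
pose J := cyl alpha [:: true].
have mJ : measurable J by exact: measurable_cyl.
pose q := fine (nu J).
have q0 : 0 < q.
  rewrite lt_def fine_ge0// andbT; apply/eqP => qE.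
  have nJ : nu J = 0%E by rewrite -[LHS]fineK ?fin_num_measure// -/q qE.
  by move: ent; rewrite (entropy_digit inv nJ) ltxx.
pose psi : X -> R := \1_J.
have bpsi : bm psi by exact: bm_indic.
have psi01 x : 0 <= psi x <= 1 by rewrite /psi indicE; case: (x \in J); rewrite /= ?ler01 lexx.
have ps1 : sup_norm psi <= 1.
  by apply: sup_norm_le => x; case/andP: (psi01 x) => h1 h2; rewrite ger0_norm.
have ps0 : 0 <= sup_norm psi.
  apply: le_trans (normr_ge0 (psi X0)) _; apply: ub_le_sup; last by exists X0.
  by exists 1 => _ [x _ <-]; case/andP: (psi01 x) => h1 h2; rewrite ger0_norm.
(* The rate is that of mixing. The Lipschitz constant 1 / [gap n.+1] of the ramp costs only a
   sublinear term in the exponent. *)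
exists (- ln r), (fun n => ln (C / q) + (1 + a) * - ln (pt (tpt n.+2))); split.
- by rewrite oppr_gt0 ln_lt0// r0.
- apply: sublinD; first exact: sublin_cst.
  apply: sublinZ; first by rewrite addr_ge0.
  exact: (sublin_shift (sublin_shift (sublin_ln_tpt alpha))).
move=> n; set B := fine _.
have hr : is_holder 1 (ramp n.+1) by eexists; exact: ramp_holder.
have Z : Ex nu (fun x => psi (iter n f x) * ramp n.+1 x) = 0.
  rewrite -[RHS](Ex_cst nu 0); congr Ex; apply/funext => x.
  rewrite /psi indicE; case: (boolP (_ \in J)) => [|_]; last by rewrite mul0r.
  rewrite inE /J /cyl /= => -[d].
  by rewrite digit_ramp ?mulr0.
have bd : bounded_fun psi.
  exists 1; split; first exact: num_real.
  move=> M M1 x _ /=; case/andP: (psi01 x) => h1 h2; rewrite ger0_norm//.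
  exact: le_trans h2 (ltW M1).
have := mix psi (ramp n.+1) n bd bpsi.1 hr.
rewrite -!/(Ex _ _) -/(Ex nu (ramp _)) Z sub0r normrN Ex_indic// -/q => h.
have b1 : B <= Ex nu (ramp n.+1).
  rewrite /B -Ex_indic; last exact: measurable_cyl.
  apply: Ex_le; [by apply: bm_indic; exact: measurable_cyl|exact: bm_ramp|].
  by move=> x; exact: ramp_ge_indic.
have B0 : 0 <= B by rewrite fine_ge0.
have h2 : q * B <= C / gap n.+1 * r ^+ n.
  apply: (@le_trans _ _ `|q * Ex nu (ramp n.+1)|).
    by rewrite ger0_norm ?ler_wpM2l ?mulr_ge0 ?(ltW q0)// (le_trans B0).
  apply: le_trans h _; rewrite ler_wpM2r ?exprn_ge0 ?(ltW r0)//.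
  rewrite -mulrA ler_wpM2l ?(ltW C0)// -[leRHS]mul1r ler_pM//.
    by apply: holder_seminorm_ge0 => //; exact: oner_neq0.
  by apply: holder_seminorm_le; exact: ramp_holder.
have -> : expR (ln (C / q) + (1 + a) * - ln (pt (tpt n.+2)) - - ln r * n%:R) =
    C / q / gap n.+1 * r ^+ n.
  rewrite -ln_gap !expRD lnK ?posrE ?divr_gt0//; congr (_ * _ * _).
    by rewrite expRN lnK// posrE gap_gt0.
  by rewrite mulNr opprK mulrC mulr_natl -lnXn// lnK// posrE exprn_gt0.
rewrite -(ler_pM2l q0); apply: le_trans h2 _.
rewrite le_eqVlt; apply/orP; left; apply/eqP; field.
by rewrite !gt_eqF ?gap_gt0.
Qed.

End mixing_decay.

Section sums.
Context {R : realType}.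
Implicit Types (s : nat -> R) (k m n : nat).

Lemma sum_pulse_le s (E : R) m k : (forall i, 0 <= s i) -> 0 <= E ->
  \sum_(0 <= i < k) (if (i < m)%N then s i else if i == m then s i + E else 0) <=
  \sum_(0 <= i < m.+1) s i + E.
Proof.
move=> s0 E0; pose F i := if (i < m)%N then s i else if i == m then s i + E else 0.
have F0 i : 0 <= F i by rewrite /F; do 2![case: ifP => // _]; rewrite addr_ge0.
apply: (@le_trans _ _ (\sum_(0 <= i < m.+1 + k) F i)).
  rewrite [leRHS](@big_cat_nat _ _ _ k)//= ?leq_addl// lerDl sumr_ge0//.
rewrite (@big_cat_nat _ _ _ m.+1)//= ?leq_addr//.
rewrite [X in _ + X](_ : _ = 0) ?addr0; last first.
  rewrite big_nat_cond big1// => i; rewrite andbT => /andP[mi _].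
  by rewrite /F ltnNge (ltnW mi)/= gtn_eqF.
rewrite !big_nat_recr//= /F ltnn eqxx -addrA lerD2r.
rewrite le_eqVlt; apply/orP; left; apply/eqP.
by apply: eq_big_nat => i /andP[_ ->].
Qed.

End sums.

Lemma gap_ge0 (R : realType) (alpha : {posnum R}) k : 0 <= gap alpha k.
Proof. exact/ltW/gap_gt0. Qed.

(** * The potential lowered near the fixed point *)

Section level.
Context {R : realType} (alpha : {posnum R}).
Local Notation X := (unit_itv R).
Local Notation f := (intermittent_map alpha).
Local Notation tpt := (tpt alpha).
Local Notation gap := (gap alpha).
Local Notation ramp := (ramp alpha).
Local Notation br := (br alpha).
Local Notation bs := (bs alpha).
Implicit Types (x y z : X) (w v : seq bool) (n m k l : nat).

Variables (g A B : R) (phi : X -> R).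
Hypotheses (g_gt0 : 0 < g) (g_le1 : g <= 1) (phiA : holder_with g phi A).
Hypotheses (phi0 : phi X0 = 0) (B1 : 1 <= B) (phiB : forall x, `|phi x| <= B).

Definition run_var k : R := A * (gap k.+1 / gap 1) `^ g.

Definition run_distortion m : R :=
  (\sum_(0 <= i < m.+1) run_var i + (B + 1) / gap 1 + A) / (1 - rateg alpha g).

(** Controls the weight of an excursion 1 0^(m+2): the distortion, the drop of phi along the m
    letters where u = phi, and the three remaining letters at the crude bound 2 B + 1. *)
Definition run_cost m : R := run_distortion m +
  (\sum_(0 <= i < m) A * pt (tpt i.+1) `^ g + 3 * (2 * B + 1)).

Lemma sublin_run_cost : sublin run_cost.
Proof.
have A0 := holder_ge0 phiA.
apply: sublinD.
  apply: (@le_sublin _ _ (fun n => (1 - rateg alpha g)^-1 *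
      (\sum_(0 <= i < n.+1) run_var i + ((B + 1) / gap 1 + A)))).
    by move=> n; rewrite /run_distortion mulrC addrA.
  apply: sublinZ; first by rewrite invr_ge0 subr_ge0 ltW// rateg_lt1.
  apply: sublinD; last exact: sublin_cst.
  apply: (sublin_shift (s := fun n => \sum_(0 <= i < n) run_var i)).
  apply: sublin_sum => e e0; rewrite /run_var.
  have A1 : 0 < A + 1 by lra.
  have gg : 0 < gap 1 `^ g by rewrite powR_gt0 ?gap_gt0.
  have [n hn] := tpt_powR_small alpha g_gt0 (mulr_gt0 (divr_gt0 e0 A1) gg).
  exists n => m /hn h.
  have h1 : (gap m.+1 / gap 1) `^ g <= e / (A + 1).
    have g10 := gap_gt0 alpha 1; have gm0 := gap_gt0 alpha m.+1.
    rewrite -(ler_pM2r gg) -powRM ?divr_ge0 ?(ltW g10) ?(ltW gm0)//.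
    rewrite divfK ?gt_eqF//; apply: le_trans h.
    rewrite ge0_ler_powR ?nnegrE ?pt_ge0 ?gap_ge0 ?(ltW g_gt0)//.
    apply: (@le_trans _ _ (pt (tpt m.+1))); last exact/ltW/tpt_lt.
    by rewrite /Submission.gap gerBl pt_ge0.
  apply: (@le_trans _ _ ((A + 1) * (e / (A + 1)))); last by rewrite mulrC divfK// gt_eqF.
  by rewrite ler_pM ?powR_ge0//; lra.
apply: sublinD; last exact: sublin_cst.
apply: sublin_sum => e e0; have A1 : 0 < A + 1 by lra.
have [n hn] := tpt_powR_small alpha g_gt0 (divr_gt0 e0 A1).
exists n => m nm.
apply: (@le_trans _ _ ((A + 1) * (e / (A + 1)))); last by rewrite mulrC divfK// gt_eqF.
by rewrite ler_pM ?powR_ge0//; [lra|apply: hn; exact: leq_trans nm _].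
Qed.

Hypothesis dom : forall mu : probability X R, invariant_measure f mu ->
  (entropy f mu + (Ex mu phi)%:E <= 0)%E.
Variables (nu : probability X R) (m : nat).
Hypotheses (nu_inv : invariant_measure f nu).
Hypothesis nu_gibbs : (0 <= entropy f nu + (Ex nu phi)%:E)%E.
Local Notation l := m.+1.
Hypothesis phi_near : forall x, pt x <= pt (tpt l) -> - 2^-1 <= phi x.
Let b := fine (nu (cyl alpha (nseq l false))).
Hypothesis b_small : (B + 1) * b < 1.

(* phi lowered to -1 near 0, so that its growth exponent exceeds its value at 0. *)
Let u x := phi x - ramp l x * (phi x + 1).

Let B10 : 0 <= B + 1. Proof. by apply: (@le_trans _ _ B); [exact: le_trans B1|rewrite lerDl]. Qed.

Let A0 : 0 <= A. Proof. exact: holder_ge0 phiA. Qed.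

Let phib x : - B <= phi x <= B. Proof. by rewrite -ler_norml. Qed.

Let uB x : `|u x| <= 2 * B + 1.
Proof.
case/andP: (ramp01 alpha l x) => r0 r1.
apply: le_trans (ler_normB _ _) _; rewrite normrM (ger0_norm r0).
have : ramp l x * `|phi x + 1| <= 1 * (B + 1).
  by rewrite ler_pM//; apply: le_trans (ler_normD _ _) _; rewrite normr1 lerD2r.
by have := phiB x; lra.
Qed.

Let u_diff x y : `|u x - u y| <= `|phi x - phi y| + `|ramp l x - ramp l y| * (B + 1).
Proof.
case/andP: (ramp01 alpha l x) => r0 r1.
have -> : u x - u y = (1 - ramp l x) * (phi x - phi y) - (ramp l x - ramp l y) * (phi y + 1).
  by rewrite /u; ring.
apply: le_trans (ler_normB _ _) _; rewrite !normrM lerD//.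
  by rewrite ger0_norm ?subr_ge0// ler_piMl// gerBl.
by rewrite ler_wpM2l//; apply: le_trans (ler_normD _ _) _; rewrite normr1 lerD2r.
Qed.

Let uA : holder_with g u (A + (gap l)^-1 * (B + 1)).
Proof.
move=> x y; apply: le_trans (u_diff x y) _; rewrite mulrDl lerD//.
have := holder_lip g_gt0 g_le1 (ramp_holder alpha l) x y => h.
by rewrite mulrAC ler_wpM2r ?B10.
Qed.

Let u0 : u X0 = -1.
Proof. by rewrite /u phi0 ramp_eq1 ?pt_ge0//; ring. Qed.

Let u_phi x : pt (tpt l) <= pt x -> u x = phi x.
Proof. by move=> h; rewrite /u ramp_eq0// mul0r subr0. Qed.

Let run_itv k z : pt (tpt 1) <= pt z ->
  pt (tpt k.+1) <= pt (br (nseq k false) z) <= pt (tpt k).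
Proof.
move=> hz; have E j : br (nseq k false) (tpt j) = tpt (k + j).
  by elim: (k) => //= i ->.
have := br_le alpha (nseq k false) (tpt 1) z; rewrite E addn1 hz => ->.
by have := br_le alpha (nseq k false) z (tpt 0); rewrite E addn0 pt_le1 => ->.
Qed.

Let EE : R := (B + 1) / gap 1.

(** Along a left run u is phi until step m, is constant after it, and only at step m does the ramp
    vary. There its Lipschitz constant 1 / [gap l] is cancelled by the contraction [gap l] /
    [gap 1], so the total distortion stays sublinear. *)
Let tau k : R := if (k < m)%N then run_var k else if k == m then run_var k + EE else 0.

Let run_var0 k : 0 <= run_var k.
Proof. by rewrite mulr_ge0 ?powR_ge0. Qed.

Let EE0 : 0 <= EE. Proof. by rewrite divr_ge0 ?gap_ge0//; lra. Qed.

Let phi_run k x y : pt (tpt 1) <= pt x -> pt (tpt 1) <= pt y ->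
  `|phi (br (nseq k.+1 false) x) - phi (br (nseq k.+1 false) y)| <=
  run_var k * `|pt x - pt y| `^ g.
Proof.
move=> hx hy; apply: le_trans (phiA _ _) _; rewrite -mulrA ler_wpM2l//.
have q0 : 0 <= gap k.+1 / gap 1 by rewrite divr_ge0 ?gap_ge0.
rewrite -powRM// ge0_ler_powR ?nnegrE ?mulr_ge0 ?invr_ge0 ?gap_ge0 ?(ltW g_gt0)//.
exact: left_branches_dist.
Qed.

Let utau k x y : pt (tpt 1) <= pt x -> pt (tpt 1) <= pt y ->
  `|u (br (nseq k.+1 false) x) - u (br (nseq k.+1 false) y)| <=
  tau k * `|pt x - pt y| `^ g.
Proof.
move=> hx hy; rewrite /tau.
case/andP: (run_itv k.+1 hx) => x1 x2; case/andP: (run_itv k.+1 hy) => y1 y2.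
have ph := phi_run k hx hy.
have [km|mk|Ekm] := ltngtP k m.
- by rewrite !u_phi ?(le_trans _ x1) ?(le_trans _ y1)// tpt_le.
- rewrite /u !ramp_eq1 ?(le_trans x2) ?(le_trans y2) ?tpt_le//.
  rewrite (_ : _ - _ = 0) ?normr0 ?mul0r//; ring.
apply: le_trans (u_diff _ _) _; rewrite mulrDl lerD//.
apply: (@le_trans _ _ ((gap l)^-1 * (gap l / gap 1 * `|pt x - pt y|) * (B + 1))).
  rewrite ler_wpM2r//.
  apply: le_trans (ramp_dist _ _ _ _) _.
  by rewrite ler_wpM2l ?invr_ge0 ?gap_ge0// Ekm; exact: left_branches_dist.
have -> : (gap l)^-1 * (gap l / gap 1 * `|pt x - pt y|) * (B + 1) = EE * `|pt x - pt y|.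
  by rewrite /EE; field; rewrite !gt_eqF ?gap_gt0.
rewrite ler_wpM2l//; have id1 : holder_with 1 (@pt R) 1.
  by move=> s t; rewrite mul1r powRr1.
by have := holder_lip g_gt0 g_le1 id1 x y; rewrite mul1r.
Qed.

Let uJ x y : pt (tpt 1) <= pt x -> pt (tpt 1) <= pt y ->
  `|u x - u y| <= A * `|pt x - pt y| `^ g.
Proof.
have h1 : pt (tpt l) <= pt (tpt 1) by exact: tpt_le.
by move=> hx hy; rewrite !u_phi ?(le_trans h1)//; exact: phiA.
Qed.

Let tauT k : \sum_(0 <= i < k) tau i <= \sum_(0 <= i < m.+1) run_var i + EE.
Proof. exact: sum_pulse_le. Qed.

Let harnack n x y : pt (tpt 1) <= pt x -> pt (tpt 1) <= pt y ->
  Zn alpha u n x <= expR (run_distortion m) * Zn alpha u n y.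
Proof.
move=> hx hy.
have := Zn_harnack g_gt0 A0 uJ utau tauT n hx hy.
exact.
Qed.

Let bs_run k z : pt (tpt 1) <= pt z -> (k <= m)%N ->
  - \sum_(0 <= i < k) A * pt (tpt i.+1) `^ g <= bs u (nseq k false) z.
Proof.
move=> hz; elim: k => [|k IH] km; first by rewrite big_nil oppr0.
rewrite big_nat_recr// opprD addrC lerD//; last exact: IH (ltnW km).
case/andP: (run_itv k.+1 hz) => z1 z2.
change (- (A * pt (tpt k.+1) `^ g) <= u (br (nseq k.+1 false) z)).
rewrite u_phi; last by apply: le_trans z1; exact: tpt_le.
have := phiA (br (nseq k.+1 false) z) X0; rewrite phi0 subr0 -![val _]/(pt _).
rewrite [pt (X0)]/(0 : R) subr0 (ger0_norm (pt_ge0 _)) ler_norml => /andP[h _].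
apply: le_trans h; rewrite lerN2 ler_wpM2l// ge0_ler_powR ?nnegrE ?pt_ge0//.
exact: ltW.
Qed.

Let bmphi : bm phi. Proof. exact: (ucont_bm alpha (holder_ucont g_gt0 phiA)). Qed.

Let bmr : bm (fun x => ramp l x * (phi x + 1)).
Proof. by apply: bmM; [exact: bm_ramp|apply: bmD => //; exact: bm_cst]. Qed.

Lemma level_bound :
  expR (- run_cost m) <= m.+3%:R * (2 * (B + 1)) * b.
Proof.
have [p [pP p_min]] := growth_exponent_ex alpha uB.
have uu := holder_ucont g_gt0 uA.
have Exu (mu : probability X R) : Ex mu u = Ex mu phi - Ex mu (fun x => ramp l x * (phi x + 1)).
  by rewrite /u -ExB.
have rb : Ex nu (fun x => ramp l x * (phi x + 1)) <= (B + 1) * b.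
  rewrite /b -Ex_indic; last exact: measurable_cyl.
  have bi : bm (\1_(cyl alpha (nseq l false)) : X -> R).
    by apply: bm_indic; exact: measurable_cyl.
  rewrite -ExZ//; apply: Ex_le => //; first exact: bmZ.
  move=> x; case/andP: (ramp01 alpha l x) => r0 r1.
  apply: (@le_trans _ _ (ramp l x * (B + 1))).
    by rewrite ler_wpM2l// lerD2r; case/andP: (phib x).
  by rewrite mulrC ler_wpM2l ?ramp_le_indic//; lra.
(* Lowering phi changes the free energy of nu by at most (B + 1) b, and that free energy is
   nonnegative before the change. *)
have p1 : - ((B + 1) * b) <= p.
  have := free_energy_le nu_inv uu uB pP; rewrite Exu.
  have fin : entropy f nu \is a fin_num.
    move: nu_gibbs (dom nu_inv); case: (entropy f nu) => [r| |] //=.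
  have := nu_gibbs; rewrite -(fineK fin) -!EFinD !lee_fin.
  by move: rb; lra.
have u0p : u X0 < p by rewrite u0; have := b_small; lra.
have [nu' [h [M [[inv' mix' ent' ent0] [nuM M0 Mn Mr Mc] h0 Mcat Hk]]]] :=
  spectral_gap g_gt0 g_le1 uA uB pP p_min u0p.
have Mdec b' w : M (b' :: w) <= M w.
  by rewrite -(Mc w); case: b'; rewrite ?lerDl ?lerDr ltW.
have Mdecs k w : M (nseq k false ++ w) <= M w.
  by elim: k => //= k IH; exact: le_trans (Mdec _ _) IH.
have nseqS k : rcons (nseq k false) false = nseq k.+1 false.
  by elim: k => //= k ->.
(* Each of the first k digits is 1 with probability at most [M [:: true]]: an alternative between
   many returns and a large mass near 0. *)
have M_lin k : 1 - k%:R * M [:: true] <= M (nseq k false).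
  elim: k => [|k IH]; first by rewrite mul0r subr0 Mn.
  have := Mr (nseq k false); have := Mdecs k [:: true].
  by rewrite cats1 nseqS -natr1; move: IH; lra.
have p0 : p + 2^-1 * M (nseq l.+1 false) <= 0.
  have := dom inv'; rewrite ent' Exu -EFinD lee_fin.
  have : 2^-1 * M (nseq l.+1 false) <= Ex nu' (fun x => ramp l x * (phi x + 1)).
    have bi : bm (\1_(cyl alpha (nseq l.+1 false)) : X -> R).
      by apply: bm_indic; exact: measurable_cyl.
    have -> : M (nseq l.+1 false) = Ex nu' \1_(cyl alpha (nseq l.+1 false)).
      by rewrite Ex_indic ?nuM//; exact: measurable_cyl.
    rewrite -ExZ//; apply: Ex_le => //; first exact: bmZ.
    move=> x; case/andP: (ramp01 alpha l x) => r0 r1.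
    have [hl|/ltW hl] := leP (pt x) (pt (tpt l)).
      rewrite mulrC ler_pM ?ramp_ge_indic ?invr_ge0//.
      by have := phi_near hl; lra.
    have r00 := ramp_eq0 hl; have := ramp_ge_indic alpha l x; rewrite r00 mul0r => hi.
    by rewrite mulr_ge0_le0// invr_ge0.
  lra.
set D := run_distortion m.
(* The leading 1 brings [br w z] back to [t_1,1], so that Harnack compares h at both ends of the
   excursion; dropping it afterwards only increases the mass. *)
pose w := true :: nseq l.+1 false.
pose a := expR (- run_cost m).
have acat : a * M [:: true] <= M (nseq l.+1 false).
  apply: (@le_trans _ _ (M (w ++ [:: true]))); last first.
    apply: (le_trans (Mdec true (nseq m.+2 false ++ [:: true]))).
    by rewrite cats1 [leRHS]Mr lerDr ltW.
  apply: Mcat => x; rewrite /th; set z := br [:: true] x.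
  have hz : pt (tpt 1) <= pt z by exact: branch_true_ge.
  have hwz : pt (tpt 1) <= pt (br w z) by exact: branch_true_ge.
  have := Hk z (br w z) (expR D) (expR_ge0 _) (fun n => harnack n hz hwz) => hh.
  rewrite ler_pdivlMr//; apply: (@le_trans _ _ (a * (expR D * h (br w z)))).
    by rewrite ler_wpM2l ?expR_ge0.
  rewrite mulrA ler_wpM2r ?(ltW (h0 _))// -expRD ler_expR.
  (* Since p is negative by [p0], the normalizing factor of the weight can only help. *)
  have np : (size w)%:R * p <= 0.
    by rewrite mulr_ge0_le0//; have := M0 (nseq l.+1 false); lra.
  have b1 := bs_run hz (leqnn m).
  have ub y : - (2 * B + 1) <= u y by have := uB y; rewrite ler_norml => /andP[].
  have : bs u w z = u (br w z) + (u (br (nseq m.+2 false) z) + (u (br (nseq m.+1 false) z) + bs u (nseq m false) z)) by [].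
  have := ub (br w z); have := ub (br (nseq m.+2 false) z); have := ub (br (nseq m.+1 false) z).
  move: np b1; rewrite /a /run_cost -/D; lra.
have a1 : a <= 1.
  rewrite /a -expR0 ler_expR oppr_le0 /run_cost addr_ge0//; last first.
    by rewrite addr_ge0 ?sumr_ge0// => [i _|]; rewrite mulr_ge0 ?powR_ge0//; have := B1; lra.
  by rewrite divr_ge0 ?subr_ge0 ?(ltW (rateg_lt1 _ _))// !addr_ge0 ?sumr_ge0.
have a0 : 0 < a by exact: expR_gt0.
have l1 := M_lin l.+1.
set Xm := M (nseq l.+1 false) in acat l1 p0.
have X0' : 0 < Xm by exact: M0.
(* [acat] bounds [M [:: true]] by Xm / a; inserted into [M_lin], it eliminates this unknown mass. *)
have step : a <= m.+3%:R * Xm.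
  have : a * (1 - m.+2%:R * M [:: true]) <= a * Xm by rewrite ler_wpM2l ?(ltW a0).
  have : m.+2%:R * (a * M [:: true]) <= m.+2%:R * Xm by rewrite ler_wpM2l.
  have : a * Xm <= Xm by rewrite ler_piMl ?(ltW X0').
  rewrite -[m.+3%:R]natr1; lra.
apply: le_trans step _; rewrite -mulrA ler_wpM2l//; move: rb p1 p0; lra.
Qed.

End level.

Section dichotomy.
Context {R : realType} (alpha : {posnum R}).
Local Notation X := (unit_itv R).
Local Notation f := (intermittent_map alpha).
Local Notation tpt := (tpt alpha).
Implicit Types (x y z : X) (n m k l : nat) (mu nu : probability X R) (phi : X -> R).

Definition dominated phi := forall mu, invariant_measure f mu ->
  (entropy f mu + (Ex mu phi)%:E <= (phi X0)%:E)%E.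

Lemma mixing_not_dominated g A phi nu : 0 < g -> g <= 1 -> holder_with g phi A ->
  invariant_measure f nu -> exponentially_mixing alpha nu -> (0 < entropy f nu)%E ->
  ((phi X0)%:E <= entropy f nu + (Ex nu phi)%:E)%E -> ~ dominated phi.
Proof.
move=> g0 g1 phiA inv mix ent gib dom.
pose phi' x := phi x - phi X0.
have bphi : bm phi by exact: (ucont_bm alpha (holder_ucont g0 phiA)).
have ExE mu : Ex mu phi' = Ex mu phi - phi X0.
  by rewrite /phi' ExB// ?Ex_cst//; exact: bm_cst.
have phiA' : holder_with g phi' A.
  by move=> x y; rewrite (_ : phi' x - phi' y = phi x - phi y)// /phi'; ring.
have phi0 : phi' X0 = 0 by rewrite /phi' subrr.
have dom' mu : invariant_measure f mu -> (entropy f mu + (Ex mu phi')%:E <= 0)%E.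
  by move=> h; rewrite ExE EFinB addeA sube_le0 dom.
have gib' : (0 <= entropy f nu + (Ex nu phi')%:E)%E by rewrite ExE EFinB addeA sube_ge0.
have [B' hB'] : exists B' : R, forall x, `|phi' x| <= B'.
  by apply: is_holder_bounded g0 _; exists A.
pose B : R := Num.max 1 B'.
have B1 : 1 <= B by rewrite le_max lexx.
have hB x : `|phi' x| <= B by rewrite le_max hB' orbT.
have [kappa [s [k0 ss hs]]] := mixing_decay inv mix ent.
have [d d0 hd] := holder_ucont g0 phiA' (ltac:(by rewrite invr_gt0) : 0 < 2^-1 :> R).
have [N1 hN1] := tpt_small alpha d0.
(* The logarithmic form of [level_bound] with m = n + 1 says that T n is at least kappa n, which
   fails for large n. *)
pose T n := s n + (run_cost alpha g A B n.+1 + (ln (n.+4%:R : R) + ln (2 * (B + 1)))).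
have sT : sublin T.
  apply: sublinD => //; apply: sublinD.
    exact: (sublin_shift (sublin_run_cost alpha B g0 phiA')).
  apply: sublinD; last exact: sublin_cst.
  exact: (sublin_shift (sublin_shift (sublin_shift (sublin_ln (R := R))))).
have sB : sublin (fun n => s n + ln (B + 1)) by apply: sublinD => //; exact: sublin_cst.
have [N2 hN2] := sublin_lt k0 sT; have [N3 hN3] := sublin_lt k0 sB.
pose n := (N1 + (N2 + N3))%N.
have {}hN2 : T n < kappa * n%:R by apply: hN2; rewrite /n addnCA leq_addr.
have {}hN3 : s n + ln (B + 1) < kappa * n%:R by apply: hN3; rewrite /n addnA leq_addl.
have B10 : 0 < B + 1 by lra.
have near x : pt x <= pt (tpt n.+2) -> - 2^-1 <= phi' x.
  move=> hx; have : `|phi' x - phi' X0| <= 2^-1.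
    apply: hd; rewrite [pt (X0)]/(0 : R) subr0 ger0_norm ?pt_ge0//.
    by apply: le_trans hx (hN1 _ _); rewrite /n -addnS -addnS leq_addr.
  by rewrite phi0 subr0 ler_norml => /andP[].
have bn := hs n.
have small : (B + 1) * fine (nu (cyl alpha (nseq n.+2 false))) < 1.
  apply: (@le_lt_trans _ _ ((B + 1) * expR (s n - kappa * n%:R))).
    by rewrite ler_wpM2l// ltW.
  by rewrite -{1}(@lnK _ (B + 1)) ?posrE// -expRD -[ltRHS]expR0 ltr_expR; lra.
have := level_bound g0 g1 phiA' phi0 B1 hB dom' inv gib' near small.
apply/negP; rewrite -ltNge.
have c0 : 0 < n.+4%:R * (2 * (B + 1)) :> R by rewrite !mulr_gt0.
apply: (@le_lt_trans _ _ (n.+4%:R * (2 * (B + 1)) * expR (s n - kappa * n%:R))).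
  by rewrite ler_wpM2l// ltW.
rewrite -[X in X * _](@lnK _ (n.+4%:R * (2 * (B + 1)))) ?posrE//.
rewrite -expRD ltr_expR lnM ?posrE ?mulr_gt0//.
move: hN2; rewrite /T; lra.
Qed.

Lemma delta0_invariant : invariant_measure f (delta0 R).
Proof.
move=> A mA; rewrite /pushforward /delta0 /= !diracE; congr (_%:R%:E).
have E : f X0 = X0 := iter_map_X0 alpha 1.
rewrite /preimage; case: (boolP (unit_itv0 R \in A)) => h.
  by rewrite mem_set//= E; exact: set_mem.
rewrite memNset//= E; move: h; rewrite notin_setE; exact.
Qed.

Lemma delta0_X0 : delta0 R [set X0] = 1%E.
Proof. by rewrite /delta0 /= diracE mem_set. Qed.

Lemma entropy_delta0 : entropy f (delta0 R) = 0%E.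
Proof. exact: entropy_atom delta0_X0. Qed.

Lemma Ex_delta0 phi : bm phi -> Ex (delta0 R) phi = phi X0.
Proof.
move=> [mphi _]; rewrite /Ex /Rintegral /delta0 integral_dirac//.
- by rewrite diracT mul1e.
- exact/measurable_EFinP.
Qed.

Lemma free_energyE phi mu : bm phi ->
  free_energy alpha phi mu = (entropy f mu + (Ex mu phi)%:E)%E.
Proof. by move=> h; rewrite /free_energy EFin_Ex. Qed.

Lemma free_energy_delta0 phi : bm phi -> free_energy alpha phi (delta0 R) = (phi X0)%:E.
Proof. by move=> h; rewrite free_energyE// entropy_delta0 add0e Ex_delta0. Qed.

Lemma free_energy_le_pressure phi mu : invariant_measure f mu ->
  (free_energy alpha phi mu <= pressure alpha phi)%E.
Proof. by move=> inv; apply: ereal_sup_ubound; exists mu. Qed.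

(** All free energies are at most p, so p <= phi(0) would give domination. Hence p > phi(0), and the
    measure of [spectral_gap] attains p. *)
Lemma not_dominated_gibbs g A phi : 0 < g -> g <= 1 -> holder_with g phi A ->
  ~ dominated phi ->
  exists nu, [/\ gibbs_state alpha phi nu, exponentially_mixing alpha nu &
    (0 < entropy f nu)%E].
Proof.
move=> g0 g1 phiA nd.
have [B hB] := is_holder_bounded g0 (ex_intro _ A phiA).
have uphi := holder_ucont g0 phiA; have bphi := ucont_bm alpha uphi.
have [p [pP p_min]] := growth_exponent_ex alpha hB.
have ub mu : invariant_measure f mu -> (entropy f mu + (Ex mu phi)%:E <= p%:E)%E.
  by move=> inv; exact: free_energy_le inv uphi hB pP.
have p0 : phi X0 < p.
  rewrite ltNge; apply/negP => le; apply: nd => mu /ub h.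
  by apply: le_trans h _; rewrite lee_fin.
have [nu [h [M [[inv mix ent ent0] _ _ _ _]]]] :=
  spectral_gap g0 g1 phiA hB pP p_min p0.
exists nu; split=> //; last by rewrite ent lte_fin.
split=> //; apply/eqP; rewrite eq_le free_energy_le_pressure//=.
apply: ge_ereal_sup => _ [mu /= invmu <-].
by rewrite !free_energyE// ent -EFinD subrK; exact: ub.
Qed.

Variable gamma : {posnum R}.
Hypothesis gamma_le1 : gamma%:num <= 1.

Let g0 : 0 < gamma%:num. Proof. by []. Qed.

Lemma holder_bm (phi : holder gamma) : bm phi.
Proof. by have [A hA] := holderP phi; exact: (ucont_bm alpha (holder_ucont g0 hA)). Qed.

Lemma intermittent_phaseP (phi : holder gamma) :
  intermittent_phase alpha gamma phi <-> ~ dominated phi.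
Proof.
have [A hA] := holderP phi; have bphi := holder_bm phi.
split=> [[nu [[inv gib] mix ent]]|nd]; last exact: not_dominated_gibbs hA nd.
apply: (mixing_not_dominated g0 gamma_le1 hA inv mix ent).
rewrite -free_energyE// gib -free_energy_delta0//.
exact/free_energy_le_pressure/delta0_invariant.
Qed.

Lemma delta0_gibbsP (phi : holder gamma) :
  gibbs_state alpha phi (delta0 R) <-> dominated phi.
Proof.
have bphi := holder_bm phi; split=> [[_ gib] mu inv|dom].
  by rewrite -free_energyE// -(free_energy_delta0 bphi) gib free_energy_le_pressure.
split; first exact: delta0_invariant.
apply/eqP; rewrite eq_le (free_energy_le_pressure _ delta0_invariant)/=.
apply: ge_ereal_sup => _ [mu /= inv <-].
by rewrite free_energy_delta0// free_energyE//; exact: dom.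
Qed.

End dichotomy.

(** * The two regimes *)

Section regimes.
Context {R : realType} (alpha : {posnum R}).
Local Notation X := (unit_itv R).
Local Notation f := (intermittent_map alpha).
Local Notation a := (alpha%:num).
Local Notation branch := (branch alpha).
Local Notation tpt := (tpt alpha).
Local Notation Lop := (Lop alpha).
Local Notation Zn := (Zn alpha).
Implicit Types (x y z : X) (n m k l : nat) (mu nu : probability X R) (phi : X -> R).

Lemma growth_not_dominated g A (b c : R) phi : 0 < g -> g <= 1 -> holder_with g phi A ->
  0 < c -> (forall n, c * expR (n%:R * b) <= Zn phi n X1) -> phi X0 < b ->
  ~ dominated alpha phi.
Proof.
move=> g0 g1 phiA c0 hc phib dom.
have [B hB] := is_holder_bounded g0 (ex_intro _ A phiA).
have [p [pP p_min]] := growth_exponent_ex alpha hB.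
have bp : b <= p.
  apply/ler_addgt0Pr => e e0; have [C hC] := pP (p + e) (ltac:(by rewrite ltrDl)).
  rewrite leNgt; apply/negP => lt; have d0 : 0 < b - (p + e) by rewrite subr_gt0.
  have s1 : sublin (fun=> ln (`|C| / c) + 1) by exact: sublin_cst.
  have [n hn] := sublin_lt d0 s1; have {hn} := hn n (leqnn n).
  have h : c * expR (n%:R * b) <= `|C| * expR (n%:R * (p + e)).
    apply: le_trans (hc n) _; apply: le_trans (hC n X1) _.
    by rewrite ler_wpM2r ?expR_ge0// ler_norm.
  have C0 : 0 < `|C|.
    rewrite lt_def normr_ge0 andbT; apply/eqP => E; move: h; rewrite E mul0r.
    by apply/negP; rewrite -ltNge mulr_gt0// expR_gt0.
  have : expR (n%:R * b) <= expR (ln (`|C| / c) + n%:R * (p + e)).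
    rewrite expRD lnK ?posrE ?divr_gt0// -(ler_pM2l c0).
    by apply: le_trans h _; rewrite mulrA (mulrC c) divfK ?gt_eqF.
  by rewrite ler_expR mulrBl; lra.
have [nu [h [M [[inv mix ent ent0] _ _ _ _]]]] :=
  spectral_gap g0 g1 phiA hB pP p_min (lt_le_trans phib bp).
have := dom nu inv; rewrite ent -EFinD subrK lee_fin leNgt.
by rewrite (lt_le_trans phib bp).
Qed.

Lemma zero_not_dominated : ~ dominated alpha (fun=> 0 : R).
Proof.
apply: (@growth_not_dominated 1 0 (ln 2) 1) => //; first exact: holder_cst.
- move=> n; rewrite mul1r ZnE (eq_bigr (fun=> 1)); last first.
    move=> w _; suff -> : bs alpha (fun=> 0) w X1 = 0 :> R by rewrite expR0.
    by elim: w => //= b w ->; rewrite add0r.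
  by rewrite sum_words_cst mulr1 mulr_natl -lnXn// lnK// posrE exprn_gt0.
- by rewrite ln_gt0// ltr1n.
Qed.

Lemma powR1D_ge (b t : R) : 0 < b -> 0 <= t <= 1 -> 1 + b / 2 * t <= (1 + t) `^ b.
Proof.
move=> b0 /andP[t0 t1]; have t10 : 0 < 1 + t by lra.
rewrite /powR gt_eqF//; apply: le_trans (expR_ge1Dx _); rewrite lerD2l.
rewrite -mulrA ler_wpM2l ?(ltW b0)//.
have : ln (1 + - (t / (1 + t))) <= - (t / (1 + t)).
  by apply: le_ln1Dx; rewrite ltrN2 ltr_pdivrMr// mul1r ltrDr.
have -> : 1 + - (t / (1 + t)) = (1 + t)^-1 by field; rewrite gt_eqF.
rewrite lnV ?posrE// lerN2; apply: le_trans.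
by rewrite mulrC ler_wpM2l// lef_pV2 ?posrE//; lra.
Qed.

(* W = exp (- C x^(gamma - alpha)) satisfies L_phi W >= exp (phi 0) (1 + kappa) W,
   because x^(gamma - alpha) decreases by at least a multiple of
   y^gamma from x to its left preimage y. *)
Lemma never_dominated g A phi : g <= 1 -> holder_with g phi A -> a < g ->
  ~ dominated alpha phi.
Proof.
move=> g1 phiA ag; have g0 : 0 < g by apply: lt_trans ag.
have A0 := holder_ge0 phiA.
pose b := g - a; have b0 : 0 < b by rewrite subr_gt0.
(* With this C the gain C (b / 2) y^g of W along the left branch balances the possible drop A y^g of
   phi; the right branch then contributes the extra factor [ka]. *)
pose C := A / (b / 2).
have C0 : 0 <= C by rewrite divr_ge0// divr_ge0// ltW.
pose W x := expR (- (C * pt x `^ b)).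
pose ka : R := expR (- (A + C)).
have ka0 : 0 < ka by exact: expR_gt0.
have phil z : phi X0 - A * pt z `^ g <= phi z.
  have := phiA z X0; rewrite -![val _]/(pt _) [pt (X0)]/(0 : R) subr0.
  by rewrite (ger0_norm (pt_ge0 _)) ler_norml => /andP[h _]; lra.
have W1 x : W x <= 1.
  by rewrite /W -expR0 ler_expR oppr_le0 mulr_ge0 ?powR_ge0.
have W0 x : 0 <= W x by exact: expR_ge0.
have LW x : expR (phi X0) * (1 + ka) * W x <= Lop phi W x.
  rewrite /Submission.Lop; set y0 := branch false x; set y1 := branch true x.
  rewrite mulrDr mulr1 mulrDl; apply: lerD.
    rewrite /W -!expRD ler_expR.
    have e0 := branchE alpha false x; rewrite addr0 -/y0 in e0.
    have ex : pt x `^ b = pt y0 `^ b * (1 + pt y0 `^ a) `^ b.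
      by rewrite -e0 /expand powRM ?pt_ge0 ?addr_ge0 ?powR_ge0.
    have a01 : 0 <= pt y0 `^ a <= 1 by rewrite powR_ge0 powR_le1 ?pt_ge0 ?pt_le1.
    have h1 : pt y0 `^ b * (1 + b / 2 * pt y0 `^ a) <= pt x `^ b.
      by rewrite ex ler_wpM2l ?powR_ge0 ?powR1D_ge.
    have yg : pt y0 `^ b * pt y0 `^ a = pt y0 `^ g.
      by rewrite -powRD /b subrK// gt_eqF.
    have h2 : C * (b / 2 * (pt y0 `^ b * pt y0 `^ a)) = A * pt y0 `^ g.
      by rewrite yg mulrA /C divfK// gt_eqF ?divr_gt0.
    have h3 := ler_wpM2l C0 h1; have h4 := phil y0.
    by move: h2 h3 h4; rewrite mulrDr mulr1 mulrDr [pt y0 `^ b * (_ * _)]mulrCA; lra.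
  rewrite /W /ka -!expRD ler_expR.
  have := phil y1.
  have : A * pt y1 `^ g <= A * 1 by rewrite ler_wpM2l// powR_le1 ?(ltW g0)// pt_ge0 pt_le1.
  have : C * pt y1 `^ b <= C * 1 by rewrite ler_wpM2l// powR_le1 ?(ltW b0)// pt_ge0 pt_le1.
  have : 0 <= C * pt x `^ b by rewrite mulr_ge0 ?powR_ge0.
  lra.
pose q := expR (phi X0) * (1 + ka).
have q0 : 0 < q by rewrite mulr_gt0 ?expR_gt0 ?addr_gt0.
apply: (@growth_not_dominated g A (ln q) (W X1)) => //; first exact: expR_gt0.
  move=> n; have iW k x : q ^+ k * W x <= iter k (Lop phi) W x.
    elim: k x => [|k IH] x; first by rewrite expr0 mul1r.
    rewrite exprS -mulrA iterSr; apply: (@le_trans _ _ (q * iter k (Lop phi) W x)).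
      by rewrite ler_wpM2l ?(ltW q0).
    by rewrite -iter_LopZ; apply: iter_Lop_le => z; exact: LW.
  rewrite [n%:R * _]mulr_natl -lnXn// lnK ?posrE ?exprn_gt0// mulrC.
  by apply: le_trans (iW n X1) _; exact: iter_Lop_le.
rewrite /q lnM ?posrE ?expR_gt0 ?addr_gt0// expRK ltrDl ln_gt0// ltrDl//.
Qed.

Lemma geometric_ge (s : R) : 0 <= s -> s <= 1 -> s * expR (-1) <= 1 - expR (- s).
Proof.
move=> s0 s1; have h1 : expR (-1) <= expR (- s) by rewrite ler_expR lerN2.
have h2 : 1 + s <= expR s by exact: expR_ge1Dx.
have h3 : expR (- s) * expR s = 1 by rewrite -expRD addNr expR0.
have h4 := expR_ge0 (- s).
have h5 : s * expR (-1) <= s * expR (- s) by rewrite ler_wpM2l.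
have h6 : expR (- s) * (1 + s) <= 1 by rewrite -[leRHS]h3 ler_wpM2l.
lra.
Qed.

(** Subadditivity of the power: for 0 <= t <= s, the ratios t / s and (s - t) / s add up to 1 and
    increase when raised to g <= 1. *)
Lemma pt_powR_holder g : 0 < g -> g <= 1 -> holder_with g (fun x => pt x `^ g) 1.
Proof.
move=> g0 g1 x y; rewrite mul1r -![val _]/(pt _).
wlog h : x y / pt y <= pt x.
  move=> H; have [le|/ltW le] := leP (pt y) (pt x); first exact: H.
  by rewrite distrC (distrC (pt x)); exact: H.
set s := pt x in h *; set t := pt y in h *.
have t0 : 0 <= t by exact: pt_ge0.
rewrite !ger0_norm ?subr_ge0 ?ge0_ler_powR ?nnegrE ?(ltW g0) ?(le_trans t0)//.
have [s0|sn0] := eqVneq s 0.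
  have -> : t = 0 by apply/eqP; rewrite eq_le t0 -s0 h.
  by rewrite s0 subr0 powR0 ?gt_eqF// subr0.
have s0 : 0 < s by rewrite lt_def sn0 (le_trans t0).
have ge r : 0 <= r -> r <= 1 -> r <= r `^ g.
  rewrite le_eqVlt => /orP[/eqP <- _|r0 r1]; first exact: powR_ge0.
  by rewrite -{1}[r]powRr1 ?(ltW r0)// ger_powR// r0.
have h1 := ge (t / s); have h2 := ge ((s - t) / s).
have {}h1 : t / s <= (t / s) `^ g.
  by apply: h1; [rewrite divr_ge0// ltW|rewrite ler_pdivrMr// mul1r].
have {}h2 : (s - t) / s <= ((s - t) / s) `^ g.
  apply: h2; first by rewrite divr_ge0 ?subr_ge0// ltW.
  by rewrite ler_pdivrMr// mul1r gerBl.
have h3 : 1 <= (t / s) `^ g + ((s - t) / s) `^ g.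
  by apply: le_trans (lerD h1 h2); rewrite -mulrDl subrKC mulfV.
have sg : 0 < s `^ g by exact: powR_gt0.
have e1 : s `^ g * (t / s) `^ g = t `^ g.
  by rewrite -powRM ?(ltW s0) ?divr_ge0 ?(ltW s0)// mulrC divfK.
have e2 : s `^ g * ((s - t) / s) `^ g = (s - t) `^ g.
  by rewrite -powRM ?(ltW s0) ?divr_ge0 ?subr_ge0 ?(ltW s0)// mulrC divfK.
have := ler_wpM2l (ltW sg) h3; rewrite mulr1 mulrDr e1 e2; lra.
Qed.

(* x^(- gamma) is superharmonic on (0,1] for the transfer operator of
   - c x^gamma, c large. *)
Lemma dominated_ex g : 0 < g -> g <= 1 -> g <= a ->
  exists c : R, dominated alpha (fun x => - (c * pt x `^ g)).
Proof.
move=> g0 g1 ga.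
pose tau := pt (tpt 1) `^ g; have tau0 : 0 < tau by rewrite powR_gt0// tpt_gt0.
have tau1 : tau <= 1 by rewrite powR_le1 ?(ltW g0)// pt_ge0 pt_le1.
(* The summand g + 1 leaves a factor e^(-s) to spare on the left branch beyond e^(- g s); the last
   summand makes the right branch contribute at most e^(-(g + 1)), as [key] shows. *)
pose c : R := g + 1 + expR (g + 1) / tau ^+ 2.
have c1 : g + 1 <= c by rewrite lerDl divr_ge0 ?expR_ge0 ?exprn_ge0 ?(ltW tau0).
have c0 : 0 <= c by lra.
exists c; pose u x := - (c * pt x `^ g).
have key : expR (- (c * tau)) / tau <= expR (- (g + 1)).
  rewrite ler_pdivrMr// expRN -(ler_pM2l (expR_gt0 (c * tau))) mulfV ?gt_eqF ?expR_gt0//.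
  apply: (@le_trans _ _ ((1 + c * tau) * (expR (- (g + 1)) * tau))); last first.
    by rewrite ler_wpM2r ?mulr_ge0 ?expR_ge0 ?(ltW tau0)// expR_ge1Dx.
  rewrite -ler_pdivrMr ?mulr_gt0 ?expR_gt0// mul1r.
  have -> : (expR (- (g + 1)) * tau)^-1 = expR (g + 1) / tau ^+ 2 * tau.
    by rewrite expRN invfM invrK expr2; field; rewrite gt_eqF.
  apply: (@le_trans _ _ (c * tau)); last by rewrite lerDr.
  by rewrite ler_wpM2r ?(ltW tau0)// /c lerDr; lra.
have super n x : 0 < pt x -> Zn u n x <= (pt x `^ g)^-1.
  elim: n x => [|n IH] x x0.
    by rewrite /Submission.Zn /= invf_ge1 ?powR_gt0// powR_le1 ?(ltW g0)// pt_ge0 pt_le1.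
  rewrite -add1n Zn_add /= /Submission.Lop.
  set y0 := branch false x; set y1 := branch true x.
  have y00 : 0 < pt y0 by exact: branch_gt0.
  have y10 : 0 < pt y1 by exact: branch_gt0.
  apply: (@le_trans _ _ (expR (u y0) * (pt y0 `^ g)^-1 + expR (u y1) * (pt y1 `^ g)^-1)).
    by rewrite lerD// ler_wpM2l ?expR_ge0//; exact: IH.
  have e0 := branchE alpha false x; rewrite addr0 -/y0 in e0.
  pose s := pt y0 `^ g; have s0 : 0 < s by exact: powR_gt0.
  have s1 : s <= 1 by rewrite powR_le1 ?(ltW g0)// pt_ge0 pt_le1.
  pose v := pt y1 `^ g; have v0 : 0 < v by exact: powR_gt0.
  have tv : tau <= v.
    by rewrite ge0_ler_powR ?nnegrE ?pt_ge0 ?(ltW g0)//; exact: branch_true_ge.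
  (* Here g <= alpha enters: (1 + y^alpha)^g <= e^(g y^alpha) <= e^(g y^g) for y <= 1. *)
  have hx : s^-1 * expR (- (g * s)) <= (pt x `^ g)^-1.
    rewrite -e0 /expand powRM ?pt_ge0 ?addr_ge0 ?powR_ge0// -/s invfM.
    rewrite ler_wpM2l ?invr_ge0 ?(ltW s0)// expRN lef_pV2 ?posrE ?expR_gt0 ?powR_gt0 ?ltr_wpDr ?powR_ge0//.
    rewrite /powR [X in if X then _ else _]gt_eqF ?ltr_wpDr ?powR_ge0//.
    rewrite ler_expR ler_wpM2l ?(ltW g0)//.
    apply: (@le_trans _ _ (pt y0 `^ a)).
      by apply: le_ln1Dx; apply: lt_le_trans (powR_ge0 _ _); rewrite ltrN10.
    by rewrite /s ger_powR// y00 pt_le1.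
  apply: le_trans hx; rewrite /u -/s -/v.
  have b1 : expR (- (c * v)) * v^-1 <= expR (- (g + 1)).
    apply: (le_trans _ key); apply: ler_pM.
    - exact: expR_ge0.
    - by rewrite invr_ge0 ltW.
    - by rewrite ler_expR lerN2 ler_wpM2l.
    - by rewrite lef_pV2 ?posrE.
  have b2 : expR (- (c * s)) <= expR (- (g * s)) * expR (- s).
    rewrite -expRD ler_expR -opprD lerN2 -{2}[s]mul1r -mulrDl ler_wpM2r ?(ltW s0)//.
  have b3 := geometric_ge (ltW s0) s1.
  have b4 : expR (- g) <= expR (- (g * s)) by rewrite ler_expR lerN2 ler_piMr ?(ltW g0).
  have aux (P Q E : R) : P + s * Q <= E -> P * s^-1 + Q <= s^-1 * E.
    move=> h; rewrite -(ler_pM2l s0) (_ : s * (s^-1 * E) = E); last first.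
      by rewrite mulrA mulfV ?gt_eqF// mul1r.
    by rewrite mulrDr mulrCA mulfV ?gt_eqF// mulr1.
  apply: aux.
  have b5 : s * (expR (- (c * v)) * v^-1) <= s * expR (- (g + 1)) by rewrite ler_wpM2l ?(ltW s0).
  have b6 : s * expR (- (g + 1)) = expR (- g) * (s * expR (- 1)).
    by rewrite opprD expRD; ring.
  have b7 : expR (- g) * (s * expR (-1)) <= expR (- (g * s)) * (1 - expR (- s)).
    by rewrite ler_pM ?expR_ge0 ?mulr_ge0 ?expR_ge0 ?(ltW s0).
  rewrite b6 in b5; apply: le_trans (lerD b2 (le_trans b5 b7)) _.
  by rewrite -mulrDr addrC subrK mulr1.
move=> mu inv.
have uA : is_holder g u.
  eexists; rewrite (_ : u = fun x => (- c) * pt x `^ g); first exact: holderZ (pt_powR_holder g0 g1).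
  by apply/funext => x; rewrite /u mulNr.
have [D hD] := uA; have [B hB] := is_holder_bounded g0 uA.
have Zn1 n : Zn u n X1 <= 1 * expR (n%:R * 0).
  rewrite mulr0 expR0 mulr1; apply: le_trans (super n X1 ltr01) _.
  by rewrite [pt X1]/(1 : R) powR1 invr1.
have h := entropy_le inv (holder_ucont g0 hD) hB Zn1.
apply: le_trans (leeD2r _ h) _; rewrite -EFinD lee_fin subrK.
by rewrite [pt X0]/(0 : R) powR0 ?gt_eqF// mulr0 oppr0.
Qed.

End regimes.

(** * Topology of the phases *)

Lemma star_convex_connected (R : realType) (V : normedModType R) (x0 : V) (A : set V) :
  A x0 -> star_convex x0 A -> connected A.
Proof.
move=> A0 st; pose S x := [set (1 - t) *: x0 + t *: x | t in `[0 : R, 1 : R]%classic].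
have -> : A = \bigcup_(x in A) S x.
  apply/seteqP; split=> [x Ax|_ [x Ax [t /= t01 <-]]].
    exists x => //; exists 1; last by rewrite subrr scale0r scale1r add0r.
    by rewrite /= in_itv /= ler01 lexx.
  by apply: st => //; move: t01; rewrite in_itv.
apply: bigcup_connected.
  exists x0 => x Ax; exists 0; last by rewrite subr0 scale1r scale0r addr0.
  by rewrite /= in_itv /= lexx ler01.
move=> x Ax; apply: connected_continuous_connected; first exact: segment_connected.
apply: continuous_subspaceT => t.
apply: cvgD; apply: cvgZr_tmp; last exact: cvg_id.
by apply: cvgB; [exact: cvg_cst|exact: cvg_id].
Qed.

Section phase_topology.
Context {R : realType} (alpha gamma : {posnum R}).
Hypothesis gamma_le1 : gamma%:num <= 1.
Local Notation X := (unit_itv R).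
Local Notation f := (intermittent_map alpha).
Local Notation V := (holder gamma).
Local Notation tpt := (tpt alpha).
Implicit Types (x y z : X) (n m k : nat) (mu nu : probability X R) (phi psi : V).

Let g0 : 0 < gamma%:num. Proof. by []. Qed.

Definition dominated_set : set V := [set phi | dominated alpha phi].
Local Notation D := dominated_set.

Lemma holder_ge phi x : `|phi x| <= `|phi|.
Proof. exact: holder_norm_ge. Qed.

Lemma holder_dist0 phi x : `|phi x - phi X0| <= `|phi| * pt x `^ gamma%:num.
Proof.
have h := le_holder_seminorm (lt0r_neq0 g0) (holderP phi).
apply: le_trans (h x X0) _; rewrite -![val _]/(pt _) [pt X0]/(0 : R) subr0.
rewrite (ger0_norm (pt_ge0 _)) ler_wpM2r ?powR_ge0//.
rewrite [leRHS]/(holder_norm phi) /holder_norm lerDr.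
exact: le_trans (le_sup_norm g0 (holderP phi) X0).
Qed.

Lemma holder_interiorP (A : set V) phi :
  A° phi <-> exists2 r : R, 0 < r & forall psi, `|phi - psi| < r -> A psi.
Proof.
rewrite /interior; split=> [/nbhs_normP[r /= r0 h]|[r r0 h]].
  by exists r => // psi hp; exact: h.
by apply/(@nbhs_normP _ V); exists r.
Qed.

Lemma entropy_ge0 mu : (0 <= entropy f mu)%E.
Proof.
apply: ereal_sup_ubound; exists 1%N, (fun=> setT); split.
  split=> //; last by apply/seteqP; split => // x _; exists ord0.
  by apply/trivIsetP => i j _ _; rewrite (ord1 i) (ord1 j) eqxx.
congr EFin; rewrite /partition_entropy.
have E n : join_entropy mu f (fun _ : 'I_1 => [set: X]) n / n%:R = 0.
  rewrite /join_entropy big1 ?mul0r// => w _.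
  rewrite (_ : join_atom _ _ _ = setT) ?probability_setT ?ln1 ?mulr0 ?oppr0//.
  by apply/seteqP; split.
by under eq_fun do rewrite E; rewrite lim_cst.
Qed.

Lemma dominated_le (phi psi : X -> R) : bm phi -> bm psi ->
  (forall x, psi x - psi X0 <= phi x - phi X0) ->
  dominated alpha phi -> dominated alpha psi.
Proof.
move=> bphi bpsi le dom mu inv.
have h : Ex mu psi <= Ex mu phi + (psi X0 - phi X0).
  rewrite -(Ex_cst mu (psi X0 - phi X0)) -ExD//; last exact: bm_cst.
  apply: Ex_le => //; first by apply: bmD => //; exact: bm_cst.
  by move=> x; have := le x; lra.
have := dom mu inv; case: (entropy f mu) => [r| |]; rewrite ?leNye -?EFinD ?lee_fin//.
lra.
Qed.

Lemma not_dominatedP (phi : X -> R) : ~ dominated alpha phi <->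
  exists2 mu, invariant_measure f mu & ((phi X0)%:E < entropy f mu + (Ex mu phi)%:E)%E.
Proof.
split=> [nd|[mu inv lt] dom]; last by have := dom mu inv; rewrite leNgt lt.
apply: contrapT => h; apply: nd => mu inv; rewrite leNgt; apply/negP => lt.
by apply: h; exists mu.
Qed.

Lemma holder_bm' phi : bm phi. Proof. exact: (holder_bm alpha). Qed.
Local Hint Resolve holder_bm' : core.

(** A measure that strictly beats delta_0 still does so for nearby potentials, since value at 0 and
    integral are 1-Lipschitz in the potential. With infinite entropy any radius works. *)
Lemma closed_dominated : closed D.
Proof.
suff : open (~` D) by move/open_closedC; rewrite setCK.
rewrite openE => phi /= /not_dominatedP[mu inv lt]; apply/holder_interiorP.
have := entropy_ge0 mu; case E : (entropy f mu) => [r| |] // r0; last first.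
  by exists 1 => // psi _; apply/not_dominatedP; exists mu => //; rewrite E ltry.
rewrite E -EFinD lte_fin in lt.
exists ((r + Ex mu phi - phi X0) / 2); first by rewrite divr_gt0// subr_gt0.
move=> psi h; apply/not_dominatedP; exists mu => //; rewrite E -EFinD lte_fin.
have h0 : `|phi X0 - psi X0| <= `|phi - psi| by exact: holder_ge (phi - psi) X0.
have : `|Ex mu (fun x => phi x - psi x)| <= `|phi - psi|.
  by apply: Ex_norm_le; [exact: bmB|move=> x; exact: holder_ge (phi - psi) x].
rewrite ExB// ler_norml => /andP[h1 h2].
by move: h0; rewrite ler_norml => /andP[h3 h4]; lra.
Qed.

Lemma holder_of_subproof (u : X -> R) : is_holder gamma%:num u ->
  (u : X -> R^o) \in holder_pred gamma.
Proof. by move=> h; rewrite inE. Qed.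

Definition holder_of (u : X -> R) (h : is_holder gamma%:num u) : V :=
  Holder (holder_of_subproof h).

Definition ppow : V := holder_of (ex_intro _ _ (pt_powR_holder g0 gamma_le1)).

Lemma ppowE x : ppow x = pt x `^ gamma%:num. Proof. by []. Qed.

(** A Hoelder perturbation d of norm below e satisfies |d(x) - d(0)| <= e x^gamma, which is exactly
    the room created by subtracting e x^gamma. *)
Lemma perturb_interior phi (e : R) : D phi -> 0 < e -> D° (phi - e *: ppow).
Proof.
move=> Dphi e0; apply/holder_interiorP; exists e => // psi h.
apply: (dominated_le _ _ _ Dphi) => // x.
have := holder_dist0 (phi - e *: ppow - psi) x.
set d := phi - e *: ppow - psi in h *.
have dE z : d z = phi z - e * pt z `^ gamma%:num - psi z by [].
rewrite !dE [pt X0]/(0 : R) powR0 ?gt_eqF// mulr0 subr0.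
have : `|d| * pt x `^ gamma%:num <= e * pt x `^ gamma%:num.
  by rewrite ler_wpM2r ?powR_ge0// ltW.
by rewrite ler_norml => h1 /andP[h2 h3]; lra.
Qed.

Lemma dominated_closure : D = closure D°.
Proof.
apply/seteqP; split; last first.
  apply: subset_trans (closureS (@interior_subset _ D)) _.
  by have /closure_id <- := closed_dominated.
move=> phi Dphi B /nbhs_normP[r /= r0 hB].
pose e := r / (`|ppow| + 1); have N1 : 0 < `|ppow| + 1 by rewrite ltr_wpDl.
have e0 : 0 < e by rewrite divr_gt0.
exists (phi - e *: ppow); split; first exact: perturb_interior.
apply: hB => /=; rewrite opprB addrC subrK normrZ gtr0_norm// /e mulrAC ltr_pdivrMr//.
by rewrite ltr_pM2l// ltrDl.
Qed.

(** For small e the potential phi + e x^gamma is still dominated, so a Gibbs state mu for phi has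
    nonpositive integral of x^gamma. Hence mu is carried by 0. *)
Lemma interior_dominated_unique phi : D° phi -> unique_gibbs_state alpha phi (delta0 R).
Proof.
move=> iphi; have Dphi := interior_subset iphi.
split; first exact/delta0_gibbsP.
move=> mu [inv gib] A mA.
have gib' : (entropy f mu + (Ex mu phi)%:E = (phi X0)%:E)%E.
  by rewrite -free_energyE// gib -(free_energy_delta0 alpha)//; apply/esym; have [_] := (delta0_gibbsP alpha phi).2 Dphi.
have /holder_interiorP[r r0 hr] := iphi.
pose e := r / (`|ppow| + 1); have N1 : 0 < `|ppow| + 1 by rewrite ltr_wpDl.
have e0 : 0 < e by rewrite divr_gt0.
have De : D (phi + e *: ppow).
  apply: hr; rewrite opprD addNKr normrN normrZ gtr0_norm// /e mulrAC ltr_pdivrMr//.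
  by rewrite ltr_pM2l// ltrDl.
have ExE : Ex mu (phi + e *: ppow : V) = Ex mu phi + e * Ex mu ppow.
  by rewrite -ExZ// -ExD//; exact: bmZ.
have Ep : Ex mu ppow <= 0.
  have := De mu inv; rewrite ExE EFinD addeA gib' -EFinD lee_fin.
  rewrite (_ : (phi + e *: ppow) X0 = phi X0); last first.
    by change (phi X0 + e * pt X0 `^ gamma%:num = phi X0); rewrite [pt X0]/(0 : R) powR0 ?gt_eqF// mulr0 addr0.
  by rewrite gerDl pmulr_rle0.
have bp : bm ppow by exact: holder_bm'.
have cyl1 n : fine (mu (~` cyl alpha (nseq n false))) <= 0.
  have mC : measurable (~` cyl alpha (nseq n false)).
    by apply: measurableC; exact: measurable_cyl.
  have tn : 0 < pt (tpt n) `^ gamma%:num by rewrite powR_gt0// tpt_gt0.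
  rewrite -(pmulr_rle0 _ tn) -Ex_indic// -ExZ; last exact: bm_indic.
  apply: le_trans Ep; apply: Ex_le => //; first by apply: bmZ; exact: bm_indic.
  move=> x; rewrite ppowE indicE; case: (boolP (x \in _)) => [|_]; last first.
    by rewrite mulr0 powR_ge0.
  rewrite inE cyl_nseq /= => /negP; rewrite -ltNge mulr1 => h.
  by rewrite ge0_ler_powR ?nnegrE ?pt_ge0 ?(ltW h).
have mX0 : mu (~` [set X0 : X]) = 0%E.
  have cov : ~` [set X0 : X] `<=` \bigcup_n (~` cyl alpha (nseq n false)).
    move=> x /= xX0; apply: contrapT => nE; apply: xX0; apply/pt_inj/eqP.
    rewrite eq_le pt_ge0 andbT; apply/ler_addgt0Pr => e' e'0.
    have [n hn] := tpt_small alpha e'0; rewrite [pt X0]/(0 : R) add0r.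
    apply: le_trans (hn n (leqnn _)); rewrite leNgt; apply/negP => lt; apply: nE.
    by exists n => //; rewrite cyl_nseq /=; apply/negP; rewrite -ltNge.
  apply/eqP; rewrite eq_le measure_ge0 andbT.
  apply: (@le_trans _ _ (\sum_(n <oo) mu (~` cyl alpha (nseq n false)))%E).
    apply: measure_sigma_subadditive => //.
    - by move=> n; apply: measurableC; exact: measurable_cyl.
    - by apply: measurableC; exact: measurable_X0.
  rewrite eseries0// => n _ _; apply/eqP; rewrite eq_le measure_ge0 andbT.
  rewrite -[X in (X <= _)%E]fineK ?lee_fin// fin_num_measure//.
  by apply: measurableC; exact: measurable_cyl.
have nul B : measurable B -> ~ B X0 -> mu B = 0%E.
  move=> mB nB; apply/eqP; rewrite eq_le measure_ge0 andbT -mX0.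
  apply: le_measure; rewrite ?inE//; first by apply: measurableC; exact: measurable_X0.
  by move=> x Bx /= xE; apply: nB; rewrite -xE.
rewrite /delta0 /= diracE; case: (boolP (_ \in A)) => [|/negP] hA.
  have h : mu (~` A) = 0%E.
    by apply: nul; [exact: measurableC|move=> /=; apply; exact: set_mem].
  by rewrite -[A]setCK probability_setC ?h ?sube0//; exact: measurableC.
by apply: nul => // h; apply: hA; exact: mem_set.
Qed.

End phase_topology.

Section phases.
Context {R : realType} (alpha gamma : {posnum R}).
Hypothesis gamma_le1 : gamma%:num <= 1.
Local Notation X := (unit_itv R).
Local Notation f := (intermittent_map alpha).
Local Notation V := (holder gamma).
Local Notation D := (@dominated_set R alpha gamma).
Implicit Types (phi psi : V).

Let g0 : 0 < gamma%:num. Proof. by []. Qed.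

Lemma intermittent_phaseE : intermittent_phase alpha gamma = ~` D.
Proof. by apply/seteqP; split => phi /(intermittent_phaseP alpha gamma_le1). Qed.

Lemma delta0_gibbs_setE :
  [set phi : V | gibbs_state alpha phi (delta0 R)] = D.
Proof. by apply/seteqP; split => phi /= /delta0_gibbsP. Qed.

Lemma stationary_phaseE : stationary_phase alpha gamma = D°.
Proof.
apply/seteqP; split.
  by apply: interiorS => phi [+ _] => /delta0_gibbsP.
rewrite -[X in X `<=` _](iffLR (interior_id D°)); last exact: open_interior.
by apply: interiorS => phi; exact: interior_dominated_unique.
Qed.

Lemma intermittent_phase0 : intermittent_phase alpha gamma 0.
Proof. by rewrite intermittent_phaseE; exact: zero_not_dominated. Qed.

Lemma holder_conv (a b : R) phi psi mu :
  Ex mu (a *: phi + b *: psi : V) = a * Ex mu phi + b * Ex mu psi.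
Proof.
have b1 : bm phi by exact: (holder_bm alpha).
have b2 : bm psi by exact: (holder_bm alpha).
by rewrite -!ExZ// -ExD//; exact: bmZ.
Qed.

Lemma intermittent_star_convex : star_convex 0 (intermittent_phase alpha gamma).
Proof.
move=> phi t Iphi /andP[t0 t1].
have [->|tn0] := eqVneq t 0.
  by rewrite subr0 scale1r scale0r addr0; exact: intermittent_phase0.
have {tn0} t0 : 0 < t by rewrite lt_def tn0.
move: Iphi; rewrite intermittent_phaseE scaler0 add0r.
move=> /not_dominatedP[mu inv lt]; apply/not_dominatedP; exists mu => //.
have := entropy_ge0 alpha mu; move: lt.
have -> : Ex mu (t *: phi : V) = t * Ex mu phi.
  by rewrite -ExZ//; exact: (holder_bm alpha).
rewrite -[(t *: phi) X0]/(t * phi X0).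
case: (entropy f mu) => [r| |] //; last by rewrite !ltry.
rewrite -!EFinD !lte_fin lee_fin => h r0.
have h1 : t * phi X0 < t * (r + Ex mu phi) by rewrite ltr_pM2l.
have h2 : t * r <= r by rewrite ler_piMl.
by lra.
Qed.

Lemma dominated_convex phi psi (t : R) : 0 <= t <= 1 -> D phi -> D psi ->
  D (t *: phi + (1 - t) *: psi).
Proof.
move=> /andP[t0 t1] h1 h2 mu inv; have := h1 mu inv; have := h2 mu inv.
rewrite holder_conv.
rewrite -[(t *: phi + (1 - t) *: psi) X0]/(t * phi X0 + (1 - t) * psi X0).
case: (entropy f mu) => [r| |] //; last by rewrite !leNye.
rewrite -!EFinD !lee_fin => h3 h4.
have s0 : 0 <= 1 - t by rewrite subr_ge0.
have h5 := ler_wpM2l t0 h4; have h6 := ler_wpM2l s0 h3; lra.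
Qed.

Lemma stationary_convex phi psi (t : R) : 0 <= t <= 1 ->
  D° phi -> D° psi -> D° (t *: phi + (1 - t) *: psi).
Proof.
move=> t01 h1 h2; have /andP[t0 t1] := t01.
have [->|tn0] := eqVneq t 0.
  by rewrite scale0r add0r subr0 scale1r.
have {tn0} t0' : 0 < t by rewrite lt_def tn0.
move/holder_interiorP : h1 => [r r0 hr].
apply/holder_interiorP; exists (t * r); first exact: mulr_gt0.
move=> chi h.
(* The homothety centred at psi with ratio 1 / t sends chi to eta, which lies within r of phi. *)
pose eta := phi - t^-1 *: (t *: phi + (1 - t) *: psi - chi).
have -> : chi = t *: eta + (1 - t) *: psi.
  rewrite /eta scalerBr scalerA mulfV ?gt_eqF// scale1r opprB.
  by rewrite addrAC [RHS]addrC subrK.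
apply: dominated_convex => //; last exact: interior_subset h2.
apply: hr; rewrite opprB addrC subrK normrZ gtr0_norm ?invr_gt0//.
by rewrite ltr_pdivrMl.
Qed.

Lemma stationary_unbounded (psi : V) : D psi -> ~ bounded_set (D°).
Proof.
move=> Dpsi [M0 [_ hM]].
(* Adding a constant preserves domination and makes the value at 0 exceed the bound; subtracting
   x^gamma reaches the interior without changing that value. *)
pose c : R := `|M0| + 2 + `|psi X0|.
have hc : is_holder gamma%:num (fun x => psi x + c).
  have [A hA] := holderP psi; exists A => x y.
  by rewrite opprD addrACA subrr addr0; exact: hA.
pose phi : V := holder_of hc.
have bpsi : bm psi by exact: (holder_bm alpha).
have Dphi : D phi.
  apply: (dominated_le _ _ _ Dpsi) => //; first exact: (holder_bm alpha).
  by move=> x; rewrite /phi /= opprD addrACA subrr addr0.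
have := perturb_interior gamma_le1 Dphi ltr01.
set chi := (X in D° X) => Dchi.
have := hM (`|M0| + 1) _ chi Dchi.
move=> /(_ (ltac:(by rewrite ltr_pwDr// ler_norm))) /= h.
have := holder_ge chi X0.
have -> : chi X0 = psi X0 + c.
  change (psi X0 + c - 1 * pt X0 `^ gamma%:num = psi X0 + c).
  by rewrite [pt X0]/(0 : R) powR0 ?gt_eqF// mulr0 subr0.
have := ler_norm (psi X0 + c); have := ler_norm (- psi X0); rewrite normrN /c.
by lra.
Qed.

End phases.

Theorem proposition3p1 (R : realType) (alpha gamma : {posnum R})
    (gamma_le1 : gamma%:num <= 1) :
  let I := intermittent_phase alpha gamma in
  let S := stationary_phase alpha gamma in
  [/\ I 0 /\ I !=set0,
      alpha%:num < 1 -> alpha%:num < gamma%:num -> I = setT /\ S = set0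
    & gamma%:num <= alpha%:num ->
      [/\ S !=set0,
          star_convex 0 I /\ connected I,
          [/\ ~ bounded_set S, convex_set S,
              S = [set phi : holder gamma |
                    gibbs_state alpha phi (delta0 R)]°
            & connected S]
        & [/\ regopen I /\ regopen S,
              I `&` S = set0,
              dense (I `|` S),
              boundary I = boundary S
            & boundary S = ~` (I `|` S)]]].
Proof.
move=> I S; have IE : I = ~` @dominated_set R alpha gamma := intermittent_phaseE alpha gamma_le1.
have SE : S = (@dominated_set R alpha gamma)° := stationary_phaseE alpha gamma_le1.
have I0 : I 0 := intermittent_phase0 alpha gamma_le1.
have star : star_convex 0 I := intermittent_star_convex gamma_le1.
set D := @dominated_set R alpha gamma in IE SE.
have clD : closed D by exact: closed_dominated.
have DE : D = closure D° by exact: dominated_closure.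
have SD : S `<=` D by rewrite SE; exact: interior_subset.
have oI : open I by rewrite IE openC.
have oS : open S by rewrite SE; exact: open_interior.
have clS : closure S = D by rewrite SE -DE.
have clI : closure I = ~` S by rewrite IE closure_setC SE.
split; first by split => //; exists 0.
- move=> a1 ag; have D0 : D = set0.
    apply/seteqP; split => // phi; have [A hA] := holderP phi.
    exact: (never_dominated gamma_le1 hA ag).
  by rewrite IE SE D0 setC0 interior0.
move=> ga; have g0 : 0 < gamma%:num by [].
have [c hc] := dominated_ex g0 gamma_le1 ga.
have hp : is_holder gamma%:num (fun x => - (c * pt x `^ gamma%:num)).
  eexists; rewrite (_ : (fun x => _) = fun x => - c * pt x `^ gamma%:num).
    exact: holderZ (pt_powR_holder g0 gamma_le1).
  by apply/funext => x; rewrite mulNr.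
pose psi : holder gamma := holder_of hp.
have Dpsi : D psi by exact: hc.
have S0 : S (psi - 1 *: ppow gamma_le1) by rewrite SE; exact: perturb_interior.
have cS (phi chi : holder gamma) t : 0 <= t <= 1 -> S phi -> S chi ->
    S (t *: phi + (1 - t) *: chi).
  by rewrite SE; exact: stationary_convex.
split.
- by exists (psi - 1 *: ppow gamma_le1).
- by split => //; exact: (star_convex_connected I0 star).
- split.
  + by rewrite SE; exact: stationary_unbounded Dpsi.
  + move=> phi chi t; rewrite !inE => h1 h2; apply: cS => //.
    by apply/andP; split.
  + by rewrite SE delta0_gibbs_setE.
  + apply: (star_convex_connected S0) => phi t Sphi t01.
    by rewrite addrC; exact: cS.
split.
- split; last by rewrite SE; exact: interior_closed_regopen.
  by rewrite /regopen clI interiorC clS IE.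
- by apply/seteqP; split => // phi [+ /SD]; rewrite IE.
- move=> O [phi Ophi] oO.
  have [Dphi|nD] := pselect (D phi); last first.
    by exists phi; split => //; left; rewrite IE.
  have : closure S phi by rewrite clS.
  move=> /(_ O (open_nbhs_nbhs (conj oO Ophi)))[chi [Schi Ochi]].
  by exists chi; split => //; right.
- rewrite /boundary clI clS.
  have -> : I° = I by apply/interior_id.
  have -> : S° = S by apply/interior_id.
  by rewrite IE setDE setCK setDE setIC.
- rewrite /boundary clS; have -> : S° = S by apply/interior_id.
  by rewrite setCU IE setCK setDE.
Qed.
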